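(* Let $M$ be a smooth two-dimensional surface with boundary, equipped with an area form $\omega$, and let $f:M\to\mathbb R$ be a smooth function. Let $O\in\partial M$ be a point which is a regular point for $f$ and a non-degenerate critical point for the restriction $f|_{\partial M}$. Then there exists a chart $(p,q)$ centered at $O$, defined on a neighborhood $U$ of $O$ in $M$, such that $q\ge 0$ everywhere on $U$, the boundary is given by the equation $q=0$ (that is, $\partial M\cap U=\{q=0\}$), $\omega=dp\wedge dq$ on $U$, and $f=\alpha\circ S$ on $U$, where $S=q+p^2$ or $S=q-p^2$, and $\alpha$ is a function of one variable which is smooth in a neighborhood of the origin $0\in\mathbb R$ and satisfies $\alpha'(0)\neq 0$.
   Context: Smooth means $C^\infty$. An area form is a smooth nowhere vanishing differential 2-form. A chart $(p,q)$ is centered at $O$ if $p(O)=q(O)=0$. The point $O$ is regular for $f$ if $df\neq 0$ at $O$. *)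

(* Defs.v *)
From HB Require Import structures.
From mathcomp Require Import all_boot all_order all_algebra.
From mathcomp Require Import all_classical all_reals all_analysis.

Set Implicit Arguments.
Unset Strict Implicit.
Unset Printing Implicit Defensive.
Import Order.TTheory GRing.Theory Num.Theory.
Import numFieldNormedType.Exports.
Local Open Scope classical_set_scope.
Local Open Scope ring_scope.

Definition plane (R : realType) : normedModType R := (R^o * R^o)%type.

Definition half_plane (R : realType) : set (plane R) := [set x | 0 <= x.2].

Section Smoothness.
Context {R : realType} {V W : normedModType R}.

Fixpoint iter_derive (vs : seq V) (g : V -> W) : V -> W :=
  if vs is v :: vs' then 'D_v (iter_derive vs' g) else g.

(* Meant for A open and V finite-dimensional, where the existence and
   continuity of all iterated directional derivatives is C^oo. *)
Definition smooth_on (A : set V) (g : V -> W) : Prop :=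
  forall (vs : seq V) (x : V), A x ->
    {for x, continuous (iter_derive vs g)} /\
    forall v, derivable (iter_derive vs g) x v.

(* On a set D that need not be open, smooth means: locally the restriction of
   a smooth function on an open set. The values of g outside D are ignored. *)
Definition smooth_within (D : set V) (g : V -> W) : Prop :=
  forall x, D x -> exists (A : set V) (h : V -> W),
    [/\ open A, A x, smooth_on A h & forall y, A y -> D y -> g y = h y].

End Smoothness.

(* The differential of g at x applied to v, for g defined near x in the closed
   half-plane only: the limit runs over the h for which x + h v stays in the
   half-plane, so it is one-sided when x is on the edge and v is transverse to
   it, and is the usual 'D_v g x otherwise. *)
Definition half_diff (R : realType) (W : normedModType R)
    (g : plane R -> W) (x v : plane R) : W :=
  lim (h^-1 *: (g (h *: v + x) - g x) @[h --> within
        [set h : R | half_plane (h *: v + x)] (0 : R)^']).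

(* A homeomorphism from an open subset of T onto a relatively open subset of
   the closed half-plane. chart_map and chart_inv are meaningful only on
   chart_dom and chart_img respectively. *)
Record chart (R : realType) (T : topologicalType) := Chart {
  chart_dom : set T ;
  chart_map : T -> plane R ;
  chart_inv : plane R -> T ;
  chart_dom_open : open chart_dom ;
  chart_img_open : exists A : set (plane R),
    open A /\ chart_map @` chart_dom = A `&` @half_plane R ;
  chart_mapK : forall m, chart_dom m -> chart_inv (chart_map m) = m ;
  chart_map_cont : {within chart_dom, continuous chart_map} ;
  chart_inv_cont : {within chart_map @` chart_dom, continuous chart_inv} }.

Definition chart_img (R : realType) (T : topologicalType) (c : chart R T) :
  set (plane R) := chart_map c @` chart_dom c.

Definition transition (R : realType) (T : topologicalType) (c d : chart R T) :
  plane R -> plane R := chart_map d \o chart_inv c.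

Definition compatible (R : realType) (T : topologicalType) (c d : chart R T) :
    Prop :=
  smooth_within (chart_map c @` (chart_dom c `&` chart_dom d))
    (transition c d) /\
  smooth_within (chart_map d @` (chart_dom c `&` chart_dom d))
    (transition d c).

(* Smooth two-dimensional manifolds with (possibly empty) boundary. The atlas
   need not be maximal. *)
Record surface (R : realType) := Surface {
  surface_space :> topologicalType ;
  atlas : set (chart R surface_space) ;
  surface_hausdorff : hausdorff_space surface_space ;
  surface_second_countable : @second_countable surface_space ;
  atlas_cover : forall m, exists2 c, atlas c & chart_dom c m ;
  atlas_compatible : forall c d, atlas c -> atlas d -> compatible c d }.

Section Surface.
Context {R : realType} {M : surface R}.

Definition smooth_chart (c : chart R M) : Prop :=
  forall d, atlas d -> compatible c d.

Definition boundary : set M :=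
  [set m | exists c : chart R M,
    [/\ atlas c, chart_dom c m & (chart_map c m).2 = 0]].

Definition smooth_fun (f : M -> R) : Prop :=
  forall c : chart R M, atlas c ->
    smooth_within (chart_img c) (f \o chart_inv c : plane R -> R^o).

(* The components of the covector d_m f in the chart c: its value on the
   tangent vector at m with coordinates u. *)
Definition diff_in (c : chart R M) (f : M -> R) (m : M) (u : plane R) : R :=
  half_diff (f \o chart_inv c : plane R -> R^o) (chart_map c m) u.

Definition regular_point (f : M -> R) (m : M) : Prop :=
  exists c : chart R M,
    [/\ atlas c, chart_dom c m & exists u, diff_in c f m u != 0].

(* The restriction of f to the boundary, in the coordinate t that c induces on
   the boundary. *)
Definition on_boundary (c : chart R M) (f : M -> R) (t : R) : R^o :=
  f (chart_inv c (t, 0)).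

Definition nondegenerate_boundary_critical_point (f : M -> R) (m : M) : Prop :=
  exists c : chart R M,
    [/\ atlas c, chart_dom c m, (chart_map c m).2 = 0,
        derive1 (on_boundary c f) (chart_map c m).1 = 0 &
        derive1n 2 (on_boundary c f) (chart_map c m).1 != 0].

(* w c m u v is the value of the form at m on the pair of tangent vectors with
   coordinates u and v in the chart c; it is meaningful only for c in the atlas
   and m in the domain of c. *)
Definition form_family := chart R M -> M -> plane R -> plane R -> R^o.

Record two_form (w : form_family) : Prop := TwoForm {
  two_form_linearl : forall c m v, atlas c -> chart_dom c m ->
    linear (fun u => w c m u v) ;
  two_form_linearr : forall c m u, atlas c -> chart_dom c m ->
    linear (w c m u) ;
  two_form_alternating : forall c m u, atlas c -> chart_dom c m ->
    w c m u u = 0 ;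
  two_form_change : forall c d m u v, atlas c -> atlas d ->
    chart_dom c m -> chart_dom d m ->
    w c m u v = w d m (half_diff (transition c d) (chart_map c m) u)
                      (half_diff (transition c d) (chart_map c m) v) }.

Definition smooth_form (w : form_family) : Prop :=
  forall c u v, atlas c ->
    smooth_within (chart_img c) (fun x => w c (chart_inv c x) u v).

Definition nowhere_vanishing (w : form_family) : Prop :=
  forall c m, atlas c -> chart_dom c m -> exists u v, w c m u v != 0.

Definition area_form (w : form_family) : Prop :=
  [/\ two_form w, smooth_form w & nowhere_vanishing w].

(* The form dp /\ dq. *)
Definition wedge_diff (p q : M -> R) : form_family := fun c m u v =>
  diff_in c p m u * diff_in c q m v - diff_in c p m v * diff_in c q m u.

Definition form_eq_on (U : set M) (w1 w2 : form_family) : Prop :=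
  forall c m u v, atlas c -> chart_dom c m -> U m -> w1 c m u v = w2 c m u v.

End Surface.

Arguments boundary {R} M.
Arguments form_family {R} M.

(* Main.v *)
Require Import Defs.
From HB Require Import structures.
From mathcomp Require Import all_boot all_order all_algebra.
From mathcomp Require Import all_classical all_reals all_analysis.
From mathcomp Require Import ring lra zify.

Set Implicit Arguments.
Unset Strict Implicit.
Unset Printing Implicit Defensive.
Import Order.TTheory GRing.Theory Num.Theory.
Import numFieldNormedType.Exports.
Local Open Scope classical_set_scope.
Local Open Scope ring_scope.

(** Near O the function and the area form extend smoothly across the boundary,
so that they become germs f and rho dx /\ dy at the origin of the plane, where
the boundary is y = 0. The hypotheses at O say that the x-derivative of f
vanishes at 0, that f is still regular there, so that f_y <> 0, and that f(x, 0)
has a non-degenerate critical point.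

Then s = +-(f - f(0)), with the sign for which s_y > 0, can replace y as second
coordinate, and the form is u dx /\ ds for some germ u (straighten). The
coordinates are sought as p = P(x, s) and q = beta(s) - eps p^2, with eps = +-1
and beta a germ of one variable such that beta'(0) > 0. The sum q + eps p^2 =
beta(s) is a function of f, so that alpha is essentially the inverse of beta.
Moreover dp /\ dq = P_x beta'(s) dx /\ ds, and the condition on the area form
is solved by P = (K - c(s)) / beta'(s), where K is a primitive of u in the
variable x and c is arbitrary. What remains is to choose beta and c so that q
vanishes on the boundary.

By the Morse lemma on the boundary (morse1) there is a parameter v in which
s = eps v^2; let N(v) be the restriction of K to the boundary. The condition
reads beta(eps v^2) = eps ((N(v) - c(eps v^2)) / beta'(eps v^2))^2, and it is
solved in boundary_equation. The even part of N is taken for c(eps v^2); the odd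
part of N, which is half of the integral of u along the level curve s = eps v^2
between its two boundary points, then determines beta by a first order
differential equation whose smooth solution is an explicit average. That c and
beta are smooth in s, and not only in v, is Whitney's theorem: a smooth even
function of v is a smooth function of v^2 (whitney_even). It follows from
Borel's theorem, which reduces it to functions whose derivatives all vanish at
the origin; such a function of the square root of s is smooth.

The coordinate change (p, q) is inverted by composing inverses of shears
(x, y) -> (x, F(x, y)), which the implicit function theorem provides
(shear_inverse). As q vanishes on the boundary and q_y > 0, the sign of q is
that of y. On the surface, the new chart is the composite of a chart of the
atlas with (p, q); the boundary is the same in all charts because a coordinate
change cannot send an interior point of the half-plane to its edge
(boundary_invariant). *)

(** * Germs of class C^n *)

Section Criterion.
Context {R : realType} {V W : normedModType R}.

(** The operator 'd chooses a differential, so that its value has to be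
identified by uniqueness of the linear part; a remainder estimate does this. *)
Lemma diff_crit (f : V -> W) (x : V) (L : {linear V -> W}) :
  continuous L ->
  (forall e, 0 < e -> \forall h \near (0 : V),
     `|f (h + x) - f x - L h| <= e * `|h|) ->
  differentiable f x /\ 'd f x = L :> (V -> W).
Proof.
move=> cL H.
have E : f \o shift x = cst (f x) + L +o_ (0 : V) id.
  apply/eqaddoP => e e0; have := H _ e0.
  by apply: filterS => h; rewrite !fctE /= opprD addrA.
have dE := diff_unique cL E; split => //.
by apply/diff_locallyP; rewrite dE; split => //; rewrite E.
Qed.

Lemma diff_near_eq (f g : V -> W) (x : V) :
  (\forall y \near x, f y = g y) -> differentiable f x ->
  differentiable g x /\ 'd g x = 'd f x :> (V -> W).
Proof.
move=> fg df; apply: diff_crit; first exact: diff_continuous.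
move=> e e0.
have [_ E] := iffLR (diff_locallyP _ _) df.
move/eqaddoP : E => /(_ _ e0).
have : \forall h \near (0 : V), f (h + x) = g (h + x).
  have := fg; rewrite (near_shift 0 x).
  by apply: filterS => h; rewrite /= subr0.
apply: filterS2 => h; rewrite !fctE /= => fgh; rewrite -fgh (nbhs_singleton fg).
by rewrite opprD addrA.
Qed.
End Criterion.

Lemma near_all {R : realType} {V : normedModType R} (x : V) (P : set V) :
  (forall y, P y) -> \forall y \near x, P y.
Proof. by move=> aP; apply: nearW. Qed.

Lemma near_normP {R : realType} {V : normedModType R} (x : V) (P : set V) :
  (\forall y \near x, P y) <-> exists2 r : R, 0 < r & forall h, `|h| < r -> P (h + x).
Proof.
split.
  move=> /(iffLR (nbhs_normP _ _))[r r0 rP]; exists r => // h hr.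
  by apply: rP; rewrite /ball_ /= opprD addrCA subrr addr0 normrN.
move=> [r r0 rP]; apply/(iffRL (nbhs_normP _ _)); exists r => // y.
by rewrite /ball_ /= distrC => /rP; rewrite subrK.
Qed.

Lemma near0_normP {R : realType} {V : normedModType R} (P : set V) :
  (\forall y \near (0 : V), P y) <-> exists2 r : R, 0 < r & forall h, `|h| < r -> P h.
Proof.
split=> [/near_normP[r r0 rP]|[r r0 rP]]; last first.
  by apply/near_normP; exists r => // h /rP; rewrite addr0.
by exists r => // h /rP; rewrite addr0.
Qed.

Lemma near_cvg {T U : Type} {F : set_system T} {G : set_system U} (f : T -> U)
    (P : set U) :
  f @ F --> G -> (\forall y \near G, P y) -> \forall x \near F, P (f x).
Proof. by move=> fFG; exact: fFG. Qed.

Lemma near_imp {R : realType} {V : normedModType R} (x : V) (P Q : set V) :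
  (\forall y \near x, P y) -> (forall y, P y -> Q y) -> \forall y \near x, Q y.
Proof. by move=> nP PQ; apply: filterS nP. Qed.

Lemma near_and {R : realType} {V : normedModType R} (x : V) (P Q : set V) :
  (\forall y \near x, P y) -> (\forall y \near x, Q y) ->
  \forall y \near x, P y /\ Q y.
Proof. by move=> nP nQ; exact: filterI. Qed.

Lemma near_open {R : realType} {V : normedModType R} (x : V) (P : set V) : (\forall y \near x, P y) ->
  exists A : set V, [/\ open A, A x & forall w : V, A w -> P w].
Proof.
move=> nP; exists (P°); split; first exact: open_interior.
  exact: nP.
by move=> y; exact: interior_subset.
Qed.

Section Class.
Context {R : realType} {V : normedModType R}.
Implicit Types (f g : V -> R^o) (x y v : V) (n : nat).

(** Order n + 1 asks for order n of the differentials along each fixed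
direction. With differentials rather than partial derivatives, sums, products
and composites are handled by induction on n. *)
Fixpoint class_at n x g : Prop :=
  if n is n'.+1 then
    (\forall y \near x, differentiable g y) /\
    forall v, class_at n' x (fun y => 'd g y v)
  else \forall y \near x, {for y, continuous g}.

Lemma class_at0 x g : class_at 0 x g <-> \forall y \near x, {for y, continuous g}.
Proof. by []. Qed.

Lemma continuous_class_at0 x g : continuous g -> class_at 0 x g.
Proof. by move=> cg; apply/class_at0; apply: nearW. Qed.

Lemma class_atS n x g : class_at n.+1 x g <->
  (\forall y \near x, differentiable g y) /\
    forall v, class_at n x (fun y => 'd g y v).
Proof. by []. Qed.

Definition smooth_at x g : Prop := forall n, class_at n x g.

Lemma diffDv f g x v : differentiable f x -> differentiable g x ->
  'd (fun y => f y + g y) x v = 'd f x v + 'd g x v.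
Proof. by move=> df dg; have /(congr1 (fun L => L v)) := diffD df dg. Qed.

Lemma diffMv f g x v : differentiable f x -> differentiable g x ->
  'd (fun y => f y * g y) x v = f x * 'd g x v + g x * 'd f x v.
Proof. by move=> df dg; have /(congr1 (fun L => L v)) := diffM df dg. Qed.

Lemma class_at_ext n x f g :
  (\forall y \near x, f y = g y) -> class_at n x f -> class_at n x g.
Proof.
elim: n f g => [|n IHn] f g /near_join fg /=.
  apply: filterS2 fg => y fg cf.
  change (g z @[z --> y] --> g y); rewrite -(nbhs_singleton fg).
  apply: cvg_trans cf; apply: near_eq_cvg; apply: filterS fg => z ->//.
move=> [df cf]; split.
  by apply: filterS2 fg df => y fg df; have [] := diff_near_eq fg df.
move=> v; apply: IHn (cf v).
apply: filterS2 fg df => y fg df; have [_ E] := diff_near_eq fg df.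
exact (esym (congr1 (fun L : V -> R^o => L v) E)).
Qed.

Lemma smooth_at_ext x f g :
  (\forall y \near x, f y = g y) -> smooth_at x f -> smooth_at x g.
Proof. by move=> fg sf n; apply: class_at_ext fg (sf n). Qed.

Lemma class_at_diff n x f :
  class_at n.+1 x f -> \forall y \near x, differentiable f y.
Proof. by case. Qed.

Lemma class_atW n x f : class_at n.+1 x f -> class_at n x f.
Proof.
elim: n f => [|n IHn] f /= [df cf].
  by apply: filterS df => y; exact: differentiable_continuous.
by split=> // v; apply/IHn/cf.
Qed.

Lemma class_at_cont n x f : class_at n x f ->
  \forall y \near x, {for y, continuous f}.
Proof. by elim: n => // n IHn /class_atW. Qed.

Lemma class_at_cst n x (a : R) : class_at n x (cst (a : R^o)).
Proof.
elim: n a => [|n IHn] a /=; first by apply: nearW => y; exact: cvg_cst.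
split=> [|v]; first by apply: nearW => y; exact: differentiable_cst.
by apply: class_at_ext (IHn 0); apply: nearW => y; rewrite diff_cst.
Qed.

Lemma class_at_lin n x (L : {linear V -> R^o}) : continuous L -> class_at n x L.
Proof.
move=> cL; case: n => [|n] /=; first by apply: nearW.
split=> [|v]; first by apply: nearW => y; exact: linear_differentiable.
by apply: class_at_ext (class_at_cst n x (L v)); apply: nearW => y; rewrite diff_lin.
Qed.

Lemma class_atD n x f g : class_at n x f -> class_at n x g ->
  class_at n x (fun y => f y + g y).
Proof.
elim: n f g => [|n IHn] f g /=.
  by apply: filterS2 => y; exact: continuousD.
move=> [df cf] [dg cg]; split.
  by apply: filterS2 df dg => y; exact: differentiableD.
move=> v; apply: class_at_ext (IHn _ _ (cf v) (cg v)).
by apply: filterS2 df dg => y df dg; exact (esym (diffDv v df dg)).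
Qed.

Lemma class_atM n x f g : class_at n x f -> class_at n x g ->
  class_at n x (fun y => f y * g y).
Proof.
elim: n f g => [|n IHn] f g.
  by rewrite /=; apply: filterS2 => y; exact: continuousM.
move=> cnf cng; have [df cf] := iffLR (class_atS _ _ _) cnf;
  have [dg cg] := iffLR (class_atS _ _ _) cng; split.
  by apply: filterS2 df dg => y; exact: differentiableM.
move=> v; have := class_atD (IHn _ _ (class_atW cnf) (cg v))
                            (IHn _ _ (class_atW cng) (cf v)).
apply: class_at_ext.
by apply: filterS2 df dg => y df dg; exact (esym (diffMv v df dg)).
Qed.

Lemma smooth_at_cst x (a : R) : smooth_at x (fun=> (a : R^o)).
Proof. move=> n; exact: class_at_cst. Qed.

Lemma smooth_atD x f g : smooth_at x f -> smooth_at x g ->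
  smooth_at x (fun y => f y + g y).
Proof. by move=> sf sg n; apply: class_atD. Qed.

Lemma smooth_atM x f g : smooth_at x f -> smooth_at x g ->
  smooth_at x (fun y => f y * g y).
Proof. by move=> sf sg n; apply: class_atM. Qed.

Lemma smooth_atN x f : smooth_at x f -> smooth_at x (fun y => - f y).
Proof.
move=> sf; apply: smooth_at_ext (smooth_atM (smooth_at_cst x (-1)) sf).
by apply: nearW => y; rewrite mulN1r.
Qed.

Lemma smooth_atB x f g : smooth_at x f -> smooth_at x g ->
  smooth_at x (fun y => f y - g y).
Proof. by move=> sf sg; apply/smooth_atD/smooth_atN. Qed.

Lemma smooth_atX x f k : smooth_at x f -> smooth_at x (fun y => f y ^+ k).
Proof.
move=> sf; elim: k => [|k IHk].
  by apply: smooth_at_ext (smooth_at_cst x 1); apply: nearW => y; rewrite expr0.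
apply: smooth_at_ext (smooth_atM sf IHk).
by apply: nearW => y; rewrite exprS.
Qed.

Lemma smooth_at_diff x f : smooth_at x f ->
  \forall y \near x, differentiable f y.
Proof. by move=> sf; exact: (class_at_diff (sf 1%N)). Qed.

Lemma smooth_at_differentiable x f : smooth_at x f -> differentiable f x.
Proof. by move=> sf; exact: (nbhs_singleton (smooth_at_diff sf)). Qed.

Lemma smooth_at_cont x f : smooth_at x f -> {for x, continuous f}.
Proof. by move=> sf; exact: (nbhs_singleton (sf 0)). Qed.

Lemma smooth_at_d x f v : smooth_at x f -> smooth_at x (fun y => 'd f y v).
Proof. by move=> sf n; exact: (iffLR (class_atS n x f) (sf n.+1)).2. Qed.

End Class.

Section Comp1.
Context {R : realType} {V : normedModType R}.

Lemma diff_scalar (g : R^o -> R^o) (y a : R^o) : 'd g y a = a * 'd g y 1.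
Proof.
have := linearZ_LR ('d g y) a (1 : R^o).
by rewrite [a *: (1 : R^o)](mulr1 a).
Qed.

Lemma diff_plane (g : plane R -> R^o) (z v : plane R) :
  'd g z v = v.1 * 'd g z (1, 0) + v.2 * 'd g z (0, 1).
Proof.
have {1}-> : v = v.1 *: ((1, 0) : plane R) + v.2 *: ((0, 1) : plane R).
  case: v => a b; congr pair => /=.
    by rewrite [X in X + _](mulr1 a) [X in _ + X](mulr0 b) addr0.
  by rewrite [X in X + _](mulr0 a) [X in _ + X](mulr1 b) add0r.
rewrite linearD; congr (_ + _); exact: linearZ_LR.
Qed.

Lemma diff_comp1v (g : R^o -> R^o) (h : V -> R^o) y v :
  differentiable h y -> differentiable g (h y) ->
  'd (fun y => g (h y)) y v = 'd h y v * 'd g (h y) 1.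
Proof.
move=> dh dg; have /(congr1 (fun L => L v)) := diff_comp dh dg.
move=> E; apply: (etrans E); exact: diff_scalar.
Qed.

Lemma diff_comp2v (g : plane R -> R^o) (h1 h2 : V -> R^o) y v :
  differentiable h1 y -> differentiable h2 y ->
  differentiable g (h1 y, h2 y) ->
  'd (fun y => g (h1 y, h2 y)) y v =
  'd h1 y v * 'd g (h1 y, h2 y) (1, 0) + 'd h2 y v * 'd g (h1 y, h2 y) (0, 1).
Proof.
move=> dh1 dh2 dg.
have dh := differentiable_pair dh1 dh2.
have /(congr1 (fun L => L v)) E :=
  @diff_comp _ _ _ _ (fun y => (h1 y, h2 y)) g y dh dg.
apply: (etrans E).
have /(congr1 (fun L => L v)) E' := diff_pair dh1 dh2.
have {}E' : 'd (fun y0 => (h1 y0, h2 y0)) y v = ('d h1 y v, 'd h2 y v) := E'.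
rewrite [LHS]/comp E'; exact: diff_plane.
Qed.

(** The differential of g \o h is the product of that of h with a composite of
the same shape, in which g is replaced by its derivative. *)
Lemma class_at_comp1 n x (g : R^o -> R^o) (h : V -> R^o) :
  class_at n (h x) g -> class_at n x h -> class_at n x (g \o h).
Proof.
elim: n g h => [|n IHn] g h cg ch.
  have /nbhs_singleton chx := ch.
  have := chx _ cg; rewrite nbhs_filterE /=.
  by apply: filterS2 ch => y ch1 cg1; exact: continuous_comp.
have /nbhs_singleton chx := class_at_cont ch.
have [dg cg'] := iffLR (class_atS _ _ _) cg.
have [dh ch'] := iffLR (class_atS _ _ _) ch.
have dg' := chx _ dg.
split; first by apply: filterS2 dh dg' => y dh1 dg1; exact: differentiable_comp.
move=> v; have := class_atM (ch' v) (IHn _ _ (cg' 1) (class_atW ch)).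
apply: class_at_ext; apply: filterS2 dh dg' => y dh1 dg1.
exact (esym (diff_comp1v v dh1 dg1)).
Qed.

Lemma smooth_at_comp1 x (g : R^o -> R^o) (h : V -> R^o) :
  smooth_at (h x) g -> smooth_at x h -> smooth_at x (fun y => g (h y)).
Proof. by move=> sg sh n; exact: class_at_comp1. Qed.

Lemma cvg_pair2 x (h1 h2 : V -> R^o) (P : set (plane R)) :
  {for x, continuous h1} -> {for x, continuous h2} ->
  (\forall z \near (h1 x, h2 x), P z) -> \forall y \near x, P (h1 y, h2 y).
Proof.
move=> c1 c2 nP.
have c : (fun y => (h1 y, h2 y)) @ x --> (h1 x, h2 x).
  exact: (@cvg_pair _ _ _ (nbhs x) (nbhs (h1 x)) (nbhs (h2 x)) _ _ _ h1 h2 c1 c2).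
exact: (c _ nP).
Qed.

Lemma class_at_comp2 n x (g : plane R -> R^o) (h1 h2 : V -> R^o) :
  class_at n (h1 x, h2 x) g -> class_at n x h1 -> class_at n x h2 ->
  class_at n x (fun y => g (h1 y, h2 y)).
Proof.
elim: n g h1 h2 => [|n IHn] g h1 h2 cg ch1 ch2.
  have c1 := nbhs_singleton ch1; have c2 := nbhs_singleton ch2.
  have cgh : \forall y \near x, {for (h1 y, h2 y), continuous g}.
    exact: (cvg_pair2 c1 c2 cg).
  apply: filterS3 ch1 ch2 cgh => y c1y c2y cgy.
  apply: (@continuous_comp _ _ _ (fun y => (h1 y, h2 y))) => //.
  exact: (@cvg_pair _ _ _ (nbhs y) (nbhs (h1 y)) (nbhs (h2 y)) _ _ _ h1 h2).
have c1 := nbhs_singleton (class_at_cont ch1).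
have c2 := nbhs_singleton (class_at_cont ch2).
have [dg cg'] := iffLR (class_atS _ _ _) cg.
have [dh1 ch1'] := iffLR (class_atS _ _ _) ch1.
have [dh2 ch2'] := iffLR (class_atS _ _ _) ch2.
have dg' : \forall y \near x, differentiable g (h1 y, h2 y).
  exact: (cvg_pair2 c1 c2 dg).
have dh : \forall y \near x, differentiable (fun y => (h1 y, h2 y)) y.
  by apply: filterS2 dh1 dh2 => y; exact: differentiable_pair.
split.
  apply: filterS2 dh dg' => y dhy dgy.
  exact: (@differentiable_comp _ _ _ _ (fun y => (h1 y, h2 y)) g).
move=> v.
have := class_atD
  (class_atM (ch1' v) (IHn _ _ _ (cg' (1, 0)) (class_atW ch1) (class_atW ch2)))
  (class_atM (ch2' v) (IHn _ _ _ (cg' (0, 1)) (class_atW ch1) (class_atW ch2))).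
apply: class_at_ext; apply: filterS3 dh1 dh2 dg' => y dh1y dh2y dgy.
exact (esym (diff_comp2v v dh1y dh2y dgy)).
Qed.

Lemma smooth_at_comp2 x (g : plane R -> R^o) (h1 h2 : V -> R^o) :
  smooth_at (h1 x, h2 x) g -> smooth_at x h1 -> smooth_at x h2 ->
  smooth_at x (fun y => g (h1 y, h2 y)).
Proof. by move=> sg sh1 sh2 n; exact: class_at_comp2. Qed.

End Comp1.

(** * Smooth functions of one variable *)

Section OneVar.
Context {R : realType}.
Implicit Types (f g : R^o -> R^o) (x y : R^o).

Lemma diff_is_derive g x (a : R) : is_derive (x : R) 1 (g : R -> R) a ->
  differentiable g x /\ 'd g x 1 = a.
Proof.
move=> dg; have dx : derivable g x 1 by exact: ex_derive.
have dfx : differentiable g x by apply/derivable1_diffP.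
split => //; rewrite -deriveE //; exact: derive_val.
Qed.

Lemma is_derive_diff g x : differentiable g x ->
  is_derive (x : R) 1 (g : R -> R) ('d g x 1).
Proof.
move=> dg; split; first by apply/derivable1_diffP.
by rewrite deriveE.
Qed.

Lemma smooth_at_is_derive x g : smooth_at x g ->
  is_derive (x : R) 1 (g : R -> R) (derive1 (g : R -> R) x).
Proof.
move=> /smooth_at_differentiable dg.
have h := is_derive_diff dg; apply: is_derive_eq h _.
by rewrite derive1E deriveE.
Qed.

Lemma diff_derive1 x g : smooth_at x g -> 'd g x 1 = derive1 (g : R -> R) x.
Proof. by move=> /smooth_at_is_derive/diff_is_derive[]. Qed.

(** This turns the derivative formulas of the elementary functions into their
smoothness. *)
Lemma class_at_derive n x f g :
  (\forall y \near x, is_derive (y : R) 1 (f : R -> R) (g y)) ->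
  class_at n x g -> class_at n.+1 x f.
Proof.
move=> dfg cg; apply/class_atS; split.
  by apply: filterS dfg => y /diff_is_derive[].
move=> v; have cv := class_at_cst n x v.
apply: class_at_ext (class_atM cv cg).
apply: filterS dfg => y /diff_is_derive[_ dg].
by rewrite diff_scalar dg.
Qed.

Lemma smooth_at_derive1 x f : smooth_at x f -> smooth_at x (derive1 (f : R -> R)).
Proof.
move=> sf; apply: (smooth_at_ext _ (smooth_at_d (1 : R^o) sf)).
apply: filterS (smooth_at_diff sf) => y df.
by rewrite derive1E deriveE.
Qed.

Lemma smooth_at_id x : smooth_at x (fun y => y).
Proof.
case=> [|n]; first by apply: continuous_class_at0 => y; exact: cvg_id.
apply: class_at_derive (class_at_cst n x 1).
by apply: near_all => y; exact: is_derive_id.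
Qed.

Lemma smooth_at_expR x : smooth_at x (expR : R^o -> R^o).
Proof.
elim=> [|n IHn]; first by apply: continuous_class_at0; exact: continuous_expR.
apply: class_at_derive IHn; apply: near_all => y; exact: is_derive_expR.
Qed.

Lemma smooth_at_inv x : x != 0 -> smooth_at x (fun y => y^-1 : R^o).
Proof.
move=> x0; have nx : \forall y \near x, y != 0 :> R.
  by apply: (@cvgr_neq0 R R _ (nbhs x) _ id x).
elim=> [|n IHn].
  by apply: filterS nx => y y0; exact: inv_continuous.
apply: (@class_at_derive _ _ _ (fun y => - 1 * (y^-1 * y^-1))).
  apply: filterS nx => y y0.
  have := @is_deriveV R id y 1 1 y0 (is_derive_id _ _).
  move=> h; apply: is_derive_eq h _.
  by rewrite scaler1 expr2 invfM mulN1r.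
exact: (class_atM (class_at_cst n x (-1)) (class_atM IHn IHn)).
Qed.

Lemma smooth_at_ln x : 0 < x -> smooth_at x (@ln R : R^o -> R^o).
Proof.
move=> x0; case=> [|n].
  have : \forall y \near x, 0 < y :> R by exact: (@cvgr_gt R _ (nbhs x) _ id x).
  by apply: filterS => y; exact: continuous_ln.
apply: (@class_at_derive _ _ _ (fun y => y^-1)); last exact: (smooth_at_inv (lt0r_neq0 x0) n).
have : \forall y \near x, 0 < y :> R by exact: (@cvgr_gt R _ (nbhs x) _ id x).
by apply: filterS => y; exact: is_derive1_ln.
Qed.

End OneVar.

Section MoreClosure.
Context {R : realType} {V : normedModType R}.

Lemma smooth_atV (x : V) (f : V -> R^o) : f x != 0 -> smooth_at x f ->
  smooth_at x (fun y => (f y)^-1).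
Proof. by move=> fx0 sf; exact: (smooth_at_comp1 (smooth_at_inv fx0) sf). Qed.

Lemma smooth_at_div (x : V) (f g : V -> R^o) : g x != 0 ->
  smooth_at x f -> smooth_at x g -> smooth_at x (fun y => f y / g y).
Proof. by move=> gx0 sf sg; apply: smooth_atM => //; exact: smooth_atV. Qed.

Lemma smooth_at_fst (z : plane R) : smooth_at z (fun w : plane R => w.1).
Proof.
move=> n; apply: (@class_at_lin R (plane R) n z (fst : {linear plane R -> R^o})).
by move=> w; exact: cvg_fst.
Qed.

Lemma smooth_at_snd (z : plane R) : smooth_at z (fun w : plane R => w.2).
Proof.
move=> n; apply: (@class_at_lin R (plane R) n z (snd : {linear plane R -> R^o})).
by move=> w; exact: cvg_snd.
Qed.

Lemma diff_fstv (z v : plane R) : 'd (fun w : plane R => w.1 : R^o) z v = v.1.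
Proof.
have c : continuous (fst : {linear plane R -> R^o}) by move=> w; exact: cvg_fst.
by have /(congr1 (fun L => L v)) := diff_lin z c.
Qed.

Lemma diff_sndv (z v : plane R) : 'd (fun w : plane R => w.2 : R^o) z v = v.2.
Proof.
have c : continuous (snd : {linear plane R -> R^o}) by move=> w; exact: cvg_snd.
by have /(congr1 (fun L => L v)) := diff_lin z c.
Qed.

End MoreClosure.

(** * Iterated directional derivatives *)

Section MVTdir.
Context {R : realType} {V : normedModType R}.

Lemma is_derive_line (g : V -> R^o) (z e : V) (t : R) :
  derivable g (t *: e + z) e ->
  is_derive t 1 (fun s : R => g (s *: e + z) : R) ('D_e g (t *: e + z)).
Proof.
move=> dg.
have E : (fun h : R => h^-1 *: (((fun s : R => g (s *: e + z)) \o shift t) (h *: 1) - g (t *: e + z) : R^o))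
  = (fun h => h^-1 *: ((g \o shift (t *: e + z)) (h *: e) - g (t *: e + z))).
  apply/funext => h /=; congr (_ *: (g _ - _)).
  by rewrite [h *: 1](mulr1 h) scalerDl addrA.
split; first by rewrite /derivable E.
by rewrite /derive E.
Qed.

(** Covers both signs of h, since a partial increment has any sign. *)
Lemma MVT_dir (g : V -> R^o) (z e : V) (h : R) :
  (forall t : R, `|t| <= `|h| -> derivable g (t *: e + z) e) ->
  exists2 t : R, `|t| <= `|h| & g (h *: e + z) - g z = h * 'D_e g (t *: e + z).
Proof.
move=> dg; pose psi := fun s : R => g (s *: e + z) : R.
have psi0 : psi 0 = g z by rewrite /psi scale0r add0r.
have dpsi (t : R) : `|t| <= `|h| -> is_derive t (1 : R) psi ('D_e g (t *: e + z)).
  by move=> /dg; exact: is_derive_line.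
have cpsi (a b : R) : (forall t : R, t \in `[a, b] -> `|t| <= `|h|) ->
    {within `[a, b], continuous psi}.
  move=> H; apply: derivable_within_continuous => t /H /dpsi dt.
  exact: ex_derive.
have [h0|h0] := leP 0 h.
  have H (t : R) : t \in `[0, h] -> `|t| <= `|h|.
    by rewrite in_itv /= => /andP[t0 th]; rewrite !ger0_norm.
  have [|c cI E] := @MVT_segment R psi (fun t => 'D_e g (t *: e + z)) 0 h h0 _ (cpsi _ _ H).
    by move=> t tI; apply: dpsi; apply: H; exact: subset_itv_oo_cc tI.
  exists c; first exact: H.
  by move: E; rewrite psi0 subr0 mulrC.
have H (t : R) : t \in `[h, 0] -> `|t| <= `|h|.
  by rewrite in_itv /= => /andP[t0 th]; rewrite !ler0_norm ?lerN2 // ltW.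
have [|c cI E] := @MVT_segment R psi (fun t => 'D_e g (t *: e + z)) h 0 (ltW h0) _ (cpsi _ _ H).
  by move=> t tI; apply: dpsi; apply: H; exact: subset_itv_oo_cc tI.
exists c; first exact: H.
move: E; rewrite psi0 sub0r mulrN mulrC => E.
by rewrite -[RHS]opprK -E opprB.
Qed.

Lemma MVT_diff (g : V -> R^o) (z v : V) :
  (forall t : R, 0 <= t <= 1 -> differentiable g (t *: v + z)) ->
  exists2 t : R, 0 <= t <= 1 & g (v + z) - g z = 'd g (t *: v + z) v.
Proof.
move=> dg; pose psi := fun s : R => g (s *: v + z) : R.
have dpsi (t : R) : 0 <= t <= 1 -> is_derive t (1 : R) psi ('D_v g (t *: v + z)).
  by move=> /dg ?; apply: is_derive_line; exact: diff_derivable.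
have cpsi : {within `[0, 1], continuous psi}.
  apply: derivable_within_continuous => t; rewrite in_itv /= => /dpsi dt.
  exact: ex_derive.
have [|c cI E] := @MVT_segment R psi (fun t => 'D_v g (t *: v + z)) 0 1 ler01 _ cpsi.
  by move=> t /subset_itv_oo_cc; rewrite in_itv; exact: dpsi.
move: cI; rewrite in_itv /= => cI; exists c => //.
move: E; rewrite /psi scale1r scale0r add0r subr0 mulr1 => ->.
by rewrite deriveE //; exact: dg.
Qed.

End MVTdir.

Section Plane.
Context {R : realType}.
Implicit Types (g : plane R -> R^o) (z v : plane R) (A : set (plane R)).

Definition e1 : plane R := (1, 0).
Definition e2 : plane R := (0, 1).

Lemma plane_scale (a : R) v : a *: v = (a * v.1, a * v.2).
Proof. by case: v. Qed.

Lemma plane_add u v : u + v = (u.1 + v.1, u.2 + v.2).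
Proof. by case: u v => ? ? []. Qed.

Lemma norm_fst z : `|z.1| <= `|z|.
Proof. by rewrite [X in _ <= X]prod_normE le_max lexx. Qed.

Lemma norm_snd z : `|z.2| <= `|z|.
Proof. by rewrite [X in _ <= X]prod_normE le_max lexx orbT. Qed.

Lemma norm_planeP z (d : R) : (`|z| < d) = (`|z.1| < d) && (`|z.2| < d).
Proof. by rewrite prod_normE gt_max. Qed.

Lemma lin_bound (h1 h2 dx dy e n : R) : `|dx| <= e / 2 -> `|dy| <= e / 2 ->
  `|h1| <= n -> `|h2| <= n -> `|h1 * dx + h2 * dy| <= e * n.
Proof.
move=> hx hy h1n h2n; rewrite [e]splitr mulrDl; apply: (le_trans (ler_normD _ _)).
by rewrite !normrM ![_ / 2 * n]mulrC lerD // ler_pM.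
Qed.

Lemma diff_crit_plane g z (a b : R) :
  (forall e, 0 < e -> \forall h \near (0 : plane R),
     `|g (h + z) - g z - (h.1 * a + h.2 * b)| <= e * `|h|) ->
  differentiable g z /\ forall v, 'd g z v = v.1 * a + v.2 * b.
Proof.
pose d (h : plane R) : R^o := h.1 * a + h.2 * b.
have lin_d : linear d.
  by move=> k [? ?] [? ?]; rewrite /d /= /GRing.scale /= !mulrDl mulrDr !mulrA addrACA.
pose dM := GRing.isLinear.Build _ _ _ _ _ lin_d.
pose dL : {linear _ -> _} := HB.pack d dM.
move=> H; have [] := @diff_crit R (plane R) R^o g z dL.
- move=> w; apply: cvgD; apply: cvgM; try exact: cvg_cst.
    exact: cvg_fst.
  exact: cvg_snd.
- exact: H.
by move=> dg E; split=> // v; rewrite E.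
Qed.

(** The increment h is split into the vertical step h.2 followed by the
horizontal step h.1; the mean value theorem computes each of them with a partial
derivative at a point close to z. *)
Lemma C1_differentiable g z :
  (\forall w \near z, derivable g w e1) ->
  (\forall w \near z, derivable g w e2) ->
  {for z, continuous ('D_e1 g)} -> {for z, continuous ('D_e2 g)} ->
  differentiable g z.
Proof.
move=> d1 d2 c1 c2.
have [] // := @diff_crit_plane g z ('D_e1 g z) ('D_e2 g z) _ => e e0.
have e20 : 0 < e / 2 by rewrite divr_gt0.
have n1 : \forall w \near z, `|'D_e1 g z - 'D_e1 g w| < e / 2.
  by move/cvgrPdist_lt : c1 => /(_ _ e20).
have n2 : \forall w \near z, `|'D_e2 g z - 'D_e2 g w| < e / 2.
  by move/cvgrPdist_lt : c2 => /(_ _ e20).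
have [r r0 rP] := iffLR (near_normP _ _) (filterI (filterI d1 d2) (filterI n1 n2)).
apply/near0_normP; exists r => // h; rewrite norm_planeP => /andP[h1 h2].
have Q w : `|w.1| <= `|h.1| -> `|w.2| <= `|h.2| ->
  ((derivable g (w + z) e1 /\ derivable g (w + z) e2) /\
   (`|'D_e1 g z - 'D_e1 g (w + z)| < e / 2 /\
    `|'D_e2 g z - 'D_e2 g (w + z)| < e / 2)).
  move=> w1 w2; apply: rP.
  by rewrite norm_planeP (le_lt_trans w1 h1) (le_lt_trans w2 h2).
have [|t1 t1h E1] := @MVT_dir R (plane R) g ((0, h.2) + z) e1 h.1.
  move=> t th; rewrite (addrA (t *: e1) (0, h.2) z).
  have [||[dg _] _] := Q (t *: e1 + (0, h.2)); last exact: dg.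
    by rewrite plane_scale /= mulr1 addr0.
  by rewrite plane_scale /= mulr0 add0r.
rewrite (addrA (t1 *: e1) (0, h.2) z) in E1.
have [|t2 t2h E2] := @MVT_dir R (plane R) g z e2 h.2.
  move=> t th; have [] := Q (t *: e2); last by move=> [].
    by rewrite plane_scale /= mulr0 normr0.
  by rewrite plane_scale /= mulr1.
have hE : h.1 *: e1 + ((0, h.2) + z) = h + z.
  rewrite (addrA (h.1 *: e1) (0, h.2) z); congr (_ + _); rewrite plane_scale plane_add /= mulr1 mulr0 addr0 add0r.
  by case: (h).
have h2E : h.2 *: e2 + z = (0, h.2) + z.
  by congr (_ + _); rewrite plane_scale /= mulr1 mulr0.
rewrite hE in E1; rewrite h2E in E2.
rewrite (_ : g (h + z) - g z - (h.1 * 'D_e1 g z + h.2 * 'D_e2 g z) =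
  h.1 * ('D_e1 g (t1 *: e1 + (0, h.2) + z) - 'D_e1 g z) +
  h.2 * ('D_e2 g (t2 *: e2 + z) - 'D_e2 g z)); last first.
  rewrite !mulrBr -E1 -E2; move: (g _) (g _) (g _) (h.1 * _) (h.2 * _) => a b c k l.
  ring.
have [||_ [q1 _]] := Q (t1 *: e1 + (0, h.2)).
- by rewrite plane_scale /= mulr1 addr0.
- by rewrite plane_scale /= mulr0 add0r.
have [||_ [_ q2]] := Q (t2 *: e2).
- by rewrite plane_scale /= mulr0 normr0.
- by rewrite plane_scale /= mulr1.
apply: lin_bound.
- by rewrite distrC; exact: ltW.
- by rewrite distrC; exact: ltW.
- exact: norm_fst.
- exact: norm_snd.
Qed.

(** The iterated directional derivatives have continuous partial derivatives,
hence are differentiable; so differentials along fixed directions are again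
iterated directional derivatives. *)
Lemma smooth_on_at A g x : open A -> smooth_on A g -> A x -> smooth_at x g.
Proof.
move=> oA sg Ax n.
suff H : forall n vs, class_at n x (iter_derive vs g) by exact: (H n [::]).
have nA : \forall y \near x, A y by exact: open_nbhs_nbhs.
elim=> [|{}n IHn] vs.
  by apply/class_at0; apply: filterS nA => y /(sg vs)[].
have df : \forall y \near x, differentiable (iter_derive vs g) y.
  apply: filterS (near_join nA) => y Ay.
  apply: C1_differentiable.
  - by apply: filterS Ay => w /(sg vs)[].
  - by apply: filterS Ay => w /(sg vs)[].
  - by have [] := sg (e1 :: vs) y (nbhs_singleton Ay).
  - by have [] := sg (e2 :: vs) y (nbhs_singleton Ay).
apply/class_atS; split=> // v; apply: class_at_ext (IHn (v :: vs)).
by apply: filterS df => y dfy; rewrite -deriveE.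
Qed.

End Plane.

Section SmoothOn.
Context {R : realType} {V : normedModType R}.

Lemma smooth_at_iter_derive vs (g : V -> R^o) x :
  smooth_at x g -> smooth_at x (iter_derive vs g).
Proof.
elim: vs => // v vs IH /IH sg.
apply: (smooth_at_ext _ (smooth_at_d v sg)).
by apply: filterS (smooth_at_diff sg) => y dfy; rewrite /= deriveE.
Qed.

Lemma smooth_at_on (A : set V) (g : V -> R^o) :
  (forall x, A x -> smooth_at x g) -> smooth_on A g.
Proof.
move=> sg vs x Ax; have s := smooth_at_iter_derive vs (sg x Ax).
split; first exact: smooth_at_cont.
by move=> v; apply: diff_derivable; exact: smooth_at_differentiable.
Qed.

Lemma derive_pair (a b : V -> R^o) x v : derivable a x v -> derivable b x v ->
  derivable (fun y => (a y, b y) : plane R) x v /\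
  'D_v (fun y => (a y, b y) : plane R) x = ('D_v a x, 'D_v b x).
Proof.
move=> da db.
have c : (h^-1 *: (((fun y => (a y, b y) : plane R) \o shift x) (h *: v) -
   (a x, b x) : plane R)) @[h --> (0 : R)^'] --> (('D_v a x, 'D_v b x) : plane R).
  exact: (@cvg_pair _ _ _ _ _ _ _ _ _ _ _ da db).
split; first by apply/cvg_ex; exists ('D_v a x, 'D_v b x).
exact: cvg_lim c.
Qed.

Lemma derive_lin (L : {linear plane R -> R^o}) (h : V -> plane R) x v :
  continuous L -> derivable h x v ->
  derivable (L \o h) x v /\ 'D_v (L \o h) x = L ('D_v h x).
Proof.
move=> cL dh.
have E : (fun t : R => t^-1 *: ((L \o h \o shift x) (t *: v) - (L \o h) x)) =
    L \o (fun t : R => t^-1 *: ((h \o shift x) (t *: v) - h x)).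
  apply/funext => t; apply: esym; apply: (etrans (linearZ_LR L _ _)).
  by congr (_ *: _); exact: linearB.
have c : (t^-1 *: ((L \o h \o shift x) (t *: v) - (L \o h) x)) @[t --> (0 : R)^']
    --> L ('D_v h x).
  by rewrite E; exact: (cvg_comp _ _ dh (cL ('D_v h x))).
by split; [apply/cvg_ex; eexists; exact: c|exact: cvg_lim c].
Qed.

Lemma smooth_at_on_pair (A : set V) (a b : V -> R^o) :
  (forall x, A x -> smooth_at x a) -> (forall x, A x -> smooth_at x b) ->
  smooth_on A (fun y => (a y, b y) : plane R).
Proof.
move=> sa sb vs x Ax.
have E : \forall y \near x, iter_derive vs (fun y => (a y, b y) : plane R) y =
    (iter_derive vs a y, iter_derive vs b y).
  elim: vs => [|v vs IH] /=; first exact: near_all.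
  have sda := smooth_at_diff (smooth_at_iter_derive vs (sa x Ax)).
  have sdb := smooth_at_diff (smooth_at_iter_derive vs (sb x Ax)).
  apply: filterS3 (near_join IH) sda sdb => y Ey day dby.
  rewrite (near_eq_derive _ Ey).
  by have [] := derive_pair (diff_derivable (v:=v) day) (diff_derivable (v:=v) dby).
have sda := smooth_at_iter_derive vs (sa x Ax).
have sdb := smooth_at_iter_derive vs (sb x Ax).
split.
  change (iter_derive vs (fun y => (a y, b y) : plane R) y @[y --> x] -->
    iter_derive vs (fun y => (a y, b y) : plane R) x).
  rewrite (nbhs_singleton E).
  apply: (@cvg_trans _ ((iter_derive vs a y, iter_derive vs b y) @[y --> x])).
    by apply: near_eq_cvg; apply: filterS E => y ->.
  exact: (@cvg_pair _ _ _ (nbhs x) _ _ _ _ _ _ _ (smooth_at_cont sda) (smooth_at_cont sdb)).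
move=> v.
have [d _] := derive_pair (diff_derivable (v:=v) (smooth_at_differentiable sda))
  (diff_derivable (v:=v) (smooth_at_differentiable sdb)).
apply: near_eq_derivable d.
by apply: filterS E => y ->.
Qed.

Lemma smooth_on_lin (L : {linear plane R -> R^o}) (A : set V) (h : V -> plane R) :
  continuous L -> open A -> smooth_on A h -> smooth_on A (L \o h).
Proof.
move=> cL oA sh.
have nA y : A y -> \forall w \near y, A w by move=> Ay; exact: open_nbhs_nbhs.
have E vs y : A y -> iter_derive vs (L \o h) y = L (iter_derive vs h y).
  elim: vs y => // v vs IH y Ay /=.
  have [_ /(_ v) d] := sh vs y Ay; have [_ <-] := derive_lin cL d.
  by apply: near_eq_derive; apply: filterS (nA _ Ay) => w /IH.
move=> vs x Ax; have [c d] := sh vs x Ax.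
have E' : \forall y \near x, (L \o iter_derive vs h) y = iter_derive vs (L \o h) y.
  by apply: filterS (nA _ Ax) => y /(E vs).
split=> [|v]; last first.
  by have [dL _] := derive_lin cL (d v); exact: near_eq_derivable E' dL.
change (iter_derive vs (L \o h) y @[y --> x] --> iter_derive vs (L \o h) x).
rewrite (E vs x Ax); apply: cvg_trans (near_eq_cvg E') _.
exact: (cvg_comp _ _ c (cL _)).
Qed.

End SmoothOn.

(** * Averages along horizontal segments *)

Section Integral01.
Context {R : realType}.
Implicit Types (phi psi : R -> R).

Definition int01 phi : R := \int[lebesgue_measure]_(t in `[0, 1]%classic) phi t.

(** Continuity on the line at each point of [0, 1], which is stable under the
pointwise operations, rather than continuity of a restriction. *)
Definition cont01 phi := forall t : R, 0 <= t <= 1 -> {for t, continuous (phi : R^o -> R^o)}.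

Lemma cont01_within phi : cont01 phi -> {within `[0, 1], continuous phi}.
Proof.
by move=> c; apply: continuous_in_subspaceT => t; rewrite inE /= in_itv; exact: c.
Qed.

Lemma cont01_integrable phi : cont01 phi ->
  lebesgue_measure.-integrable `[0, 1]%classic (EFin \o phi).
Proof.
move=> /cont01_within c; apply: continuous_compact_integrable => //.
exact: segment_compact.
Qed.

Lemma eq_int01 phi psi : (forall t : R, 0 <= t <= 1 -> phi t = psi t) ->
  int01 phi = int01 psi.
Proof. by move=> E; apply: eq_Rintegral => t; rewrite inE /= in_itv => /E. Qed.

Lemma int01_cst (a : R) : int01 (fun=> a) = a.
Proof.
rewrite /int01 Rintegral_cst //= lebesgue_measure_itv /= lte_fin ltr01.
by rewrite oppr0 adde0 mulr1.
Qed.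

Lemma int01D phi psi : cont01 phi -> cont01 psi ->
  int01 (fun t => phi t + psi t) = int01 phi + int01 psi.
Proof. by move=> c d; rewrite /int01 RintegralD //; exact: cont01_integrable. Qed.

Lemma int01Z (a : R) phi : cont01 phi -> int01 (fun t => a * phi t) = a * int01 phi.
Proof. by move=> c; rewrite /int01 RintegralZl //; exact: cont01_integrable. Qed.

Lemma int01_bound phi (e : R) : cont01 phi ->
  (forall t : R, 0 <= t <= 1 -> `|phi t| <= e) -> `|int01 phi| <= e.
Proof.
move=> c b; rewrite -[e]int01_cst /int01.
have cc : cont01 (fun t => `|phi t|).
  move=> t /c h; apply: (@continuous_comp _ _ _ phi (fun x : R => `|x|)) => //.
  exact: norm_continuous.
apply: (le_trans (le_normr_Rintegral _ _)) => //; first exact: cont01_integrable.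
apply: le_Rintegral; [by []| | |].
- exact: cont01_integrable.
- by apply: cont01_integrable => t _; exact: cvg_cst.
- by move=> t; rewrite /= in_itv; exact: b.
Qed.

Lemma int01_ftc phi dphi :
  (forall t : R, 0 <= t <= 1 -> is_derive t 1 phi (dphi t)) -> cont01 dphi ->
  int01 dphi = phi 1 - phi 0.
Proof.
move=> d c.
have cphi (t : R) : 0 <= t <= 1 -> {for t, continuous (phi : R^o -> R^o)}.
  move=> /d dt; apply: differentiable_continuous; apply/derivable1_diffP.
  exact: ex_derive.
rewrite /int01 /Rintegral (continuous_FTC2 (F := phi)) //.
- exact: cont01_within.
- split.
  + move=> t; rewrite in_itv /= => /andP[t0 t1].
    have dt : is_derive t 1 phi (dphi t) by apply: d; rewrite (ltW t0) (ltW t1).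
    exact: ex_derive.
  + by apply: cvg_at_right_filter; apply: cphi; rewrite lexx ler01.
  + by apply: cvg_at_left_filter; apply: cphi; rewrite lexx ler01.
- move=> t; rewrite in_itv /= => /andP[t0 t1].
  have dt : is_derive t 1 phi (dphi t) by apply: d; rewrite (ltW t0) (ltW t1).
  by rewrite derive1E; exact: derive_val.
Qed.

End Integral01.

Section Ray.
Context {R : realType}.
Implicit Types (g : plane R -> R^o) (z h : plane R).

Definition ray (t : R) z : plane R := (t * z.1, z.2).

(** The average of g over the segment from (0, y) to (x, y), with weight t ^ k.
These averages are stable under differentiation (Lop_diff), they give the
quotient in Hadamard's lemma (Lop_hadamard), and they are the solutions h without
singularity of (k + 1) h + x h_x = g (Lop_euler and Lop_diff). *)
Definition Lop (k : nat) g z : R^o := int01 (fun t => t ^+ k * g (ray t z)).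

Lemma rayD t h z : ray t (h + z) = ray t h + ray t z.
Proof. by rewrite /ray plane_add [RHS]plane_add /= mulrDr. Qed.

Lemma norm_ray (t : R) h (r : R) : 0 <= t <= 1 -> `|h| < r -> `|ray t h| < r.
Proof.
move=> /andP[t0 t1]; rewrite !norm_planeP /= => /andP[h1 h2].
apply/andP; split=> //; apply: le_lt_trans h1.
rewrite [X in X <= _]normrM ger0_norm // ler_piMl //.
Qed.

Lemma norm_ray_le (t : R) h : 0 <= t <= 1 -> `|ray t h| <= `|h|.
Proof.
move=> t01; rewrite leNgt; apply/negP => H.
have := norm_ray t01 H; rewrite ltxx //.
Qed.

Lemma ray_continuous (t0 : R) z : (fun t : R => ray t z) @ t0 --> ray t0 z.
Proof.
apply: (@cvg_pair _ _ _ (nbhs t0) (nbhs (t0 * z.1)) (nbhs z.2) _ _ _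
  (fun t => t * z.1) (fun=> z.2)); last exact: cvg_cst.
by apply: cvgM; [exact: cvg_id|exact: cvg_cst].
Qed.

Lemma cvg_addC z : (fun p : plane R * plane R => p.2 + p.1) @ (z, 0 : plane R) --> z.
Proof.
rewrite -[X in _ --> X]add0r; apply: cvgD; [exact: cvg_snd|exact: cvg_fst].
Qed.

(** Compactness of [0, 1] gives one radius for the whole segment. *)
Lemma ray_near (Q : plane R -> plane R -> Prop) z :
  (forall t : R, 0 <= t <= 1 ->
    \forall w \near ray t z & v \near (0 : plane R), Q w v) ->
  \forall v \near (0 : plane R), forall t : R, 0 <= t <= 1 -> Q (ray t z) v.
Proof.
move=> H.
have /compact_near_coveringP cpt : compact (`[0 : R, 1]%classic) by exact: segment_compact.
have := cpt (plane R) (nbhs (0 : plane R)) (fun v t => Q (ray t z) v) _ _.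
have H' : forall t : R, `[0 : R, 1]%classic t ->
    \forall t' \near t & v \near (0 : plane R), Q (ray t' z) v.
  move=> t; rewrite /= in_itv => /= t01; have [[A B] /= [nA nB] AB] := H t t01.
  exists ([set t' | A (ray t' z)], B) => /=.
    by split => //; exact: (near_cvg (@ray_continuous t z) nA).
  by move=> [t' v] /= [At' Bv]; exact: (AB (ray t' z, v)).
move=> /(_ _ H'); apply: filterS => v Hv t t01.
by apply: Hv; rewrite /= in_itv.
Qed.

Lemma ray_near1 (Q : set (plane R)) z :
  (forall t : R, 0 <= t <= 1 -> \forall w \near ray t z, Q w) ->
  \forall z' \near z, forall t : R, 0 <= t <= 1 -> Q (ray t z').
Proof.
move=> H.
have : \forall v \near (0 : plane R), forall t : R, 0 <= t <= 1 -> Q (v + ray t z).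
  apply: (@ray_near (fun w v => Q (v + w))) => t /H nQ.
  exact: (cvg_addC nQ).
move=> /(iffLR (near0_normP _))[r r0 rP].
apply/near_normP; exists r => // h hr t t01.
by rewrite rayD; apply: rP => //; exact: norm_ray.
Qed.

Lemma ray_unif g z :
  (forall t : R, 0 <= t <= 1 -> {for ray t z, continuous g}) ->
  forall e : R, 0 < e -> exists2 r : R, 0 < r & forall v : plane R, `|v| < r ->
    forall t : R, 0 <= t <= 1 -> `|g (v + ray t z) - g (ray t z)| < e.
Proof.
move=> c e e0; apply/near0_normP.
apply: (@ray_near (fun w v => `|g (v + w) - g w| < e)) => t /c ct.
have c1 : (fun p : plane R * plane R => g (p.2 + p.1) - g p.1) @ (ray t z, 0 : plane R) --> 0.
  rewrite [X in _ --> X](_ : _ = g (ray t z) - g (ray t z)); last by rewrite subrr.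
  apply: cvgB; last by apply: (cvg_comp _ _ cvg_fst); exact: ct.
  exact: (cvg_comp _ _ (cvg_addC (z := ray t z)) ct).
by apply: (cvgr_norm_lt _ c1); rewrite normr0.
Qed.

Lemma ray_cont01 k g z :
  (forall t : R, 0 <= t <= 1 -> {for ray t z, continuous g}) ->
  cont01 (fun t => t ^+ k * g (ray t z)).
Proof.
move=> c t /c ct; apply: cvgM; first exact: exprn_continuous.
exact: (cvg_comp _ _ (@ray_continuous t z) ct).
Qed.

Lemma Lop_continuous k g z :
  (forall t : R, 0 <= t <= 1 -> \forall w \near ray t z, {for w, continuous g}) ->
  {for z, continuous (Lop k g)}.
Proof.
move=> H; have c t (t01 : 0 <= t <= 1) := nbhs_singleton (H t t01).
apply/cvgrPdist_le => e e0.
have [r r0 rP] := ray_unif c e0.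
have [s s0 sP] := iffLR (near_normP _ _) (ray_near1 H).
suff H' : \forall z' \near z, `|Lop k g z - Lop k g z'| <= e by exact: H'.
apply/near_normP; exists (Num.min r s); first by rewrite lt_min r0.
move=> h; rewrite lt_min => /andP[hr hs]; have ch := sP h hs.
have c1 := ray_cont01 (k:=k) c.
have c2 : cont01 (fun t => t ^+ k * g (ray t (h + z))).
  exact: ray_cont01 ch.
have c3 : cont01 (fun t => -1 * (t ^+ k * g (ray t (h + z)))).
  by move=> t /c2 ct; apply: cvgM; [exact: cvg_cst|exact: ct].
have -> : Lop k g z - Lop k g (h + z) =
    int01 (fun t => t ^+ k * g (ray t z) + -1 * (t ^+ k * g (ray t (h + z)))).
  by rewrite int01D // int01Z // mulN1r.
apply: int01_bound; first by move=> t t01; apply: cvgD; [exact: c1|exact: c3].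
move=> t t01; rewrite mulN1r -mulrBr normrM rayD.
have /andP[t0 t1] := t01.
rewrite -[e]mul1r; apply: ler_pM => //.
  by rewrite ger0_norm ?exprn_ge0 // exprn_ile1.
by rewrite distrC ltW //; apply: rP => //; exact: norm_ray.
Qed.

(** A first order expansion of g which is uniform along the segment; its
integral is the expansion of the average. *)
Lemma ray_expansion g z :
  (forall t : R, 0 <= t <= 1 -> \forall w \near ray t z, differentiable g w) ->
  (forall v t, 0 <= t <= 1 -> {for ray t z, continuous (fun w => 'd g w v)}) ->
  forall e : R, 0 < e -> exists2 r : R, 0 < r & forall h : plane R, `|h| < r ->
    forall t : R, 0 <= t <= 1 ->
    `|g (ray t (h + z)) - g (ray t z) -
      (h.1 * (t * 'd g (ray t z) e1) + h.2 * 'd g (ray t z) e2)| <= e * `|h|.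
Proof.
move=> dg cg e e0; have e20 : 0 < e / 2 by rewrite divr_gt0.
have [r1 r10 r1P] := ray_unif (cg e1) e20.
have [r2 r20 r2P] := ray_unif (cg e2) e20.
have [r3 r30 r3P] : exists2 r : R, 0 < r & forall v : plane R, `|v| < r ->
    forall t : R, 0 <= t <= 1 -> differentiable g (v + ray t z).
  apply/near0_normP; apply: (@ray_near (fun w v => differentiable g (v + w))) => t /dg nQ.
  exact: (cvg_addC nQ).
exists (Num.min r1 (Num.min r2 r3)); first by rewrite !lt_min r10 r20.
move=> h; rewrite !lt_min => /and3P[h1 h2 h3] t t01.
have hs (s : R) (r : R) : 0 <= s <= 1 -> `|h| < r -> `|s *: ray t h| < r.
  move=> /andP[s0 s1] hr; rewrite normrZ ger0_norm //.
  apply: le_lt_trans (norm_ray t01 hr).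
  by rewrite ler_piMl.
have [|s s01 E] := @MVT_diff R (plane R) g (ray t z) (ray t h).
  by move=> s s01; apply: r3P => //; exact: hs.
have aux (x y a b c d : R) : t * x * a + y * b - (x * (t * c) + y * d) =
    t * x * (a - c) + y * (b - d) by ring.
have {}E : g (ray t (h + z)) - g (ray t z) = t * h.1 * 'd g (s *: ray t h + ray t z) e1 +
   h.2 * 'd g (s *: ray t h + ray t z) e2.
  by rewrite rayD; apply: (etrans E); exact: diff_plane.
rewrite E aux.
have n1 := norm_fst (ray t h); have n2 := norm_snd (ray t h).
have n3 := norm_ray_le h t01.
apply: lin_bound.
- by apply: ltW; apply: r1P => //; exact: hs.
- by apply: ltW; apply: r2P => //; exact: hs.
- exact: le_trans n1 n3.
- exact: le_trans n2 n3.
Qed.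

Lemma Lop_diff k g z :
  (forall t : R, 0 <= t <= 1 -> \forall w \near ray t z, differentiable g w) ->
  (forall v t, 0 <= t <= 1 -> {for ray t z, continuous (fun w => 'd g w v)}) ->
  differentiable (Lop k g) z /\ forall v, 'd (Lop k g) z v =
    v.1 * Lop k.+1 (fun w => 'd g w e1) z + v.2 * Lop k (fun w => 'd g w e2) z.
Proof.
move=> dg cg; apply: diff_crit_plane => e e0.
have [r r0 rP] := ray_expansion dg cg e0.
have [s s0 sP] := iffLR (near_normP _ _) (ray_near1 dg).
apply/near0_normP; exists (Num.min r s); first by rewrite lt_min r0.
move=> h; rewrite lt_min => /andP[hr hs].
have cw w : (forall t : R, 0 <= t <= 1 -> differentiable g (ray t w)) ->
    cont01 (fun t => t ^+ k * g (ray t w)).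
  by move=> H; apply: ray_cont01 => t /H; exact: differentiable_continuous.
have c1 : cont01 (fun t => t ^+ k * g (ray t (h + z))) by apply: cw; exact: sP.
have c0 : cont01 (fun t => t ^+ k * g (ray t z)).
  by apply: cw => t /dg; exact: nbhs_singleton.
have cx := ray_cont01 (k:=k.+1) (cg e1).
have cy := ray_cont01 (k:=k) (cg e2).
have cZ (a : R) (phi : R -> R) : cont01 phi -> cont01 (fun t => a * phi t).
  by move=> c t /c ct; apply: cvgM; [exact: cvg_cst|exact: ct].
have cD (phi psi : R -> R) : cont01 phi -> cont01 psi -> cont01 (fun t => phi t + psi t).
  by move=> c d t t01; apply: cvgD; [exact: c|exact: d].
rewrite (_ : _ - _ - _ = int01 (fun t =>
  (t ^+ k * g (ray t (h + z)) + -1 * (t ^+ k * g (ray t z))) +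
  (- h.1 * (t ^+ k.+1 * 'd g (ray t z) e1) + - h.2 * (t ^+ k * 'd g (ray t z) e2)))); last first.
  rewrite int01D; [|exact: (cD _ _ c1 (cZ _ _ c0))|exact: (cD _ _ (cZ _ _ cx) (cZ _ _ cy))].
  rewrite int01D; [|by []|exact: cZ].
  rewrite int01D; [|exact: cZ|exact: cZ].
  rewrite !int01Z // mulN1r !mulNr -opprD //.
apply: int01_bound.
  exact: (cD _ _ (cD _ _ c1 (cZ _ _ c0)) (cD _ _ (cZ _ _ cx) (cZ _ _ cy))).
move=> t t01; have /andP[t0 t1] := t01.
have -> : t ^+ k * g (ray t (h + z)) + -1 * (t ^+ k * g (ray t z)) +
  (- h.1 * (t ^+ k.+1 * 'd g (ray t z) e1) + - h.2 * (t ^+ k * 'd g (ray t z) e2)) =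
  t ^+ k * (g (ray t (h + z)) - g (ray t z) -
    (h.1 * (t * 'd g (ray t z) e1) + h.2 * 'd g (ray t z) e2)).
  have aux (x y a b c d tk : R) : tk * a + -1 * (tk * b) + (- x * (t * tk * c) + - y * (tk * d)) =
    tk * (a - b - (x * (t * c) + y * d)) by ring.
  by rewrite exprS; exact: aux.
rewrite normrM -[_ * `|h|]mul1r; apply: ler_pM => //; last exact: rP.
by rewrite ger0_norm ?exprn_ge0 // exprn_ile1.
Qed.

(** The partial derivatives of an average of g are averages of partial
derivatives of g. *)
Lemma class_at_Lop n k g z :
  (forall t : R, 0 <= t <= 1 -> class_at n (ray t z) g) -> class_at n z (Lop k g).
Proof.
elim: n k g => [|n IHn] k g cg.
  apply/class_at0.
  have : \forall z' \near z, forall t : R, 0 <= t <= 1 ->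
      \forall w \near ray t z', {for w, continuous g}.
    apply: (@ray_near1 (fun w => \forall w' \near w, {for w', continuous g})).
    by move=> t /cg /class_at0 c; exact: (near_join c).
  by apply: filterS => z'; exact: Lop_continuous.
have E : \forall z' \near z, differentiable (Lop k g) z' /\
    forall v, 'd (Lop k g) z' v =
    v.1 * Lop k.+1 (fun w => 'd g w e1) z' + v.2 * Lop k (fun w => 'd g w e2) z'.
  have H1 : \forall z' \near z, forall t : R, 0 <= t <= 1 ->
      \forall w \near ray t z', differentiable g w.
    apply: (@ray_near1 (fun w => \forall w' \near w, differentiable g w')).
    by move=> t /cg /class_atS[c _]; exact: (near_join c).
  have H2 v : \forall z' \near z, forall t : R, 0 <= t <= 1 ->
      {for ray t z', continuous (fun w => 'd g w v)}.
    apply: (@ray_near1 (fun w' => {for w', continuous (fun w => 'd g w v)})).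
    by move=> t /cg /class_atS[_ /(_ v)]; exact: class_at_cont.
  apply: filterS3 H1 (H2 e1) (H2 e2) => z' d1 c1 c2; apply: Lop_diff => // v t t01.
  have -> : (fun w => 'd g w v) = (fun w => v.1 * 'd g w e1 + v.2 * 'd g w e2).
    by apply/funext => w; exact: diff_plane.
  exact: (cvgD (cvgM (cvg_cst _) (c1 _ t01)) (cvgM (cvg_cst _) (c2 _ t01))).
apply/class_atS; split; first by apply: filterS E => ? [].
move=> v; apply: (@class_at_ext _ _ _ _ (fun z' => v.1 * Lop k.+1 (fun w => 'd g w e1) z' +
   v.2 * Lop k (fun w => 'd g w e2) z')).
  by apply: filterS E => z' [_ E']; exact: (esym (E' v)).
have c v' j : class_at n z (Lop j (fun w => 'd g w v')).
  by apply: IHn => t /cg /class_atS[_ cd]; exact: cd.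
exact: (class_atD (class_atM (class_at_cst n z v.1) (c e1 k.+1))
                  (class_atM (class_at_cst n z v.2) (c e2 k))).
Qed.

Lemma smooth_at_Lop k g z :
  (forall t : R, 0 <= t <= 1 -> smooth_at (ray t z) g) -> smooth_at z (Lop k g).
Proof. by move=> sg n; apply: class_at_Lop => t /sg. Qed.

Lemma is_derive_ray g z (t : R) : differentiable g (ray t z) ->
  is_derive t 1 (fun s : R => g (ray s z) : R) (z.1 * 'd g (ray t z) e1).
Proof.
move=> dg.
have E : (fun s : R => g (ray s z)) = (fun s : R => g (s *: ((z.1, 0) : plane R) + (0, z.2))).
  apply/funext => s; congr g; rewrite plane_scale plane_add /= addr0 mulr0 add0r //.
have Et : ray t z = t *: ((z.1, 0) : plane R) + (0, z.2).
  by rewrite plane_scale plane_add /= addr0 mulr0 add0r.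
rewrite E; have := @is_derive_line R (plane R) g (0, z.2) (z.1, 0) t.
rewrite -Et => /(_ (diff_derivable dg)) H.
apply: is_derive_eq H _.
apply: (etrans (deriveE _ dg)); apply: (etrans (diff_plane _ _ _)).
have aux (x a b : R) : x * a + 0 * b = x * a by rewrite mul0r addr0.
exact: aux.
Qed.

(** The fundamental theorem of calculus for t |-> g (t x, y). *)
Lemma Lop_hadamard g z : (forall t : R, 0 <= t <= 1 -> smooth_at (ray t z) g) ->
  z.1 * Lop 0 (fun w => 'd g w e1) z = g z - g (0, z.2).
Proof.
move=> sg.
have d t (t01 : 0 <= t <= 1) := smooth_at_differentiable (sg t t01).
have c t (t01 : 0 <= t <= 1) := smooth_at_cont (smooth_at_d e1 (sg t t01)).
have c0 := ray_cont01 (k:=0) c.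
rewrite /Lop -int01Z //.
have H1 (t : R) : 0 <= t <= 1 -> is_derive t 1 (fun s : R => g (ray s z) : R)
    (z.1 * (t ^+ 0 * 'd g (ray t z) e1)).
  by move=> t01; rewrite expr0 mul1r; apply: is_derive_ray; exact: d.
have H2 : cont01 (fun t => z.1 * (t ^+ 0 * 'd g (ray t z) e1)).
  by move=> t /c0 ct; apply: cvgM; [exact: cvg_cst|exact: ct].
rewrite (int01_ftc H1 H2) /ray mul1r mul0r.
by case: (z).
Qed.

(** The fundamental theorem of calculus for t |-> t ^ (k + 1) g (t x, y). *)
Lemma Lop_euler k g z : (forall t : R, 0 <= t <= 1 -> smooth_at (ray t z) g) ->
  k.+1%:R * Lop k g z + z.1 * Lop k.+1 (fun w => 'd g w e1) z = g z.
Proof.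
move=> sg.
have d t (t01 : 0 <= t <= 1) := smooth_at_differentiable (sg t t01).
have c t (t01 : 0 <= t <= 1) := smooth_at_cont (smooth_at_d e1 (sg t t01)).
have c1 := ray_cont01 (k:=k.+1) c.
have c0 := ray_cont01 (k:=k) (fun t t01 => smooth_at_cont (sg t t01)).
have cZ (a : R) (phi : R -> R) : cont01 phi -> cont01 (fun t => a * phi t).
  by move=> h t /h ct; apply: cvgM; [exact: cvg_cst|exact: ct].
rewrite /Lop -!int01Z // -int01D; [|exact: cZ|exact: cZ].
have H2 : cont01 (fun t => k.+1%:R * (t ^+ k * g (ray t z)) +
    z.1 * (t ^+ k.+1 * 'd g (ray t z) e1)).
  by move=> t t01; apply: cvgD; [exact: (cZ _ _ c0)|exact: (cZ _ _ c1)].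
have H1 (t : R) : 0 <= t <= 1 -> is_derive t 1 (fun s : R => s ^+ k.+1 * g (ray s z) : R)
    (k.+1%:R * (t ^+ k * g (ray t z)) + z.1 * (t ^+ k.+1 * 'd g (ray t z) e1)).
  move=> t01; have dg := is_derive_ray (d t t01).
  have dX : is_derive t 1 (fun s : R => s ^+ k.+1) (k.+1%:R * t ^+ k).
    split; first exact: exprn_derivable.
    by rewrite exp_derive; exact: mulr1.
  have H := @is_deriveM _ _ (fun s : R => s ^+ k.+1) (fun s => g (ray s z)) t 1 _ _ dX dg.
  apply: is_derive_eq H _.
  have aux (tk1 tk a b G : R) : tk1 * (z.1 * b) + G * (a * tk) =
    a * (tk * G) + z.1 * (tk1 * b) by ring.
  exact: aux.
rewrite (int01_ftc H1 H2) expr1n expr0n /= mul0r subr0 mul1r /ray mul1r.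
by case: (z).
Qed.

End Ray.

(** * Inversion of shears *)

Section Shear.
Context {R : realType}.

Lemma diff_bound_plane (F : plane R -> R^o) z : differentiable F z ->
  forall e : R, 0 < e -> exists2 r : R, 0 < r & forall h : plane R, `|h| < r ->
    `|F (h + z) - F z - 'd F z h| <= e * `|h|.
Proof.
move=> dF e e0; have [_ E] := iffLR (diff_locallyP _ _) dF.
move/eqaddoP : E => /(_ _ e0) /(iffLR (near0_normP _))[r r0 rP].
exists r => // h /rP; rewrite !fctE /= => H.
by rewrite -addrA -opprD.
Qed.

(** With k the increment of Y over h, the expansion of F gives
h.2 = h.1 a + k b up to a small multiple of max (|h|, |k|). As b <> 0 this first
bounds k by a multiple of |h|, and then the error is small compared to |h|. *)
Lemma implicit_diff (F Y : plane R -> R^o) (w : plane R) (a b : R) :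
  (\forall w' \near w, F (w'.1, Y w') = w'.2) -> {for w, continuous Y} ->
  differentiable F (w.1, Y w) ->
  (forall h, 'd F (w.1, Y w) h = h.1 * a + h.2 * b) -> b != 0 ->
  differentiable Y w /\ forall v, 'd Y w v = (v.2 - v.1 * a) / b.
Proof.
move=> FY cY dF dFE Fy0; pose z : plane R := (w.1, Y w).
rewrite -[(w.1, Y w)]/z in dF dFE.
suff [dY E] : differentiable Y w /\ forall v, 'd Y w v = v.1 * (- (a / b)) + v.2 * b^-1.
  split; first exact: dY.
  move=> v; apply: (etrans (E v)).
  have aux (x y : R) : x * (- (a / b)) + y * b^-1 = (y - x * a) / b by ring.
  exact: aux.
apply: diff_crit_plane => e e0.
have b0 : 0 < `|b| by rewrite normr_gt0.
pose C := 2 * (1 + `|a|) / `|b| + 1.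
have C0 : 0 < C.
  by rewrite ltr_wpDl // divr_ge0 // mulr_ge0 // addr_ge0.
(* The first bound makes |k| <= C |h|; with this, the second one makes the error
   on k at most e |h|. *)
pose e' := Num.min (`|b| / 2) (e * `|b| / C).
have e'0 : 0 < e'.
  by rewrite lt_min !divr_gt0 // mulr_gt0.
have [r r0 rP] := diff_bound_plane dF e'0.
have Yr : \forall w' \near w, `|Y w - Y w'| < r.
  by move/cvgrPdist_lt : cY => /(_ _ r0).
have [s s0 sP] := iffLR (near_normP _ _) (filterI FY Yr).
apply/near0_normP; exists (Num.min r s); first by rewrite lt_min r0 s0.
move=> h; rewrite lt_min => /andP[hr hs].
have [FYh Yh] := sP h hs.
set k := Y (h + w) - Y w.
have kr : `|k| < r by rewrite /k distrC.
have h1 := norm_fst h; have h2 := norm_snd h.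
have := rP (h.1, k); rewrite norm_planeP /= kr (le_lt_trans h1 hr) => /(_ isT).
have -> : (h.1, k) + z = ((h + w).1, Y (h + w)).
  by rewrite plane_add /= /k subrK.
rewrite FYh (_ : F z = w.2); last exact: (nbhs_singleton FY).
rewrite dFE /=.
have -> : (h + w).2 - w.2 = h.2 by rewrite /= addrK.
set n := `|(h.1, k) : plane R|.
have nh : n <= Num.max `|h| `|k|.
  rewrite /n prod_normE ge_max; apply/andP; split; rewrite le_max; apply/orP.
    by left; exact: (norm_fst h).
  by right; exact: lexx.
have n0 : 0 <= n by exact: normr_ge0.
move=> B.
have kC : `|k| <= C * `|h|.
  have B1 : `|h.2 - (h.1 * a + k * b)| <= `|b| / 2 * n.
    by apply: (le_trans B); apply: ler_wpM2r => //; rewrite /e' ge_min lexx.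
  have B2 : `|k| * `|b| <= `|b| / 2 * n + `|h| * (1 + `|a|).
    rewrite -normrM (_ : k * b = - (h.2 - (h.1 * a + k * b)) + (h.2 - h.1 * a)); last by ring.
    apply: (le_trans (ler_normD _ _)); rewrite normrN; apply: lerD => //.
    apply: (le_trans (ler_normB _ _)); rewrite mulrDr mulr1 normrM; apply: lerD => //.
    exact: ler_wpM2r.
  have h0 : 0 <= `|h| by [].
  have [hk|kh] := leP `|k| `|h|.
    apply: (le_trans hk); rewrite ler_peMl // /C lerDr divr_ge0 // mulr_ge0 // addr_ge0 //.
  move: nh; rewrite (max_idPr (ltW kh)) => nh.
  have B3 : `|k| * `|b| <= 2 * (1 + `|a|) * `|h|.
    have : `|b| / 2 * n <= `|b| / 2 * `|k| by apply: ler_wpM2l => //; rewrite divr_ge0.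
    by move: B2; set u := `|h| * (1 + `|a|) => B2 B4; rewrite -mulrA [(1 + _) * _]mulrC -/u; lra.
  rewrite /C mulrDl mul1r; apply: ler_wpDr => //.
  by rewrite mulrAC ler_pdivlMr.
have nC : n <= C * `|h|.
  apply: (le_trans nh); rewrite ge_max kC andbT ler_peMl // /C lerDr.
  by rewrite divr_ge0 // mulr_ge0 // addr_ge0.
have -> : k - (h.1 * - (a / b) + h.2 / b) = - (h.2 - (h.1 * a + k * b)) / b.
  by field; rewrite -normr_gt0.
rewrite normrM normrN normfV ler_pdivrMr //; apply: (le_trans B).
apply: (@le_trans _ _ (e * `|b| / C * n)).
  by apply: ler_wpM2r => //; rewrite /e' ge_min lexx orbT.
apply: (@le_trans _ _ (e * `|b| / C * (C * `|h|))).
  by apply: ler_wpM2l => //; rewrite divr_ge0 // ?mulr_ge0 // ltW.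
by rewrite mulrA divfK ?gt_eqF // mulrAC.
Qed.

(** The differential of Y is a rational expression in derivatives of F composed
with Y: if Y is of class C^n, this makes it of class C^(n+1). *)
Lemma implicit_smooth (F Y : plane R -> R^o) (w : plane R) :
  (\forall w' \near w, [/\ F (w'.1, Y w') = w'.2, {for w', continuous Y},
     smooth_at (w'.1, Y w') F & 'd F (w'.1, Y w') e2 != 0]) ->
  smooth_at w Y.
Proof.
move=> H; have dY : \forall w' \near w, differentiable Y w' /\
    forall v, 'd Y w' v =
      (v.2 - v.1 * 'd F (w'.1, Y w') e1) / 'd F (w'.1, Y w') e2.
  apply: filterS (near_join H) => w' Hw'.
  have [_ c s nz] := nbhs_singleton Hw'.
  have dE h := diff_plane F (w'.1, Y w') h.
  apply: (implicit_diff _ c (smooth_at_differentiable s) dE nz).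
  by apply: filterS Hw' => ? [].
elim=> [|n IHn].
  by apply/class_at0; apply: filterS H => w' [].
apply/class_atS; split; first by apply: filterS dY => ? [].
have [_ _ s nz] := nbhs_singleton H.
move=> v; apply: (@class_at_ext R (plane R) n w (fun w' =>
    (v.2 + - v.1 * 'd F (w'.1, Y w') e1) * ('d F (w'.1, Y w') e2)^-1)).
  apply: filterS dY => w' [_ E]; apply: (etrans _ (esym (E v))).
  have aux (x y A B : R) : (x + - y * A) * B^-1 = (x - y * A) / B by rewrite mulNr.
  exact: aux.
have c1 v' : class_at n w (fun w' => 'd F (w'.1, Y w') v').
  exact: (class_at_comp2 (smooth_at_d v' s n) (smooth_at_fst w n) IHn).
apply: class_atM.
  apply: class_atD; first exact: class_at_cst.
  apply: class_atM; first exact: class_at_cst.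
  exact: c1.
exact: (@class_at_comp1 R (plane R) n w (fun y => y^-1)
  (fun w' => 'd F (w'.1, Y w') e2) (smooth_at_inv nz n) (c1 e2)).
Qed.

End Shear.

Section ShearInverse.
Context {R : realType}.

Lemma increasing_fiber (F : plane R -> R^o) (x y y' : R) : y < y' ->
  (forall t : R, y <= t <= y' -> differentiable F (x, t) /\ 0 < 'd F (x, t) e2) ->
  F (x, y) < F (x, y').
Proof.
move=> yy' H; have d0 : 0 < y' - y by rewrite subr_gt0.
have E (t : R) : t *: ((0, y' - y) : plane R) + (x, y) = (x, y + t * (y' - y)).
  by rewrite plane_scale plane_add /= mulr0 add0r [_ + y]addrC.
have I (t : R) : 0 <= t <= 1 -> y <= y + t * (y' - y) <= y'.
  move=> /andP[t0 t1]; rewrite lerDl mulr_ge0 ?(ltW d0) //= -lerBrDl.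
  by rewrite ler_piMl // ltW.
have [|t t01] := @MVT_diff R (plane R) F (x, y) (0, y' - y).
  by move=> t /I /H[]; rewrite E.
rewrite E -[X in F (X + _)]scale1r E mul1r addrCA subrr addr0 diff_plane /= mul0r add0r => D.
by rewrite -subr_gt0 D mulr_gt0 //; have [] := H _ (I _ t01).
Qed.

Lemma continuous_fiber (F : plane R -> R^o) (x a b : R) :
  (forall t : R, a <= t <= b -> {for (x, t), continuous F}) ->
  {within `[a, b], continuous (fun t : R => F (x, t) : R)}.
Proof.
move=> H; apply: continuous_in_subspaceT => t; rewrite inE /= in_itv /= => /H c.
apply: (@continuous_comp _ _ _ (fun t : R => (x, t) : plane R) F) c.
exact: (@cvg_pair _ _ _ (nbhs t) (nbhs x) (nbhs t) _ _ _ (fun=> x) id (cvg_cst x) cvg_id).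
Qed.

(** The implicit function theorem, for the inverse (x, s) |-> (x, Y (x, s)) of
the shear (x, y) |-> (x, F (x, y)). Near 0 the function F is strictly monotone in
y, so that Y is given by the intermediate value theorem and is continuous by
monotonicity. Inverse functions in one variable and inverses of coordinate
changes of the plane are obtained from this case. *)
Lemma shear_inverse (F : plane R -> R^o) :
  (\forall z \near (0 : plane R), smooth_at z F) -> F 0 = 0 -> 'd F 0 e2 != 0 ->
  exists Y : plane R -> R^o, [/\ Y 0 = 0,
    \forall w \near (0 : plane R), smooth_at w Y,
    \forall w \near (0 : plane R), F (w.1, Y w) = w.2 &
    \forall z \near (0 : plane R), Y (z.1, F z) = z.2].
Proof.
move=> sF F0 Fy0.
(* Y (x, - s) is the solution for F if Y is the solution for - F. *)
wlog Fy : F sF F0 Fy0 / 0 < 'd F 0 e2.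
  move=> WL; have [Fy|Fy|Fy] := ltgtP ('d F 0 e2) 0; last by rewrite Fy eqxx in Fy0.
  - have dN z : smooth_at z F -> 'd (fun z => - F z) z e2 = - 'd F z e2.
      move=> /smooth_at_differentiable dF.
      by have /(congr1 (fun L => L e2)) := diffN dF.
    have d0 := dN 0 (nbhs_singleton sF).
    have [||||Y [Y0 sY YF FY]] := WL (fun z => - F z).
    + by apply: filterS sF => z; exact: smooth_atN.
    + by rewrite F0 oppr0.
    + by rewrite d0 oppr_eq0.
    + by rewrite d0 oppr_gt0.
    have c : (fun w : plane R => (w.1, - w.2) : plane R) @ (0 : plane R) --> (0 : plane R).
      rewrite [X in _ --> X](_ : _ = ((0 : plane R).1, - (0 : plane R).2)); last by rewrite oppr0.
      apply: (@cvg_pair _ _ _ _ (nbhs (0 : plane R).1) (nbhs (- (0 : plane R).2 : R))).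
        exact: cvg_fst.
      by apply: cvgN; exact: cvg_snd.
    exists (fun w => Y (w.1, - w.2)); split.
    + by rewrite /= oppr0.
    + apply: filterS (near_cvg c sY) => w sw.
      exact: (@smooth_at_comp2 _ _ w Y (fun w : plane R => w.1) (fun w => - w.2)
        sw (smooth_at_fst w) (smooth_atN (smooth_at_snd w))).
    + by apply: filterS (near_cvg c YF) => w /= /(congr1 -%R); rewrite !opprK.
    + by apply: filterS FY.
  - exact: WL.
have cD : {for 0, continuous (fun z => 'd F z e2)}.
  exact: smooth_at_cont (smooth_at_d e2 (nbhs_singleton sF)).
have nD : \forall z \near (0 : plane R), 0 < 'd F z e2.
  exact: (cvgr_gt _ cD _ Fy).
have [r0 r00 H] := iffLR (near0_normP _) (filterI sF nD).
have sm z : `|z| < r0 -> smooth_at z F by move=> /H[].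
have ps z : `|z| < r0 -> 0 < 'd F z e2 by move=> /H[].
pose r := r0 / 2; have r_gt0 : 0 < r by rewrite divr_gt0.
have rr0 : r < r0 by rewrite /r; lra.
have inc x y y' : `|x| < r0 -> - r <= y -> y < y' -> y' <= r -> F (x, y) < F (x, y').
  move=> xr yr yy' y'r; apply: (increasing_fiber yy') => t /andP[yt ty'].
  have nt : `|(x, t) : plane R| < r0.
    rewrite norm_planeP /= xr /= (le_lt_trans _ rr0) // ler_norml.
    by rewrite (le_trans yr yt) (le_trans ty' y'r).
  by split; [exact: smooth_at_differentiable (sm _ nt) | exact: ps].
have injF x y y' : `|x| < r0 -> `|y| <= r -> `|y'| <= r -> F (x, y) = F (x, y') -> y = y'.
  rewrite !ler_norml => xr /andP[y1 y2] /andP[y'1 y'2] E.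
  have [yy'|yy'|//] := ltgtP y y'.
    by have := inc x y y' xr y1 yy' y'2; rewrite E ltxx.
  by have := inc x y' y xr y'1 yy' y2; rewrite E ltxx.
(* The points (x, s) for which s lies strictly between the values of F at the
   ends of the vertical segment; this is an open set. *)
pose G := [set w : plane R | [/\ `|w.1| < r0, F (w.1, - r) < w.2 & w.2 < F (w.1, r)]].
pose Y (w : plane R) : R^o := xget 0 [set y : R | `|y| < r /\ F (w.1, y) = w.2].
have HY w : G w -> `|Y w| < r /\ F (w.1, Y w) = w.2.
  move=> [w1 w2 w3]; suff [y Ey] : exists y : R, `|y| < r /\ F (w.1, y) = w.2.
    exact: (@xgetPex _ 0 [set y : R | `|y| < r /\ F (w.1, y) = w.2] (ex_intro _ y Ey)).
  have [||y yI Fy'] := @IVT R (fun t => F (w.1, t)) (- r) r w.2 ltac:(lra).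
  - apply: continuous_fiber => t tr; apply: smooth_at_cont; apply: sm.
    by rewrite norm_planeP /= w1 /= (le_lt_trans _ rr0) // ler_norml.
  - by rewrite ge_min (ltW w2) le_max (ltW w3) orbT.
  exists y; split=> //; move: yI; rewrite in_itv /= => /andP[y1 y2].
  rewrite ltr_norml !lt_neqAle y1 y2 !andbT; apply/andP; split; apply/eqP => E.
    by move: w2; rewrite E Fy' ltxx.
  by move: w3; rewrite -E Fy' ltxx.
have cF1 (x t : R) : `|x| < r0 -> `|t| <= r ->
    {for (x, t), continuous F}.
  move=> xr tr; apply: smooth_at_cont; apply: sm.
  by rewrite norm_planeP /= xr (le_lt_trans tr rr0).
have cFw (w : plane R) (t : R) : `|w.1| < r0 -> `|t| <= r ->
    (fun w' : plane R => F (w'.1, t) - w'.2) @ w --> F (w.1, t) - w.2.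
  move=> wr tr; apply: cvgB; last exact: cvg_snd.
  apply: (@continuous_comp _ _ _ (fun w' : plane R => (w'.1, t) : plane R) F); last exact: cF1.
  apply: (@cvg_pair _ _ _ (nbhs w) (nbhs w.1) (nbhs t)); first exact: cvg_fst.
  exact: cvg_cst.
have nF1 (w : plane R) : `|w.1| < r0 -> \forall w' \near w, `|w'.1| < r0.
  have c : (fun w' : plane R => w'.1 : R^o) @ w --> (w.1 : R^o) by exact: cvg_fst.
  exact: (cvgr_norm_lt _ c).
have nlt (w : plane R) (t : R) : `|w.1| < r0 -> `|t| <= r -> F (w.1, t) < w.2 ->
    \forall w' \near w, F (w'.1, t) < w'.2.
  move=> wr tr wt; have wt0 : F (w.1, t) - w.2 < 0 by rewrite subr_lt0.
  apply: filterS (cvgr_lt _ (cFw w t wr tr) _ wt0) => w'.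
  by rewrite subr_lt0.
have ngt (w : plane R) (t : R) : `|w.1| < r0 -> `|t| <= r -> w.2 < F (w.1, t) ->
    \forall w' \near w, w'.2 < F (w'.1, t).
  move=> wr tr wt; have wt0 : 0 < F (w.1, t) - w.2 by rewrite subr_gt0.
  apply: filterS (cvgr_gt _ (cFw w t wr tr) _ wt0) => w'.
  by rewrite subr_gt0.
have rN : `|- r| <= r by rewrite normrN gtr0_norm.
have rP : `|r| <= r by rewrite gtr0_norm.
have nG w : G w -> \forall w' \near w, G w'.
  move=> [w1 w2 w3].
  by apply: filterS3 (nF1 w w1) (nlt _ _ w1 rN w2) (ngt _ _ w1 rP w3).
have G0 : G 0.
  have z0 : `|0 : R| < r0 by rewrite normr0.
  have F00 : F (0, 0) = 0 by exact: F0.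
  split; first exact: z0.
    have := inc 0 (- r) 0 z0 (lexx _) ltac:(lra) ltac:(lra).
    by rewrite F00.
  have := inc 0 0 r z0 ltac:(lra) ltac:(lra) (lexx _).
  by rewrite F00.
have cY w : G w -> {for w, continuous Y}.
  move=> Gw; have [Yr FY] := HY w Gw; have [w1 _ _] := Gw.
  apply/cvgrPdist_lt => e e_gt0.
  pose d := Num.min (e / 2) (r - `|Y w|).
  have d0 : 0 < d by rewrite lt_min divr_gt0 // subr_gt0.
  have de : d < e by rewrite /d gt_min; apply/orP; left; lra.
  have dr : d <= r - `|Y w| by rewrite /d ge_min lexx orbT.
  have lo : - r <= Y w - d by have := ler_norm (- Y w); rewrite normrN; lra.
  have hi : Y w + d <= r by have := ler_norm (Y w); lra.
  have L : F (w.1, Y w - d) < w.2 by rewrite -FY; apply: inc => //; lra.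
  have U : w.2 < F (w.1, Y w + d) by rewrite -FY; apply: inc => //; lra.
  have nL := nlt w (Y w - d) w1 ltac:(rewrite ler_norml; lra) L.
  have nU := ngt w (Y w + d) w1 ltac:(rewrite ler_norml; lra) U.
  apply: filterS3 (nG _ Gw) nL nU => w' Gw' L' U'.
  have [Yr' FY'] := HY w' Gw'; have [w'1 _ _] := Gw'.
  move: Yr'; rewrite ltr_norml => /andP[Y1 Y2].
  have A1 : Y w - d < Y w'.
    rewrite ltNge; apply/negP; rewrite le_eqVlt => /orP[/eqP E|E].
      by move: L'; rewrite -E FY' ltxx.
    have := inc w'.1 (Y w') (Y w - d) w'1 (ltW Y1) E ltac:(lra).
    by rewrite FY' ltNge (ltW L').
  have A2 : Y w' < Y w + d.
    rewrite ltNge; apply/negP; rewrite le_eqVlt => /orP[/eqP E|E].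
      by move: U'; rewrite E FY' ltxx.
    have := inc w'.1 (Y w + d) (Y w') w'1 ltac:(lra) E (ltW Y2).
    by rewrite FY' ltNge (ltW U').
  by rewrite ltr_norml; apply/andP; split; lra.
have nGood w : G w -> \forall w' \near w, [/\ F (w'.1, Y w') = w'.2,
     {for w', continuous Y}, smooth_at (w'.1, Y w') F & 'd F (w'.1, Y w') e2 != 0].
  move=> /nG; apply: filterS => w' Gw'; have [Yr FY] := HY _ Gw'.
  have [w1 _ _] := Gw'.
  have nw : `|(w'.1, Y w') : plane R| < r0.
    by rewrite norm_planeP /= w1 (lt_trans Yr rr0).
  split; [exact: FY|exact: cY|exact: sm|].
  by apply: lt0r_neq0; exact: ps.
exists Y; split.
- have [Yr FY] := HY _ G0; apply: (injF 0).
  + by rewrite normr0.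
  + exact: ltW.
  + by rewrite normr0 ltW.
  + by apply: (etrans FY); exact: (esym F0).
- by apply: filterS (nG _ G0) => w /nGood; exact: implicit_smooth.
- by apply: filterS (nG _ G0) => w /HY[].
have cG : (fun z : plane R => (z.1, F z) : plane R) @ (0 : plane R) --> (0 : plane R).
  rewrite [X in _ --> X](_ : _ = ((0 : plane R).1, F 0)); last by rewrite F0.
  apply: (@cvg_pair _ _ _ _ (nbhs (0 : plane R).1) (nbhs (F 0))).
    exact: cvg_fst.
  exact: (smooth_at_cont (nbhs_singleton sF)).
have n2 : \forall z \near (0 : plane R), `|z| < r.
  by apply/near0_normP; exists r.
apply: filterS2 (near_cvg cG (nG _ G0)) n2 => z /= Gz.
rewrite norm_planeP => /andP[z1 z2].
have [Yr FY] := HY _ Gz; apply: (injF z.1).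
- exact: (lt_trans z1 rr0).
- exact: ltW.
- exact: ltW.
- by apply: (etrans FY); case: (z).
Qed.

End ShearInverse.

(** * Higher derivatives on the line *)

Section OneDim.
Context {R : realType}.
Implicit Types (f g : R -> R) (x r : R).

Definition smooth1 g := forall x, smooth_at (x : R^o) (g : R^o -> R^o).

Lemma smooth1_is_derive g x : smooth1 g -> is_derive x 1 g (derive1 g x).
Proof. by move=> /(_ x); exact: smooth_at_is_derive. Qed.

Lemma smooth1_derive1 g : smooth1 g -> smooth1 (derive1 g).
Proof. by move=> sg x; exact: smooth_at_derive1. Qed.

Lemma smooth1_derive1n k g : smooth1 g -> smooth1 (derive1n k g).
Proof. by move=> sg; elim: k => // k IHk; rewrite derive1nS; exact: smooth1_derive1. Qed.

Lemma is_derive_derive1 g x (a : R) : is_derive x 1 g a -> derive1 g x = a.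
Proof. by move=> d; rewrite derive1E; exact: derive_val. Qed.

(** Smoothness of a function whose successive derivatives are known in advance. *)
Lemma smooth1_tower (h : nat -> R -> R) :
  (forall k x, is_derive x 1 (h k) (h k.+1 x)) -> forall k, smooth1 (h k).
Proof.
move=> dh k x n; elim: n k x => [|n IHn] k x.
  apply/class_at0; apply: near_all => y.
  by have [] := diff_is_derive (dh k y) => d _; exact: differentiable_continuous.
apply: class_at_derive (IHn k.+1 x).
by apply: near_all => y; exact: dh.
Qed.

Lemma derive1n_tower (h : nat -> R -> R) :
  (forall k x, is_derive x 1 (h k) (h k.+1 x)) -> forall k, derive1n k (h 0%N) = h k.
Proof.
move=> dh; elim=> // k IHk; rewrite derive1nS IHk; apply/funext => x.
exact: is_derive_derive1.
Qed.

Lemma derive1n_near k f g x : (\forall y \near x, f y = g y) ->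
  \forall y \near x, derive1n k f y = derive1n k g y.
Proof.
move=> fg; elim: k => [|k IHk]; first exact: fg.
apply: filterS (near_join IHk) => y Ey.
rewrite !derive1nS !derive1E; exact: near_eq_derive.
Qed.

(** In Leibniz's rule only the first two derivatives of r, of order 0 and 1,
are not 0. *)
Lemma derive1n_mulid n g : smooth1 g ->
  derive1n n.+1 (fun r => r * g r) =
  (fun r => r * derive1n n.+1 g r + n.+1%:R * derive1n n g r).
Proof.
move=> sg.
have step h : smooth1 h -> derive1 (fun r => r * h r) = (fun r => r * derive1 h r + h r).
  move=> sh; apply/funext => x; apply: is_derive_derive1.
  have := @is_deriveM _ _ (id : R -> R) h x 1 _ _ (is_derive_id _ _) (smooth1_is_derive x sh).
  move=> H; apply: is_derive_eq H _.
  by congr (_ + _); exact: mulr1.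
elim: n => [|n IHn].
  by rewrite derive1n1 step //; apply/funext => r; rewrite mul1r.
rewrite derive1nS IHn; apply/funext => x; apply: is_derive_derive1.
have s1 := smooth1_derive1n n.+1 sg; have s0 := smooth1_derive1n n sg.
have d1 : is_derive x 1 (fun r => r * derive1n n.+1 g r) (x * derive1n n.+2 g x + derive1n n.+1 g x).
  have := @is_deriveM _ _ (id : R -> R) _ x 1 _ _ (is_derive_id _ _) (smooth1_is_derive x s1).
  move=> H; apply: is_derive_eq H _.
  by congr (_ + _); exact: mulr1.
have d2 : is_derive x 1 (fun r => n.+1%:R * derive1n n g r) (n.+1%:R * derive1n n.+1 g x).
  have H := @is_deriveZ _ _ _ (derive1n n g) n.+1%:R x 1 _ (smooth1_is_derive x s0).
  exact: H.
have H := is_deriveD d1 d2; apply: is_derive_eq H _.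
by rewrite -addrA -[X in X + n.+1%:R * _]mul1r -mulrDl -[1]/(1%:R) -natrD add1n.
Qed.

Lemma derive1n_mulid0 n g : smooth1 g ->
  derive1n n.+1 (fun r => r * g r) 0 = n.+1%:R * derive1n n g 0.
Proof. by move=> sg; rewrite derive1n_mulid // mul0r add0r. Qed.

Lemma smooth1M f g : smooth1 f -> smooth1 g -> smooth1 (fun x => f x * g x).
Proof. by move=> sf sg x; exact: smooth_atM. Qed.
Lemma smooth1D f g : smooth1 f -> smooth1 g -> smooth1 (fun x => f x + g x).
Proof. by move=> sf sg x; exact: smooth_atD. Qed.
Lemma smooth1B f g : smooth1 f -> smooth1 g -> smooth1 (fun x => f x - g x).
Proof. by move=> sf sg x; exact: smooth_atB. Qed.
Lemma smooth1_id : smooth1 id.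
Proof. by move=> x; exact: smooth_at_id. Qed.
Lemma smooth1_cst (a : R) : smooth1 (fun=> a).
Proof. by move=> x; exact: smooth_at_cst. Qed.
Lemma smooth1_comp f g : smooth1 f -> smooth1 g -> smooth1 (fun x => f (g x)).
Proof. by move=> sf sg x; exact: (smooth_at_comp1 (sf _) (sg x)). Qed.
Lemma smooth1X k f : smooth1 f -> smooth1 (fun x => f x ^+ k).
Proof. by move=> sf x; exact: smooth_atX. Qed.

(** The one-variable case of Lop: the integral over [0, 1] of t ^ k g (t r). *)
Definition hop (k : nat) g r : R := Lop k (fun z : plane R => g z.1) (r, 0).

Lemma smooth_at_comp_fst g (z : plane R) :
  smooth_at (z.1 : R^o) (g : R^o -> R^o) -> smooth_at z (fun z : plane R => g z.1 : R^o).
Proof.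
move=> sg.
exact: (@smooth_at_comp1 R (plane R) z g (fun z => z.1) sg (smooth_at_fst z)).
Qed.

Lemma smooth_at_hop k g r : (forall t : R, 0 <= t <= 1 -> smooth_at (t * r : R^o) (g : R^o -> R^o)) ->
  smooth_at (r : R^o) (hop k g : R^o -> R^o).
Proof.
move=> sg.
have s2 : smooth_at (r, 0) (Lop k (fun z : plane R => g z.1)).
  apply: smooth_at_Lop => t t01.
  exact: (smooth_at_comp_fst (z := ray t (r, 0)) (sg t t01)).
exact: (@smooth_at_comp2 R R^o r _ (fun y => y) (fun=> 0) s2 (smooth_at_id _) (smooth_at_cst _ _)).
Qed.

Lemma diff_comp_fst g (z : plane R) : differentiable (g : R^o -> R^o) z.1 ->
  'd (fun z : plane R => g z.1 : R^o) z e1 = derive1 g z.1.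
Proof.
move=> dg; have s1 := smooth_at_differentiable (smooth_at_fst z).
rewrite (diff_comp1v (h := fun w : plane R => w.1) e1 s1 dg) diff_fstv mul1r.
by rewrite derive1E deriveE.
Qed.

Lemma hop_hadamard g r :
  (forall t : R, 0 <= t <= 1 -> smooth_at (t * r : R^o) (g : R^o -> R^o)) ->
  r * hop 0 (derive1 g) r = g r - g 0.
Proof.
move=> sg.
have s2 t (t01 : 0 <= t <= 1) : smooth_at (ray t (r, 0)) (fun z : plane R => g z.1 : R^o).
  exact: (smooth_at_comp_fst (z := ray t (r, 0)) (sg t t01)).
rewrite -[RHS](Lop_hadamard s2) /hop /Lop; congr (_ * _).
apply: eq_int01 => t t01; congr (_ * _).
by rewrite diff_comp_fst //; exact: smooth_at_differentiable (sg t t01).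
Qed.

Lemma hop_euler k g r :
  (forall t : R, 0 <= t <= 1 -> smooth_at (t * r : R^o) (g : R^o -> R^o)) ->
  k.+1%:R * hop k g r + r * hop k.+1 (derive1 g) r = g r.
Proof.
move=> sg.
have s2 t (t01 : 0 <= t <= 1) : smooth_at (ray t (r, 0)) (fun z : plane R => g z.1 : R^o).
  exact: (smooth_at_comp_fst (z := ray t (r, 0)) (sg t t01)).
rewrite -[RHS](Lop_euler k s2) /hop; congr (_ + _ * _).
apply: eq_int01 => t t01; congr (_ * _).
by rewrite diff_comp_fst //; exact: smooth_at_differentiable (sg t t01).
Qed.

Lemma hop_derive k g r :
  (forall t : R, 0 <= t <= 1 -> smooth_at (t * r : R^o) (g : R^o -> R^o)) ->
  is_derive r 1 (hop k g) (hop k.+1 (derive1 g) r).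
Proof.
move=> sg.
have s2 t (t01 : 0 <= t <= 1) : smooth_at (ray t (r, 0)) (fun z : plane R => g z.1 : R^o).
  exact: (smooth_at_comp_fst (z := ray t (r, 0)) (sg t t01)).
have s3 := smooth_at_differentiable (smooth_at_Lop k s2).
have [_ E] := Lop_diff k (fun t t01 => smooth_at_diff (s2 t t01))
  (fun v t t01 => smooth_at_cont (smooth_at_d v (s2 t t01))).
have d1 : differentiable (fun y : R^o => y) r by exact: smooth_at_differentiable (smooth_at_id _).
have d0 : differentiable (fun y : R^o => 0 : R^o) r by exact: differentiable_cst.
have sh : differentiable (hop k g : R^o -> R^o) r.
  exact: smooth_at_differentiable (smooth_at_hop _ sg).
have H := is_derive_diff sh; apply: is_derive_eq H _.
have -> : 'd (hop k g : R^o -> R^o) r 1 = 'd (Lop k (fun z : plane R => g z.1 : R^o)) (r, 0) e1.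
  rewrite [LHS](@diff_comp2v R R^o _ (fun y => y) (fun=> 0) r 1 d1 d0 s3).
  have -> : 'd (fun y : R^o => y) r 1 = 1.
    have := @is_derive_id R R^o r 1 => /diff_is_derive [_ ->] //.
  have -> : 'd (fun=> 0 : R^o) r 1 = 0 :> R.
    by have /(congr1 (fun L => L 1)) := diff_cst (V := R^o) (W := R^o) 0 r.
  by rewrite mul1r mul0r addr0.
rewrite E /= mul1r mul0r addr0 /hop /Lop.
apply: eq_int01 => t t01; congr (_ * _).
by rewrite diff_comp_fst //; exact: smooth_at_differentiable (sg t t01).
Qed.

End OneDim.

(** * A cutoff function *)

Section Bump.
Context {R : realType}.
Implicit Types (x : R).

(** The powers of 1 / x are there to make the family stable under
differentiation, so that the smoothness of exp (- 1 / x) is a single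
induction. *)
Definition flatexp (k : nat) x : R := if 0 < x then x ^- k * expR (- x^-1) else 0.

Lemma flatexpS k x : flatexp k x = flatexp k.+1 x * x.
Proof.
rewrite /flatexp; case: ltP => [x0|]; last by rewrite mul0r.
have xn0 : x != 0 by rewrite gt_eqF.
have xkn0 : x ^+ k != 0 by rewrite expf_neq0.
by rewrite exprS; move: (x ^+ k) (expR _) xkn0 => y E yn0; field; rewrite xn0 yn0.
Qed.

Lemma flatexp_ge0 k x : 0 <= flatexp k x.
Proof.
rewrite /flatexp; case: ltP => // x0.
by rewrite mulr_ge0 ?expR_ge0 // invr_ge0 exprn_ge0 // ltW.
Qed.

Lemma flatexp_le1 k x : 0 < x -> flatexp k.+1 x <= k.+1`!%:R.
Proof.
move=> x0; rewrite /flatexp x0.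
set u := x^-1; have u0 : 0 < u by rewrite invr_gt0.
have f0 : 0 < k.+1`!%:R :> R by rewrite ltr0n fact_gt0.
rewrite -exprVn -/u expRN ler_pdivrMr ?expR_gt0 // mulrC -ler_pdivrMr //.
by apply: le_trans (expR_ge1Dxn k (ltW u0)); rewrite lerDr.
Qed.

Lemma flatexp_bound k x : flatexp k x <= k.+1`!%:R * `|x|.
Proof.
have [x0|x0] := ltP 0 x.
  by rewrite flatexpS gtr0_norm // ler_wpM2r ?flatexp_le1 // ltW.
by rewrite /flatexp ltNge x0 /= mulr_ge0.
Qed.

Lemma flatexp_cont0 k : {for 0, continuous (flatexp k : R^o -> R^o)}.
Proof.
have E0 : flatexp k 0 = 0 by rewrite /flatexp ltxx.
apply/cvgrPdist_lt => e e0; rewrite E0.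
suff : \forall y \near (0 : R^o), `|0 - flatexp k y| < e by [].
pose C : R := k.+1`!%:R.
have C0 : 0 < C by rewrite ltr0n fact_gt0.
apply/near0_normP; exists (e / C); first by rewrite divr_gt0.
move=> h; rewrite ltr_pdivlMr // => hC.
rewrite sub0r normrN ger0_norm ?flatexp_ge0 //.
by apply: le_lt_trans (flatexp_bound k h) _; rewrite mulrC.
Qed.

Lemma near_sign_pos x : 0 < x -> \forall y \near (x : R^o), 0 < y :> R.
Proof. by move=> x0; exact: (@cvgr_gt R _ (nbhs (x : R^o)) _ id x). Qed.

Lemma near_sign_neg x : x < 0 -> \forall y \near (x : R^o), y < 0 :> R.
Proof. by move=> x0; exact: (@cvgr_lt R _ (nbhs (x : R^o)) _ id x). Qed.

Lemma flatexp_derive k x :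
  is_derive x 1 (flatexp k) (flatexp k.+2 x - k%:R * flatexp k.+1 x).
Proof.
have [x0|x0|->] := ltgtP x 0.
- have E : \forall y \near (x : R), cst 0 y = flatexp k y.
    apply: filterS (near_sign_neg x0) => y y0.
    by rewrite /flatexp ltNge (ltW y0).
  apply: (near_eq_is_derive E).
  apply: is_derive_eq (is_derive_cst _ _ _) _.
  by rewrite /flatexp ltNge (ltW x0) /= mulr0 subrr.
- have E : \forall y \near (x : R), y ^- k * expR (- y^-1) = flatexp k y.
    apply: filterS (near_sign_pos x0) => y y0.
    by rewrite /flatexp y0.
  apply: (near_eq_is_derive E).
  have xn0 : x != 0 by rewrite gt_eqF.
  have dV : is_derive x 1 (fun y : R => y^-1) (- x ^- 2).
    have := @is_deriveV R id x 1 1 xn0 (is_derive_id _ _).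
    by move=> h; apply: is_derive_eq h _; exact: mulr1.
  have dVk : is_derive x 1 (fun y : R => y ^- k) (- k%:R * x ^- k.+1).
    have dX : is_derive x 1 (fun y : R => y ^+ k) (k%:R * x ^+ k.-1).
      split; first exact: exprn_derivable.
      by rewrite exp_derive; exact: mulr1.
    have xk0 : x ^+ k != 0 by rewrite expf_neq0.
    have := @is_deriveV R (fun y => y ^+ k) x _ 1 xk0 dX.
    move=> h; apply: is_derive_eq h _.
    rewrite /GRing.scale /=; case: (k) xk0 => [|j] xk0 /=; first by rewrite !mul0r mulr0 oppr0 mul0r.
    have xjn0 : x ^+ j != 0 by rewrite expf_neq0.
    rewrite !exprS expr0; move: (x ^+ j) xjn0 => y yn0.
    by field; rewrite xn0 yn0.
  have dE : is_derive x 1 (fun y : R => expR (- y^-1)) (expR (- x^-1) * x ^- 2).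
    have dN := is_deriveN dV.
    have := @is_derive1_comp R expR (fun y => - y^-1) x _ _ (is_derive_expR _) dN.
    by move=> h; apply: is_derive_eq h _; rewrite opprK.
  have := @is_deriveM _ _ _ _ x 1 _ _ dVk dE.
  move=> h; apply: is_derive_eq h _.
  rewrite /flatexp x0 /GRing.scale /= -!exprVn !exprS expr0.
  move: (x^-1) (expR _) => p E'; ring.
- rewrite [X in is_derive _ _ _ X](_ : _ = flatexp k.+1 0); last first.
    by rewrite /flatexp ltxx mulr0 subrr.
  apply/is_derive1_caratheodory; exists (flatexp k.+1); split => //.
    by move=> z; rewrite subr0 -flatexpS {2}/flatexp ltxx subr0.
  exact: flatexp_cont0.
Qed.

Lemma smooth1_flatexp k : smooth1 (flatexp k).
Proof.
move=> x n; elim: n k => [|n IHn] k.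
  apply/class_at0; apply: near_all => y.
  by have [] := diff_is_derive (flatexp_derive k y) => d _; exact: differentiable_continuous.
apply: (@class_at_derive _ n x _ (fun y => flatexp k.+2 y + (- k%:R) * flatexp k.+1 y)).
  apply: near_all => y; apply: is_derive_eq (flatexp_derive k y) _.
  by rewrite mulNr.
apply: class_atD; first exact: IHn.
apply: class_atM; last exact: IHn.
exact: class_at_cst.
Qed.

(** A function of x ^ 2, so that multiplication by it preserves evenness. *)
Definition cutoff x : R :=
  flatexp 0 (4 - x ^+ 2) / (flatexp 0 (4 - x ^+ 2) + flatexp 0 (x ^+ 2 - 1)).

Lemma flatexp_gt0 x : 0 < x -> 0 < flatexp 0 x.
Proof. by move=> x0; rewrite /flatexp x0 mulr_gt0 ?expR_gt0 // invr_gt0 exprn_gt0. Qed.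

Lemma cutoff_den x : 0 < flatexp 0 (4 - x ^+ 2) + flatexp 0 (x ^+ 2 - 1).
Proof.
have [h|h] := ltP (x ^+ 2) 4.
  by rewrite ltr_pwDl ?flatexp_ge0 // flatexp_gt0 // subr_gt0.
rewrite ltr_wpDl ?flatexp_ge0 // flatexp_gt0 // subr_gt0; lra.
Qed.

Lemma smooth1_cutoff : smooth1 cutoff.
Proof.
have s1 : smooth1 (fun x : R => flatexp 0 (4 - x ^+ 2)).
  apply: smooth1_comp; first exact: smooth1_flatexp.
  by apply: smooth1B; [exact: smooth1_cst|apply: smooth1X; exact: smooth1_id].
have s2 : smooth1 (fun x : R => flatexp 0 (x ^+ 2 - 1)).
  apply: smooth1_comp; first exact: smooth1_flatexp.
  by apply: smooth1B; [apply: smooth1X; exact: smooth1_id|exact: smooth1_cst].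
move=> x; apply: (@smooth_at_div R R^o x _ (fun x => flatexp 0 (4 - x ^+ 2) + flatexp 0 (x ^+ 2 - 1))).
- exact: lt0r_neq0 (cutoff_den x).
- exact: s1.
- by apply: smooth_atD; [exact: s1|exact: s2].
Qed.

Lemma cutoff1 x : `|x| <= 1 -> cutoff x = 1.
Proof.
move=> x1.
have x21 : x ^+ 2 <= 1 by rewrite -real_normK ?num_real // exprn_ile1.
have B : flatexp 0 (x ^+ 2 - 1) = 0.
  by rewrite /flatexp ltNge; have -> : x ^+ 2 - 1 <= 0 by lra.
rewrite /cutoff B addr0 divff // gt_eqF // flatexp_gt0 // subr_gt0; lra.
Qed.

Lemma cutoff0 x : 2 <= `|x| -> cutoff x = 0.
Proof.
move=> x1; rewrite /cutoff {1}/flatexp ltNge.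
have -> /= : 4 - x ^+ 2 <= 0; last by rewrite mul0r.
rewrite subr_le0 -real_normK ?num_real //.
have -> : 4 = 2 ^+ 2 :> R by ring.
by apply: lerXn2r; rewrite ?nnegrE.
Qed.

Lemma cutoff_even x : cutoff (- x) = cutoff x.
Proof. by rewrite /cutoff sqrrN. Qed.

End Bump.

(** * Borel's theorem *)

Section Borel.
Context {R : realType}.
Implicit Types (f g : R -> R) (s x : R).

Lemma mvt1 g s : smooth1 g -> exists2 t, `|t| <= `|s| & g s - g 0 = derive1 g t * s.
Proof.
move=> sg.
have dg (t : R) : derivable (g : R^o -> R^o) t 1.
  by have := smooth1_is_derive t sg => d; exact: ex_derive.
have [|t ts E] := @MVT_dir R R^o g 0 1 s; first by move=> t _; exact: dg.
exists t => //; move: E; rewrite !addr0 [s *: 1]mulr1 [t *: 1]mulr1 => ->.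
by rewrite mulrC derive1E.
Qed.

Lemma derive1n_scale k g (a c : R) : smooth1 g ->
  derive1n k (fun s => a * g (s * c)) = (fun s => a * c ^+ k * derive1n k g (s * c)).
Proof.
move=> sg; elim: k => [|k IHk]; first by apply/funext => s; rewrite /= mulr1.
rewrite derive1nS IHk; apply/funext => s; apply: is_derive_derive1.
have dk := smooth1_is_derive (s * c) (smooth1_derive1n k sg).
have dc : is_derive s 1 (fun s : R => s * c) c.
  have := @is_deriveM _ _ (id : R -> R) (cst c) s 1 _ _ (is_derive_id _ _) (is_derive_cst _ _ _).
  move=> h; apply: is_derive_eq h _.
  by rewrite scaler0 add0r; exact: mulr1.
have H := @is_derive1_comp R (derive1n k g) (fun s => s * c) s _ _ dk dc.
have H2 := @is_deriveZ _ _ _ (derive1n k g \o (fun s : R => s * c)) (a * c ^+ k) s 1 _ H.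
apply: is_derive_eq H2 _.
rewrite /GRing.scale /= exprS; ring.
Qed.

Lemma derive1n_monomial n k (a : R) :
  derive1n k (fun s => a * s ^+ n) 0 = if k == n then a * n`!%:R else 0.
Proof.
have smono m : smooth1 (fun s : R => a * s ^+ m).
  by apply: smooth1M; [exact: smooth1_cst|apply: smooth1X; exact: smooth1_id].
elim: n k => [|n IHn] [|k].
- by rewrite /= expr0 !mulr1.
- rewrite (_ : (fun s => _) = (fun s => a * 1)); last first.
    by apply/funext => s; rewrite expr0.
  have /(congr1 (fun h => h 0)) E := @derive1n_scale k.+1 (fun=> 1) a 0 (smooth1_cst 1).
  by apply: (etrans E); rewrite exprS mul0r mulr0 mul0r.
- by rewrite /= expr0n /= mulr0.
- rewrite (_ : (fun s => _) = (fun s => s * (a * s ^+ n))); last first.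
    by apply/funext => s; rewrite exprS mulrCA.
  rewrite derive1n_mulid0 // IHn eqSS; case: eqP => [->|_]; last by rewrite mulr0.
  by rewrite factS natrM mulrCA mulrA.
Qed.

Lemma derive1n_support k g (r : R) : (forall s, r < `|s| -> g s = 0) ->
  forall s, r < `|s| -> derive1n k g s = 0.
Proof.
move=> g0 s rs.
have n : \forall y \near (s : R^o), r < `|y : R|.
  apply: (@cvgr_gt R _ (nbhs (s : R^o)) _ (fun y : R^o => `|y|) `|s|) => //.
  exact: norm_continuous.
have E : \forall y \near (s : R^o), g y = (fun t => 0 * 1) y.
  by apply: filterS n => y /g0 ->; rewrite mul0r.
rewrite (nbhs_singleton (derive1n_near k E)).
have /(congr1 (fun h => h s)) E' := @derive1n_scale k (fun=> 1) 0 0 (smooth1_cst 1).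
by apply: (etrans E'); rewrite !mul0r.
Qed.

Lemma compact_support_bounded g (r : R) : 0 <= r -> smooth1 g ->
  (forall s, r < `|s| -> g s = 0) -> exists2 M, 0 <= M & forall s, `|g s| <= M.
Proof.
move=> r0 sg g0.
have c : {within `[- r, r], continuous (fun s : R => `|g s|)}.
  apply: continuous_in_subspaceT => s _.
  apply: (@continuous_comp _ _ _ g (fun x : R => `|x|)); last exact: norm_continuous.
  exact: smooth_at_cont (sg s).
have [|t _ tM] := @EVT_max R _ (- r) r _ c; first lra.
exists `|g t| => // s; have [sr|sr] := leP `|s| r; last by rewrite g0 ?normr0.
by apply: tM; rewrite in_itv /= -ler_norml.
Qed.

Lemma compact_support_bounded_all n g (r : R) : 0 <= r -> smooth1 g ->
  (forall s, r < `|s| -> g s = 0) ->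
  exists2 M, 0 <= M & forall k, (k <= n)%N -> forall s, `|derive1n k g s| <= M.
Proof.
move=> r0 sg g0; elim: n => [|n [M M0 HM]].
  have [M M0 HM] := compact_support_bounded r0 sg g0.
  by exists M => // k; rewrite leqn0 => /eqP ->.
have [M' M'0 HM'] := compact_support_bounded r0 (smooth1_derive1n n.+1 sg)
  (derive1n_support n.+1 g0).
exists (M + M'); first exact: addr_ge0.
move=> k; rewrite leq_eqVlt => /orP[/eqP -> s|kn s].
  by apply: (le_trans (HM' s)); rewrite lerDr.
by apply: (le_trans (HM k kn s)); rewrite lerDl.
Qed.

(** Two applications of the mean value theorem. *)
Lemma taylor2 g (C s : R) : smooth1 g -> g 0 = 0 -> derive1 g 0 = 0 -> 0 <= C ->
  (forall t, `|derive1n 2 g t| <= C) -> `|g s| <= C * s ^+ 2.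
Proof.
move=> sg g0 g1 C0 b.
have b1 t : `|derive1 g t| <= C * `|t|.
  have [u _ E] := mvt1 t (smooth1_derive1 sg).
  by move: E; rewrite g1 subr0 => ->; rewrite normrM ler_wpM2r //; exact: b.
have [u us E] := mvt1 s sg; move: E; rewrite g0 subr0 => ->.
rewrite normrM -[s ^+ 2]real_normK ?num_real // expr2 mulrA ler_wpM2r //.
by apply: (le_trans (b1 u)); rewrite ler_wpM2l.
Qed.

(** The n-th term of Borel's series: a multiple of s ^ n, cut off at a scale d.
Its k-th derivative has size d ^ (n - k), hence is small with d as soon as
k < n. The bound by e s ^ 2 uses this for the order k + 2, together with the
vanishing at 0 of the derivatives of order k and k + 1; this is why it needs
k + 3 <= n. Such a bound allows termwise differentiation of the series at 0,
while the condition on the support makes the sum finite elsewhere. *)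
Lemma borel_term (n : nat) (c e : R) : 0 < e -> exists T, [/\ smooth1 T,
  forall k, derive1n k T 0 = if k == n then c else 0,
  forall k s, e < `|s| -> derive1n k T s = 0 &
  forall k, (k + 3 <= n)%N -> forall s, `|derive1n k T s| <= e * s ^+ 2].
Proof.
move=> e0; pose phi s := s ^+ n * cutoff s.
have sphi : smooth1 phi.
  by apply: smooth1M; [apply: smooth1X; exact: smooth1_id|exact: smooth1_cutoff].
have phi0 s : 2 < `|s| -> phi s = 0 by move=> h; rewrite /phi cutoff0 ?mulr0 // ltW.
have [M M0 HM] := compact_support_bounded_all n (ler0n R 2) sphi phi0.
have f0 : 0 < n`!%:R :> R by rewrite ltr0n fact_gt0.
have [a aE] : exists a : R, a = c / n`!%:R by eexists.
pose C : R := 1 + `|a| * M.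
have C1 : 0 < C by rewrite ltr_pwDl // mulr_ge0.
(* d <= 1 bounds d ^ (n - k - 2) by d, d <= e / 2 puts the support in [-e, e],
   and d <= e / C absorbs the coefficient and the derivatives of phi. *)
pose d := Num.min 1 (Num.min (e / 2) (e / C)).
have d0 : 0 < d by rewrite !lt_min ltr01 !divr_gt0.
have d1 : d <= 1 by rewrite ge_min lexx.
have d2 : d <= e / 2 by rewrite !ge_min lexx !orbT.
have d3 : d <= e / C by rewrite !ge_min lexx !orbT.
pose T s := (a * d ^+ n) * phi (s * d^-1).
have DT k : derive1n k T = (fun s => (a * d ^+ n) * d^-1 ^+ k * derive1n k phi (s * d^-1)).
  exact: derive1n_scale.
have sT : smooth1 T.
  apply: smooth1M; first exact: smooth1_cst.
  apply: smooth1_comp sphi _.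
  by apply: smooth1M; [exact: smooth1_id|exact: smooth1_cst].
have phik k : derive1n k phi 0 = if k == n then n`!%:R else 0.
  have E : \forall y \near (0 : R^o), phi y = (fun t => 1 * t ^+ n) y.
    apply/near0_normP; exists 1 => // y /ltW y1.
    by rewrite /phi cutoff1 // mulr1 mul1r.
  by rewrite (nbhs_singleton (derive1n_near k E)) derive1n_monomial mul1r.
have T0 k : derive1n k T 0 = if k == n then c else 0.
  rewrite DT mul0r phik; case: eqP => [->|_]; last by rewrite mulr0.
  rewrite aE.
  by rewrite -mulrA -mulrA [d ^+ n * _]mulrA -exprMn divff ?gt_eqF // expr1n mul1r divfK // gt_eqF.
exists T; split=> //.
- move=> k s es; rewrite DT (derive1n_support k phi0) ?mulr0 //.
  rewrite normrM normfV (gtr0_norm d0) ltr_pdivlMr //.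
  by apply: le_lt_trans es; rewrite mulrC -ler_pdivlMr.
- move=> k kn s; apply: taylor2.
  + exact: smooth1_derive1n.
  + by rewrite T0; case: eqP => // E; exfalso; lia.
  + by rewrite -derive1nS T0; case: eqP => // E; exfalso; lia.
  + exact: ltW.
  + move=> t; have [m mE] : exists m, m = k.+2 by eexists.
    have -> : derive1n 2 (derive1n k T) = derive1n m T by rewrite mE.
    rewrite DT; have mn : (m < n)%N by rewrite mE; lia.
    rewrite !normrM !normrX normfV (gtr0_norm d0).
    have -> : `|a| * d ^+ n * d^-1 ^+ m = `|a| * d ^+ (n - m).
      rewrite -mulrA; congr (_ * _).
      rewrite -{1}(subnK (ltnW mn)) exprD -mulrA -exprMn divff ?gt_eqF //.
      by rewrite expr1n mulr1.
    have h1 : d ^+ (n - m) <= d.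
      have : (0 < n - m)%N by rewrite subn_gt0.
      case: (n - m)%N => // j _.
      by rewrite exprS ler_piMr ?(ltW d0) // exprn_ile1 // ltW.
    apply: (@le_trans _ _ (`|a| * d * M)).
      apply: ler_pM => //; last by apply: HM; exact: ltnW.
        by rewrite mulr_ge0 // exprn_ge0 // ltW.
      by rewrite ler_wpM2l.
    rewrite mulrAC; apply: (@le_trans _ _ (`|a| * M * (e / C))).
      by rewrite ler_wpM2l // mulr_ge0.
    rewrite mulrCA ler_piMr ?(ltW e0) // ler_pdivrMr // mul1r /C.
    by rewrite lerDr.
Qed.

End Borel.

Section BorelSum.
Context {R : realType}.
Implicit Types (s x y : R).

Lemma sum_trunc (a : nat -> R) (m M : nat) : (m <= M)%N ->
  (forall i, (m <= i)%N -> a i = 0) -> \sum_(i < M) a i = \sum_(i < m) a i.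
Proof.
move=> mM a0; rewrite -!(big_mkord xpredT a) (big_cat_nat (leq0n m) mM) //=.
by rewrite [X in _ + X]big_nat_cond [X in _ + X]big1 ?addr0 // => i /andP[/andP[/a0]].
Qed.

(** The n-th term of a series with sum 1, and a bound on the support and on the
size of the n-th term of Borel's series. *)
Definition half_pow (n : nat) : R := 2^-1 ^+ n.+1.

Lemma half_pow_gt0 n : 0 < half_pow n.
Proof. by rewrite exprn_gt0 // invr_gt0. Qed.

Lemma half_pow_decr m n : (m <= n)%N -> half_pow n <= half_pow m.
Proof.
move=> mn; rewrite /half_pow; apply: ler_wiXn2l => //; lra.
Qed.

Lemma half_pow_sum m : \sum_(i < m) half_pow i = 1 - 2^-1 ^+ m.
Proof.
elim: m => [|m IHm]; first by rewrite big_ord0 expr0 subrr.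
by rewrite big_ord_recr /= IHm /half_pow exprS; field.
Qed.

Lemma half_pow_small s : s != 0 -> exists N, half_pow N < `|s|.
Proof.
move=> s0; have s1 : 0 < `|s| by rewrite normr_gt0.
have := archi_boundP (ltW (_ : 0 < `|s|^-1)); rewrite invr_gt0 => /(_ s1).
set N := Num.bound _ => NB; exists N.
rewrite /half_pow exprVn -[X in _ < X]invrK ltf_pV2 ?posrE ?invr_gt0 ?exprn_gt0 //.
apply: (lt_trans NB); rewrite -natrX ltr_nat.
by apply: ltn_trans (ltnSn _) _; exact: ltn_expl.
Qed.

Lemma is_derive_sq_bound (E : R -> R) : (forall s, `|E s| <= s ^+ 2) -> is_derive (0 : R) 1 E 0.
Proof.
move=> bE; have E0 : E 0 = 0 by apply/eqP; rewrite -normr_le0; have := bE 0; rewrite expr0n.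
apply/is_derive1_caratheodory; exists (fun z => E z / z); split.
- move=> z; rewrite E0 !subr0; have [->|z0] := eqVneq z 0; first by rewrite E0 mulr0.
  by rewrite divfK.
- have q z : `|E z / z| <= `|z|.
    have [->|z0] := eqVneq z 0; first by rewrite invr0 mulr0.
    rewrite normrM normfV ler_pdivrMr ?normr_gt0 // -expr2 real_normK ?num_real //.
  apply/cvgrPdist_lt => e e0; rewrite E0 mul0r.
  suff : \forall z \near (0 : R^o), `|0 - E z / z| < e by [].
  apply/near0_normP; exists e => // h he; rewrite sub0r normrN.
  exact: le_lt_trans (q h) he.
- by rewrite E0 mul0r.
Qed.

Section Sum.
Context (c : nat -> R) (T : nat -> R -> R).
Context (sT : forall n, smooth1 (T n)).
Context (T0 : forall n k, derive1n k (T n) 0 = if k == n then c n else 0).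
Context (Tsupp : forall n k s, half_pow n < `|s| -> derive1n k (T n) s = 0).
Context (Tsmall : forall n k, (k + 3 <= n)%N ->
  forall s, `|derive1n k (T n) s| <= half_pow n * s ^+ 2).

Let N s : nat := xget 0%N [set N | half_pow N < `|s|].

Let NP s : s != 0 -> half_pow (N s) < `|s|.
Proof. by move=> /half_pow_small; exact: (@xgetPex _ 0%N [set N | half_pow N < `|s|]). Qed.

(** The k-th termwise derivative of the series of the T n. It is written as a
finite sum, whose length depends on s, because the remaining terms are 0. *)
Definition borel_sum k s : R :=
  if s == 0 then c k else \sum_(i < N s) derive1n k (T i) s.

Let borel_sumE k s m : half_pow m < `|s| ->
  borel_sum k s = \sum_(i < m) derive1n k (T i) s.
Proof.
move=> ms; have s0 : s != 0.
  by rewrite -normr_gt0; exact: lt_trans (half_pow_gt0 m) ms.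
rewrite /borel_sum (negbTE s0).
have z j i : half_pow j < `|s| -> (j <= i)%N -> derive1n k (T i) s = 0.
  by move=> js ji; apply: Tsupp; exact: le_lt_trans (half_pow_decr ji) js.
have [Nm|mN] := leqP (N s) m.
  by apply: esym; apply: (@sum_trunc (fun i => derive1n k (T i) s) _ _ Nm) => i; apply: z; exact: NP.
by apply: (@sum_trunc (fun i => derive1n k (T i) s) _ _ (ltnW mN)) => i; exact: z.
Qed.

Let is_derive_partial k m x :
  is_derive x 1 (fun y => \sum_(i < m) derive1n k (T i) y)
    (\sum_(i < m) derive1n k.+1 (T i) x).
Proof.
elim: m => [|m IHm].
  rewrite big_ord0 (_ : (fun _ => _) = cst 0); first exact: is_derive_cst.
  by apply/funext => y; rewrite big_ord0.
rewrite big_ord_recr /=.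
rewrite (_ : (fun y => \sum_(i < m.+1) _) =
  (fun y => \sum_(i < m) derive1n k (T i) y) \+ derive1n k (T m)); last first.
  by apply/funext => y; rewrite big_ord_recr.
by apply: is_deriveD; exact: smooth1_is_derive (smooth1_derive1n k (sT m)).
Qed.

Let partial0 k m : (k < m)%N -> \sum_(i < m) derive1n k (T i) 0 = c k.
Proof.
move=> km; rewrite (bigD1 (Ordinal km)) //= T0 eqxx big1 ?addr0 // => i ik.
rewrite T0; case: eqP => // E; case/eqP: ik; exact: val_inj.
Qed.

(** The terms of index at least k + 3 are bounded by half_pow n * s ^ 2, so that
they contribute neither to the value nor to the derivative at 0. *)
Let remainder k s :
  `|borel_sum k s - \sum_(i < k + 3) derive1n k (T i) s| <= s ^+ 2.
Proof.
have [->|s0] := eqVneq s 0.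
  by rewrite /borel_sum eqxx partial0 ?subrr ?normr0 ?expr0n //= addn3 ltnS leqW.
pose m := maxn (N s) (k + 3).
have ms : half_pow m < `|s|.
  by apply: le_lt_trans (NP s0); apply: half_pow_decr; exact: leq_maxl.
have km : (k + 3 <= m)%N by exact: leq_maxr.
rewrite (borel_sumE k ms) -!(big_mkord xpredT (fun i => derive1n k (T i) s)).
have aux (a b : R) : a + b - a = b by ring.
rewrite (big_cat_nat (leq0n _) km) //= aux.
apply: (le_trans (ler_norm_sum _ _ _)).
apply: (@le_trans _ _ (\sum_(k + 3 <= i < m) half_pow i * s ^+ 2)).
  rewrite big_nat_cond [X in _ <= X]big_nat_cond; apply: ler_sum.
  by move=> i /andP[/andP[ki _] _]; exact: Tsmall.
rewrite -mulr_suml ler_piMl ?sqr_ge0 //.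
apply: (@le_trans _ _ (\sum_(i < m) half_pow i)).
  rewrite -(big_mkord xpredT) [X in _ <= X](big_cat_nat (leq0n _) km) //= lerDr.
  by apply: sumr_ge0 => i _; exact: ltW (half_pow_gt0 _).
by rewrite half_pow_sum gerBl exprn_ge0 // invr_ge0.
Qed.

Lemma borel_sum_derive k x : is_derive x 1 (borel_sum k) (borel_sum k.+1 x).
Proof.
have [->|x0] := eqVneq x 0.
  rewrite {2}/borel_sum eqxx.
  rewrite (_ : borel_sum k = (fun y => borel_sum k y - \sum_(i < k + 3) derive1n k (T i) y)
    \+ (fun y => \sum_(i < k + 3) derive1n k (T i) y)); last first.
    by apply/funext => y /=; rewrite subrK.
  have d1 := is_derive_sq_bound (remainder k).
  have d2 := is_derive_partial k (k + 3) 0.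
  have d := is_deriveD d1 d2; apply: is_derive_eq d _.
  by rewrite add0r partial0 // addn3 ltnS leqW.
have mx := NP x0; set m := N x in mx.
have n : \forall y \near (x : R^o), half_pow m < `|y : R|.
  apply: (@cvgr_gt R _ (nbhs (x : R^o)) _ (fun y : R^o => `|y|) `|x|) => //.
  exact: norm_continuous.
have E : \forall y \near (x : R), \sum_(i < m) derive1n k (T i) y = borel_sum k y.
  by apply: filterS n => y my; rewrite (borel_sumE k my).
rewrite (borel_sumE k.+1 mx).
exact: (near_eq_is_derive E (is_derive_partial k m x)).
Qed.

End Sum.

(** The termwise derivatives of the series of the functions of borel_term form a
sequence in which each function is the derivative of the previous one. *)
Theorem borel (c : nat -> R) : exists B, smooth1 B /\ forall k, derive1n k B 0 = c k.
Proof.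
have /choice[T HT] : forall n, exists T, [/\ smooth1 T,
  forall k, derive1n k T 0 = if k == n then c n else 0,
  forall k s, half_pow n < `|s| -> derive1n k T s = 0 &
  forall k, (k + 3 <= n)%N -> forall s, `|derive1n k T s| <= half_pow n * s ^+ 2].
  by move=> n; exact: borel_term (half_pow_gt0 n).
have d := @borel_sum_derive c T (fun n => let: And4 h _ _ _ := HT n in h)
  (fun n => let: And4 _ h _ _ := HT n in h) (fun n => let: And4 _ _ h _ := HT n in h)
  (fun n => let: And4 _ _ _ h := HT n in h).
exists (borel_sum c T 0); split; first exact: (smooth1_tower d).
by move=> k; rewrite (derive1n_tower d) /borel_sum eqxx.
Qed.

End BorelSum.

(** * Whitney's theorem on even functions *)

Section Whitney.
Context {R : realType}.
Implicit Types (F G B : R -> R) (r s x : R).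

Definition flat F := smooth1 F /\ forall n, derive1n n F 0 = 0.

Lemma flat0 F : flat F -> F 0 = 0. Proof. by case=> _ /(_ 0%N). Qed.

Lemma flat_derive1 F : flat F -> flat (derive1 F).
Proof. by case=> sF F0; split=> [|n]; [exact: smooth1_derive1|rewrite -derive1Sn]. Qed.

(** Hadamard's quotient A of F is flat, as the derivative of order n + 1 of
r A (r) at 0 is n + 1 times the derivative of order n of A. *)
Lemma flat_factor F : flat F -> exists A, flat A /\ F = (fun r => r * A r).
Proof.
move=> fF; have [sF F0] := fF; pose A := hop 0 (derive1 F).
have sA : smooth1 A by move=> r; apply: smooth_at_hop => t _; exact: smooth1_derive1.
have FE : F = (fun r => r * A r).
  by apply/funext => r; rewrite /A hop_hadamard ?(flat0 fF) ?subr0 // => t _; exact: sF.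
exists A; split=> //; split=> // n.
have := F0 n.+1; rewrite FE derive1n_mulid0 // => /eqP.
by rewrite mulf_eq0 pnatr_eq0 /= => /eqP.
Qed.

Lemma flat_sqrt_continuous F : smooth1 F -> continuous (F \o Num.sqrt : R^o -> R^o).
Proof.
move=> sF s; apply: (@continuous_comp _ _ _ Num.sqrt F).
  exact: sqrt_continuous.
exact: smooth_at_cont (sF _).
Qed.

(** For x > 0 the derivative is F' (sqrt x) / (2 sqrt x), and F' (r) / r is again
flat. At 0, dividing F twice gives F (sqrt x) = x C (sqrt x) with C flat. *)
Lemma flat_sqrt_derive F : flat F -> exists F1, flat F1 /\
  forall x, is_derive x 1 (F \o Num.sqrt) (F1 (Num.sqrt x)).
Proof.
move=> fF; have [sF _] := fF.
have [A [fA AE]] := flat_factor (flat_derive1 fF).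
have [B [fB FB]] := flat_factor fF.
have [C [fC BC]] := flat_factor fB.
have [sA A0] := fA; have [sC _] := fC.
(* The factor 1 is the scaling that derive1n_scale expects. *)
exists (fun r => 2^-1 * A (r * 1)); split.
  split; last by move=> n; rewrite derive1n_scale // mul0r A0 mulr0.
  apply: smooth1M; first exact: smooth1_cst.
  apply: smooth1_comp sA _; apply: smooth1M; [exact: smooth1_id|exact: smooth1_cst].
move=> x; rewrite mulr1; have [x0|x0|->] := ltgtP x 0.
- have E : \forall y \near (x : R), cst 0 y = (F \o Num.sqrt) y.
    apply: filterS (near_sign_neg x0) => y y0 /=.
    by rewrite ler0_sqrtr ?(flat0 fF) // ltW.
  apply: (near_eq_is_derive E).
  apply: is_derive_eq (is_derive_cst _ _ _) _.
  by rewrite ler0_sqrtr ?(flat0 fA) ?mulr0 // ltW.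
- have s0 : 0 < Num.sqrt x by rewrite sqrtr_gt0.
  have d := @is_derive1_comp R F Num.sqrt x _ _ (smooth1_is_derive _ sF) (is_derive1_sqrt x0).
  apply: is_derive_eq d _.
  by rewrite AE; field; rewrite gt_eqF.
- rewrite sqrtr0 (flat0 fA) mulr0; apply/is_derive1_caratheodory.
  exists (C \o Num.sqrt); split.
  + move=> z /=; rewrite sqrtr0 (flat0 fF) !subr0.
    have [z0|z0] := leP 0 z.
      by rewrite FB BC mulrA -expr2 sqr_sqrtr // mulrC.
    by rewrite ler0_sqrtr ?(ltW z0) // (flat0 fF) (flat0 fC) mul0r.
  + exact: flat_sqrt_continuous.
  + by rewrite /= sqrtr0 (flat0 fC).
Qed.

(** By flat_sqrt_derive the functions of this form are stable under
differentiation. *)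
Lemma smooth1_flat_sqrt F : flat F -> smooth1 (F \o Num.sqrt).
Proof.
move=> fF x n; elim: n F fF => [|n IHn] F fF.
  apply: continuous_class_at0; apply: flat_sqrt_continuous; by case: fF.
have [F1 [fF1 d]] := flat_sqrt_derive fF.
by apply: class_at_derive (IHn _ fF1); apply: near_all.
Qed.

Lemma smooth1_comp_sqr B : smooth1 B -> smooth1 (fun r => B (r ^+ 2)).
Proof. by move=> sB; apply: smooth1_comp sB _; apply: smooth1X; exact: smooth1_id. Qed.

Lemma derive1_comp_sqr B : smooth1 B ->
  derive1 (fun r => B (r ^+ 2)) = (fun r => r * (2 * derive1 B ((r * 1) ^+ 2))).
Proof.
move=> sB; apply/funext => r; apply: is_derive_derive1.
have dX : is_derive r 1 (fun s : R => s ^+ 2) (2 * r).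
  split; first exact: exprn_derivable.
  by rewrite exp_derive expr1; exact: mulr1.
have d := @is_derive1_comp R B (fun s => s ^+ 2) r _ _ (smooth1_is_derive _ sB) dX.
by apply: is_derive_eq d _; rewrite mulr1; ring.
Qed.

Lemma derive1n_comp_sqr n B : smooth1 B ->
  derive1n n.+2 (fun r => B (r ^+ 2)) 0 =
  2 * n.+1%:R * derive1n n (fun r => derive1 B (r ^+ 2)) 0.
Proof.
move=> sB; have sB' := smooth1_comp_sqr (smooth1_derive1 sB).
rewrite derive1Sn derive1_comp_sqr // derive1n_mulid0; last first.
  apply: smooth1M; first exact: smooth1_cst.
  apply: smooth1_comp (smooth1_derive1 sB) _; apply: smooth1X.
  by apply: smooth1M; [exact: smooth1_id|exact: smooth1_cst].
rewrite (derive1n_scale n 2 1 sB') expr1n mul0r; ring.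
Qed.

(** This is (2 k)! / k!, in the recursive form given by derive1n_comp_sqr. *)
Fixpoint kappa k : R := if k is k'.+1 then 2 * (k'.*2).+1%:R * kappa k' else 1.

Lemma kappa_neq0 k : kappa k != 0.
Proof. by elim: k => [|k IHk] /=; rewrite ?oner_neq0 // !mulf_neq0 ?pnatr_eq0. Qed.

Lemma derive1n_comp_sqr_double k B : smooth1 B ->
  derive1n k.*2 (fun r => B (r ^+ 2)) 0 = kappa k * derive1n k B 0.
Proof.
elim: k B => [|k IHk] B sB; first by rewrite /= expr0n mul1r.
rewrite doubleS derive1n_comp_sqr // IHk; last exact: smooth1_derive1.
by rewrite -derive1Sn mulrA.
Qed.

Lemma derive1n_odd_even k G : smooth1 G -> (forall r, G (- r) = G r) -> odd k ->
  derive1n k G 0 = 0.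
Proof.
move=> sG eG ok.
have E : G = (fun s => 1 * G (s * -1)).
  by apply/funext => s; rewrite mul1r mulrN1 eG.
have := derive1n_scale k 1 (-1) sG; rewrite -E => /(congr1 (fun h => h 0)).
rewrite mul0r mul1r -signr_odd ok expr1 mulN1r => H; lra.
Qed.

Lemma derive1nB k F G : smooth1 F -> smooth1 G ->
  derive1n k (fun r => F r - G r) = (fun r => derive1n k F r - derive1n k G r).
Proof.
move=> sF sG; elim: k => // k IHk; rewrite derive1nS IHk; apply/funext => x.
apply: is_derive_derive1.
exact: is_deriveB (smooth1_is_derive x (smooth1_derive1n k sF))
  (smooth1_is_derive x (smooth1_derive1n k sG)).
Qed.

(** By Borel's theorem some B (r ^ 2) has the same derivatives at 0 as G. The
difference is flat and even, so it is a flat function of |r|, the square root of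
r ^ 2. *)
Theorem whitney_even G : smooth1 G -> (forall r, G (- r) = G r) ->
  exists2 h, smooth1 h & forall r, G r = h (r ^+ 2).
Proof.
move=> sG eG.
have [B [sB B0]] := borel (fun k => derive1n k.*2 G 0 / kappa k).
pose F r := G r - B (r ^+ 2).
have sF : smooth1 F by apply: smooth1B => //; exact: smooth1_comp_sqr.
have eF r : F (- r) = F r by rewrite /F eG sqrrN.
have fF : flat F.
  split=> // n; have [on|en] := boolP (odd n); first exact: derive1n_odd_even.
  rewrite derive1nB //; last exact: smooth1_comp_sqr.
  have -> : n = (n./2).*2 by rewrite -[LHS]odd_double_half (negbTE en).
  by rewrite derive1n_comp_sqr_double // B0 mulrC divfK ?kappa_neq0 // subrr.
exists (fun s => (F \o Num.sqrt) s + B s).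
  by apply: smooth1D => //; exact: smooth1_flat_sqrt.
move=> r; rewrite /= sqrtr_sqr.
have -> : F `|r| = F r by case: (ger0P r).
by rewrite /F subrK.
Qed.

(** The function is made global by an even cutoff. *)
Lemma whitney_even_near G (d : R) : 0 < d ->
  (forall r, `|r| < d -> smooth_at (r : R^o) (G : R^o -> R^o)) ->
  (forall r, `|r| < d -> G (- r) = G r) ->
  exists2 h, smooth1 h & \forall r \near (0 : R^o), G r = h (r ^+ 2).
Proof.
move=> d0 sG eG; have c0 : 0 < 3 / d by rewrite divr_gt0.
(* The cutoff is 1 for |r| <= d / 3 and vanishes for |r| >= 2 d / 3. *)
pose H r := cutoff (r * (3 / d)) * G r.
have nrm r : `|r * (3 / d)| = `|r| * (3 / d) by rewrite normrM (gtr0_norm c0).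
have H0 r : 2 / 3 * d < `|r| -> H r = 0.
  move=> dr; rewrite /H cutoff0 ?mul0r // nrm mulrA ler_pdivlMr //; lra.
have sH : smooth1 H.
  move=> r; have [rd|dr] := ltP `|r| d.
    apply: smooth_atM; last exact: sG.
    have s1 : smooth1 (fun r : R => cutoff (r * (3 / d))).
      apply: smooth1_comp; first exact: smooth1_cutoff.
      by apply: smooth1M; [exact: smooth1_id|exact: smooth1_cst].
    exact: s1.
  have n : \forall y \near (r : R^o), 2 / 3 * d < `|y : R|.
    apply: (@cvgr_gt R _ (nbhs (r : R^o)) _ (fun y : R^o => `|y|) `|r|).
      exact: norm_continuous.
    lra.
  apply: smooth_at_ext (smooth_at_cst (r : R^o) 0).
  by apply: filterS n => y /H0.
have eH r : H (- r) = H r.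
  have [rd|dr] := ltP `|r| d; first by rewrite /H mulNr cutoff_even eG.
  by rewrite !H0 ?normrN //; lra.
have [h sh hE] := whitney_even sH eH.
exists h => //; apply/near0_normP; exists (d / 3); first by rewrite divr_gt0.
move=> r rd; rewrite -hE /H cutoff1 ?mul1r // nrm mulrA ler_pdivrMr // mul1r.
have : `|r : R| < d / 3 by exact: rd.
lra.
Qed.

End Whitney.

(** * Germs of smooth functions *)

Section SmoothNear.
Context {R : realType} {V : normedModType R}.
Implicit Types (x : V) (f g : V -> R^o).

(** One neighborhood for all orders, whereas the neighborhoods in smooth_at may
shrink with the order. *)
Definition smooth_near x f := \forall y \near x, smooth_at y f.

Lemma smooth_near_at x f : smooth_near x f -> smooth_at x f.
Proof. exact: nbhs_singleton. Qed.

Lemma smooth_near_join x f : smooth_near x f -> \forall y \near x, smooth_near y f.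
Proof. exact: near_join. Qed.

Lemma smooth_near_cst x (a : R) : smooth_near x (fun=> a : R^o).
Proof. by apply: near_all => y; exact: smooth_at_cst. Qed.

Lemma smooth_nearD x f g : smooth_near x f -> smooth_near x g ->
  smooth_near x (fun y => f y + g y).
Proof. by apply: filterS2 => y; exact: smooth_atD. Qed.

Lemma smooth_nearB x f g : smooth_near x f -> smooth_near x g ->
  smooth_near x (fun y => f y - g y).
Proof. by apply: filterS2 => y; exact: smooth_atB. Qed.

Lemma smooth_nearM x f g : smooth_near x f -> smooth_near x g ->
  smooth_near x (fun y => f y * g y).
Proof. by apply: filterS2 => y; exact: smooth_atM. Qed.

Lemma smooth_nearX k x f : smooth_near x f -> smooth_near x (fun y => f y ^+ k).
Proof. by apply: filterS => y; exact: smooth_atX. Qed.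

Lemma smooth_near_diff x f v : smooth_near x f -> smooth_near x (fun y => 'd f y v).
Proof. by apply: filterS => y; exact: smooth_at_d. Qed.

Lemma near_comp1 x (f : V -> R^o) (y : R^o) (P : set R^o) : smooth_at x f -> f x = y ->
  (\forall z \near y, P z) -> \forall w \near x, P (f w).
Proof. by move=> /smooth_at_cont c <- nP; exact: (near_cvg c nP). Qed.

Lemma near_comp2 x (f g : V -> R^o) (z : plane R) (P : set (plane R)) :
  smooth_at x f -> smooth_at x g -> (f x, g x) = z ->
  (\forall w \near z, P w) -> \forall w \near x, P (f w, g w).
Proof.
move=> /smooth_at_cont c1 /smooth_at_cont c2 <- nP; exact: (cvg_pair2 c1 c2 nP).
Qed.

Lemma near_neq0 x f : smooth_at x f -> f x != 0 -> \forall y \near x, f y != 0.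
Proof. by move=> /smooth_at_cont c fx; exact: (cvgr_neq0 _ c). Qed.

Lemma near_gt0 x f : smooth_at x f -> 0 < f x -> \forall y \near x, 0 < f y.
Proof. by move=> /smooth_at_cont c fx; exact: (cvgr_gt _ c). Qed.

Lemma smooth_near_div x f g : g x != 0 -> smooth_near x f -> smooth_near x g ->
  smooth_near x (fun y => f y / g y).
Proof.
move=> gx sf sg; have n := near_neq0 (smooth_near_at sg) gx.
by apply: filterS3 n sf sg => y; exact: smooth_at_div.
Qed.

End SmoothNear.

Section SmoothNearComp.
Context {R : realType} {V : normedModType R}.
Implicit Types (x : V).

Lemma smooth_near_comp1 x (g : R^o -> R^o) (h : V -> R^o) (y : R^o) : h x = y ->
  smooth_near y g -> smooth_near x h -> smooth_near x (fun z => g (h z)).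
Proof.
move=> hx sg sh; have n := near_comp1 (smooth_near_at sh) hx sg.
by apply: filterS2 n sh => z; exact: smooth_at_comp1.
Qed.

Lemma smooth_near_comp2 x (g : plane R -> R^o) (h1 h2 : V -> R^o) (y : plane R) :
  (h1 x, h2 x) = y -> smooth_near y g -> smooth_near x h1 -> smooth_near x h2 ->
  smooth_near x (fun z => g (h1 z, h2 z)).
Proof.
move=> hx sg sh1 sh2.
have n := near_comp2 (smooth_near_at sh1) (smooth_near_at sh2) hx sg.
by apply: filterS3 n sh1 sh2 => z; exact: smooth_at_comp2.
Qed.

End SmoothNearComp.

Section Local1.
Context {R : realType}.
Implicit Types (g : R^o -> R^o) (z : plane R).

Lemma smooth_near_id : smooth_near (0 : R^o) (fun x => x).
Proof. by apply: near_all => y; exact: smooth_at_id. Qed.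

Lemma smooth_near_fst z : smooth_near z (fun w => w.1).
Proof. by apply: near_all => y; exact: smooth_at_fst. Qed.

Lemma smooth_near_snd z : smooth_near z (fun w => w.2).
Proof. by apply: near_all => y; exact: smooth_at_snd. Qed.

Lemma smooth_near_derive1 (x : R^o) g : smooth_near x g ->
  smooth_near x (derive1 (g : R -> R)).
Proof. by apply: filterS => y; exact: smooth_at_derive1. Qed.

(** The case of the shear (x, y) |-> (x, g y), restricted to x = 0. *)
Lemma inverse1 g : smooth_near (0 : R^o) g -> g 0 = 0 -> derive1 (g : R -> R) 0 != 0 ->
  exists h : R^o -> R^o, [/\ h 0 = 0, smooth_near (0 : R^o) h,
    \forall x \near (0 : R^o), h (g x) = x & \forall y \near (0 : R^o), g (h y) = y].
Proof.
move=> sg g0 dg.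
have sF : smooth_near (0 : plane R) (fun z => g z.2).
  exact: (smooth_near_comp1 (y := 0) _ sg (smooth_near_snd _)).
have [||Y [Y0 sY FY YF]] := shear_inverse sF.
- exact: g0.
- have d1 := smooth_at_differentiable (smooth_at_snd (0 : plane R)).
  have d2 := smooth_at_differentiable (smooth_near_at sg).
  have -> : 'd (fun z : plane R => g z.2) 0 e2 = 'd (fun w : plane R => w.2 : R^o) 0 e2 * 'd g 0 1.
    exact: (diff_comp1v (h := fun w : plane R => w.2) e2 d1 d2).
  by rewrite diff_sndv mul1r diff_derive1 //; exact: smooth_near_at.
have s0 := smooth_at_cst (0 : R^o) 0; have s1 := smooth_near_at smooth_near_id.
exists (fun y => Y (0, y)); split.
- exact: Y0.
- apply: (smooth_near_comp2 (y := 0) _ sY) => //.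
    exact: smooth_near_cst.
  exact: smooth_near_id.
- have E : \forall x \near (0 : R^o), Y (0, g x) = x by exact: (near_comp2 s0 s1 _ YF).
  exact: E.
- have E : \forall y \near (0 : R^o), g (Y (0, y)) = y by exact: (near_comp2 s0 s1 _ FY).
  exact: E.
Qed.

Lemma smooth_at_sqrt (x : R^o) : 0 < x -> smooth_at x (@Num.sqrt R : R^o -> R^o).
Proof.
move=> x0; have np : \forall y \near x, 0 < y :> R.
  exact: near_gt0 (smooth_at_id x) x0.
elim=> [|n IHn].
  by apply: continuous_class_at0; exact: sqrt_continuous.
apply: (@class_at_derive _ n x _ (fun y => (2 * Num.sqrt y)^-1)).
  by apply: filterS np => y y0; exact: is_derive1_sqrt.
have sq0 : 2 * Num.sqrt x != 0 :> R^o by rewrite mulf_neq0 // gt_eqF // sqrtr_gt0.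
exact: (@class_at_comp1 R R^o n x (fun y => y^-1) (fun y => 2 * Num.sqrt y)
  (smooth_at_inv sq0 n) (class_atM (class_at_cst n x 2) IHn)).
Qed.

End Local1.

(** * The Morse lemma and the boundary equation *)

Section Morse.
Context {R : realType}.
Implicit Types (g : R^o -> R^o).

Lemma scaled_lt (t r d : R) : 0 <= t <= 1 -> `|r| < d -> `|t * r| < d.
Proof.
move=> /andP[t0 t1]; apply: le_lt_trans.
by rewrite normrM ger0_norm // ler_piMl.
Qed.

(** The values of h and of its derivative at 0 are read off from hop_euler, where
the second summand vanishes at r = 0. *)
Lemma hadamard_near g : smooth_near (0 : R^o) g -> g 0 = 0 ->
  exists h : R^o -> R^o, [/\ smooth_near (0 : R^o) h,
    \forall x \near (0 : R^o), g x = x * h x, h 0 = derive1 (g : R -> R) 0 &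
    derive1 (h : R -> R) 0 = derive1n 2 (g : R -> R) 0 / 2].
Proof.
move=> sg g0; have [d d0 dP] := iffLR (near0_normP _) sg.
have sr (r t : R) : `|r| < d -> 0 <= t <= 1 -> smooth_at (t * r : R^o) g.
  by move=> rd t01; apply: dP; exact: scaled_lt.
have sr' (r t : R) : `|r| < d -> 0 <= t <= 1 ->
    smooth_at (t * r : R^o) (derive1 (g : R -> R)).
  by move=> rd t01; apply: smooth_at_derive1; exact: sr.
have z0 : `|0 : R| < d by rewrite normr0.
have sr0 t : 0 <= t <= 1 -> smooth_at (t * 0 : R^o) (derive1 (g : R -> R)).
  exact: sr'.
have sr0' t : 0 <= t <= 1 -> smooth_at (t * 0 : R^o) (derive1 (derive1 (g : R -> R))).
  by move=> t01; apply: smooth_at_derive1; exact: sr0.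
exists (hop 0 (derive1 (g : R -> R))); split.
- apply/near0_normP; exists d => // r rd.
  by apply: smooth_at_hop => t; exact: sr'.
- apply/near0_normP; exists d => // r rd.
  rewrite hop_hadamard; first by rewrite g0 subr0.
  by move=> t; exact: sr.
- by have := hop_euler 0 sr0; rewrite mul0r addr0 mul1r.
- rewrite (is_derive_derive1 (hop_derive 0 sr0)).
  have := hop_euler 1 sr0'; rewrite mul0r addr0 => E.
  change (hop 1 (derive1 (derive1 (g : R -> R))) 0 = derive1 (derive1 (g : R -> R)) 0 / 2).
  by rewrite -E mulrC mulKf // pnatr_eq0.
Qed.

Lemma sign_choice (a : R) : a != 0 -> exists e : R, (e = 1 \/ e = -1) /\ 0 < e * a.
Proof.
move=> a0; have [h|h|h] := ltgtP a 0; last by rewrite h eqxx in a0.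
  by exists (-1); split; [right|rewrite mulN1r oppr_gt0].
by exists 1; split; [left|rewrite mul1r].
Qed.

Lemma inverse_derive1 g (h : R^o -> R^o) : smooth_near (0 : R^o) g -> smooth_near (0 : R^o) h ->
  h 0 = 0 -> (\forall y \near (0 : R^o), g (h y) = y) ->
  derive1 (g : R -> R) 0 * derive1 (h : R -> R) 0 = 1.
Proof.
move=> sg sh h0 gh.
have dh := smooth_at_is_derive (smooth_near_at sh).
have dg : is_derive (h 0 : R) 1 (g : R -> R) (derive1 (g : R -> R) 0).
  by rewrite h0; exact: smooth_at_is_derive (smooth_near_at sg).
have d := @is_derive1_comp R (g : R -> R) (h : R -> R) 0 _ _ dg dh.
have did : is_derive (0 : R) 1 ((g : R -> R) \o (h : R -> R)) 1.
  apply: (@near_eq_is_derive _ _ _ id _ _ _ _ _ (is_derive_id _ _)).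
  by apply: filterS gh => v /= ->.
by rewrite -(is_derive_derive1 d) (is_derive_derive1 did).
Qed.

(** Two Hadamard quotients give g = x ^ 2 h2 (x) with h2 (0) <> 0; the parameter
is X = tau x sqrt (eps h2 (x)), and xi is its inverse. The orientation tau is left
free because the sign of N' (0) in boundary_equation depends on it. *)
Lemma morse1 g : smooth_near (0 : R^o) g -> g 0 = 0 ->
  derive1 (g : R -> R) 0 = 0 -> derive1n 2 (g : R -> R) 0 != 0 ->
  exists eps : R, (eps = 1 \/ eps = -1) /\ forall tau : R, tau = 1 \/ tau = -1 ->
  exists xi X : R^o -> R^o, [/\ smooth_near (0 : R^o) xi, xi 0 = 0,
    0 < tau * derive1 (xi : R -> R) 0,
    \forall v \near (0 : R^o), g (xi v) = eps * v ^+ 2 &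
    [/\ smooth_near (0 : R^o) X, X 0 = 0 & \forall x \near (0 : R^o), xi (X x) = x]].
Proof.
move=> sg g0 g1 g2.
have [h1 [sh1 gh1 h10 dh10]] := hadamard_near sg g0.
have [|h2 [sh2 gh2 h20 _]] := hadamard_near sh1; first by rewrite h10.
have h2n0 : h2 0 != 0.
  by rewrite h20 dh10 mulf_neq0 // invr_neq0.
have [eps [epsE e0]] := sign_choice h2n0.
exists eps; split=> // tau tauE.
have tau2 : tau * tau = 1 by case: tauE => ->; lra.
have eps2 : eps * eps = 1 by case: epsE => ->; lra.
pose k x : R^o := eps * h2 x.
have sk : smooth_near (0 : R^o) k.
  by apply: smooth_nearM => //; exact: smooth_near_cst.
have kp : \forall x \near (0 : R^o), 0 < k x by exact: near_gt0 (smooth_near_at sk) e0.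
pose l x : R^o := tau * Num.sqrt (k x).
have sl : smooth_near (0 : R^o) l.
  apply: smooth_nearM; first exact: smooth_near_cst.
  apply: (smooth_near_comp1 (y := k 0)) => //.
  have : \forall y \near (k 0 : R^o), 0 < y :> R by exact: near_gt0 (smooth_at_id _) e0.
  by apply: filterS => y; exact: smooth_at_sqrt.
pose X x : R^o := x * l x.
have sX : smooth_near (0 : R^o) X by apply: smooth_nearM => //; exact: smooth_near_id.
have X0 : X 0 = 0 by rewrite /X mul0r.
have dX : is_derive (0 : R) 1 (X : R -> R) (l 0).
  have dl := smooth_at_is_derive (smooth_near_at sl).
  have d := @is_deriveM _ _ (id : R -> R) (l : R -> R) 0 1 _ _ (is_derive_id _ _) dl.
  apply: is_derive_eq d _.
  rewrite scale0r add0r; exact: mulr1.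
have dX1 := is_derive_derive1 dX.
have l0 : 0 < tau * l 0 by rewrite /l mulrA tau2 mul1r sqrtr_gt0.
have l0n : l 0 != 0 by apply: contraTneq l0 => ->; rewrite mulr0 ltxx.
have [|xi [xi0 sxi xiX Xxi]] := inverse1 sX X0; first by rewrite dX1.
exists xi, X; split=> //.
- have E : l 0 * derive1 (xi : R -> R) 0 = 1.
    by rewrite -dX1; exact: inverse_derive1 sX sxi xi0 Xxi.
  have -> : derive1 (xi : R -> R) 0 = (l 0)^-1 by apply: (mulfI l0n); rewrite E divff.
  have -> : tau * (l 0)^-1 = (tau * l 0) * ((l 0)^-1) ^+ 2 by field.
  by rewrite mulr_gt0 // exprn_even_gt0 //= invr_neq0.
- have gk : \forall x \near (0 : R^o), g x = eps * X x ^+ 2.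
    apply: filterS3 gh1 gh2 kp => x -> -> kx.
    rewrite /X /l !exprMn sqr_sqrtr ?ltW // [tau ^+ 2]expr2 tau2 /k.
    have -> : eps * (x ^+ 2 * (1 * (eps * h2 x))) = (eps * eps) * (x * (x * h2 x)) by ring.
    by rewrite eps2 mul1r.
  have n := near_comp1 (smooth_near_at sxi) xi0 gk.
  by apply: filterS2 n Xxi => v -> ->.
Qed.

End Morse.

Section BoundaryEquation.
Context {R : realType}.
Implicit Types (N : R^o -> R^o).

Lemma hop_even k (g : R -> R) (r : R) :
  (forall t : R, 0 <= t <= 1 -> g (t * - r) = g (t * r)) -> hop k g (- r) = hop k g r.
Proof. by move=> eg; apply: eq_int01 => t t01; rewrite /= eg. Qed.

(** Let c (eps v ^ 2) be the even part of N, and v n0 (v) its odd part. For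
beta (s) = s b (eps s) ^ 2 the equation follows from
n0 = b (v ^ 2) beta' (eps v ^ 2). In terms of m = b ^ 3 this is the linear equation
n0 = m (v ^ 2) + (2 / 3) v ^ 2 m' (v ^ 2), that is 3 P + v P' = 3 n0 for
P (v) = m (v ^ 2). By hop_euler and hop_derive its solution is 3 times the average
of n0 with weight t ^ 2, which is even since n0 is. As P (0) = N' (0) > 0, the cube
root b of m exists and is smooth near 0. The functions of v ^ 2 come from
Whitney's theorem. *)
Lemma boundary_equation N (eps : R) : eps = 1 \/ eps = -1 ->
  smooth_near (0 : R^o) N -> N 0 = 0 -> 0 < derive1 (N : R -> R) 0 ->
  exists c beta : R^o -> R^o, [/\ smooth_near (0 : R^o) c, c 0 = 0,
    smooth_near (0 : R^o) beta, beta 0 = 0 &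
    0 < derive1 (beta : R -> R) 0 /\
    \forall v \near (0 : R^o), beta (eps * v ^+ 2) =
      eps * ((N v - c (eps * v ^+ 2)) / derive1 (beta : R -> R) (eps * v ^+ 2)) ^+ 2].
Proof.
move=> epsE sN N0 N1.
have eps2 : eps * eps = 1 by case: epsE => ->; lra.
have sopp : smooth_near (0 : R^o) (fun v : R^o => - v).
  by apply: near_all => v; apply: smooth_atN; exact: smooth_at_id.
have sN' : smooth_near (0 : R^o) (fun v => N (- v)).
  exact: (smooth_near_comp1 (oppr0 _) sN sopp).
pose Ne v : R := (N v + N (- v)) / 2.
pose No v : R := (N v - N (- v)) / 2.
have sNe : smooth_near (0 : R^o) (Ne : R^o -> R^o).
  by apply: smooth_nearM; [exact: smooth_nearD|exact: smooth_near_cst].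
have sNo : smooth_near (0 : R^o) (No : R^o -> R^o).
  by apply: smooth_nearM; [exact: smooth_nearB|exact: smooth_near_cst].
have No0 : No 0 = 0 by rewrite /No oppr0 subrr mul0r.
have dNo : derive1 No 0 = derive1 (N : R -> R) 0.
  have dN : is_derive (0 : R) 1 (N : R -> R) (derive1 (N : R -> R) 0).
    exact: smooth_at_is_derive (smooth_near_at sN).
  have dN' : is_derive (- 0 : R) 1 (N : R -> R) (derive1 (N : R -> R) 0) by rewrite oppr0.
  have dopp : is_derive (0 : R) 1 (fun v : R => - v) (-1).
    exact: (is_deriveN (is_derive_id (0 : R) 1)).
  have d1 := @is_derive1_comp R (N : R -> R) (fun v => - v) 0 _ _ dN' dopp.
  have d2 := is_deriveB dN d1.
  have d3 := @is_deriveZ R R^o R^o _ 2^-1 0 1 _ d2.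
  apply: is_derive_derive1.
  rewrite [X in is_derive _ _ X _](_ : _ = 2^-1 \*: ((N : R -> R) \- ((N : R -> R) \o (fun v => - v)))); last first.
    by apply/funext => v; rewrite /No mulrC.
  apply: is_derive_eq d3 _.
  by rewrite mulrN1 opprK /GRing.scale /=; field.
have [d d0 dP] := iffLR (near0_normP _) (filterI sNe sNo).
have [n0 n0def] : exists n0 : R^o -> R^o, n0 = hop 0 (derive1 No) by eexists.
have sno (r t : R) : `|r| < d -> 0 <= t <= 1 -> smooth_at (t * r : R^o) (No : R^o -> R^o).
  by move=> rd t01; have [] := dP _ (scaled_lt t01 rd).
have sn0 (r : R) : `|r| < d -> smooth_at (r : R^o) (n0 : R^o -> R^o).
  move=> rd; rewrite n0def; apply: smooth_at_hop => t t01.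
  by apply: smooth_at_derive1; exact: sno.
have NoE (r : R) : `|r| < d -> r * n0 r = No r.
  move=> rd; rewrite n0def hop_hadamard ?No0 ?subr0 // => t; exact: sno.
have Noo v : No (- v) = - No v by rewrite /No opprK; field.
have n0e (r : R) : `|r| < d -> n0 (- r) = n0 r.
  move=> rd; have [->|r0] := eqVneq r 0; first by rewrite oppr0.
  have rd' : `|- r| < d by rewrite normrN.
  apply: (mulfI r0); rewrite (NoE r rd) -[RHS]opprK -Noo -(NoE (- r) rd').
  by rewrite mulNr opprK.
pose P r : R := 3 * hop 2 n0 r.
have shop (r t : R) : `|r| < d -> 0 <= t <= 1 -> smooth_at (t * r : R^o) (n0 : R^o -> R^o).
  by move=> rd t01; apply: sn0; exact: scaled_lt.
have sP (r : R) : `|r| < d -> smooth_at (r : R^o) (P : R^o -> R^o).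
  move=> rd; apply: smooth_atM; first exact: smooth_at_cst.
  by apply: smooth_at_hop => t; exact: shop.
have eP (r : R) : `|r| < d -> P (- r) = P r.
  move=> rd; rewrite /P (@hop_even 2 n0 r) // => t t01.
  by rewrite mulrN; apply: n0e; exact: scaled_lt.
have PE (r : R) : `|r| < d -> n0 r = P r + r * hop 3 (derive1 n0) r.
  by move=> rd; rewrite /P -(hop_euler 2 (fun t => @shop r t rd)).
have dPE (r : R) : `|r| < d -> is_derive r 1 P (3 * hop 3 (derive1 n0) r).
  move=> rd; have := hop_derive 2 (fun t => @shop r t rd) => h.
  exact: (@is_deriveZ _ _ _ (hop 2 n0) 3 r 1 _ h).
have [C sC CE] : exists2 h, smooth1 h & \forall r \near (0 : R^o), Ne r = h (r ^+ 2).
  apply: (whitney_even_near d0).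
    by move=> r rd; have [] := dP r rd.
  by move=> r _; rewrite /Ne opprK addrC.
have [m sm mE] := whitney_even_near d0 sP eP.
have z0 : `|0 : R| < d by rewrite normr0.
have n00 : n0 0 = derive1 (N : R -> R) 0.
  rewrite -dNo n0def; have := @hop_euler R 0 (derive1 No) 0.
  rewrite mul0r addr0 mul1r; apply.
  by move=> t t01; apply: smooth_at_derive1; exact: sno.
have m0 : 0 < m 0.
  have := nbhs_singleton mE; rewrite expr0n /= => <-.
  by have := PE 0 z0; rewrite mul0r addr0 => <-; rewrite n00.
have nd : \forall v \near (0 : R^o), `|v : R| < d.
  by apply/near0_normP; exists d.
pose b w : R^o := expR (ln (m w) / 3).
have mp : \forall w \near (0 : R^o), 0 < m w by exact: near_gt0 (sm 0) m0.
have sb : smooth_near (0 : R^o) b.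
  apply: filterS mp => w mw.
  apply: (smooth_at_comp1 (smooth_at_expR _)); apply: smooth_atM; last exact: smooth_at_cst.
  exact: (smooth_at_comp1 (smooth_at_ln mw) (sm w)).
have b3 w : 0 < m w -> b w ^+ 3 = m w.
  move=> mw; rewrite /b -expRM_natl mulrCA divff ?pnatr_eq0 // mulr1 lnK ?posrE //.
have bp w : 0 < b w by exact: expR_gt0.
have db w : 0 < m w -> 3 * b w ^+ 2 * derive1 (b : R -> R) w = derive1 m w.
  move=> mw.
  have dm := smooth1_is_derive w sm.
  have dl := @is_derive1_comp R (@ln R) m w _ _ (is_derive1_ln mw) dm.
  have dl3 := @is_deriveZ R R^o R^o _ 3^-1 w 1 _ dl.
  have de := @is_derive1_comp R expR (3^-1 \*: (@ln R \o m)) w _ _ (is_derive_expR _) dl3.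
  have -> : derive1 (b : R -> R) w = b w * (3^-1 * ((m w)^-1 * derive1 m w)).
    apply: is_derive_derive1.
    rewrite (_ : b = expR \o (3^-1 \*: (@ln R \o m))); last first.
      by apply/funext => y; rewrite /b /= mulrC.
    exact: de.
  have -> : 3 * b w ^+ 2 * (b w * (3^-1 * ((m w)^-1 * derive1 m w))) =
    b w ^+ 3 * ((m w)^-1 * derive1 m w).
    by move: ((m w)^-1 * _) => y; field.
  by rewrite b3 // mulrA divff ?mul1r // gt_eqF.
have seps : smooth_near (0 : R^o) (fun s : R^o => eps * s).
  by apply: smooth_nearM; [exact: smooth_near_cst|exact: smooth_near_id].
pose c s : R^o := C (eps * s).
pose beta s : R^o := s * b (eps * s) ^+ 2.
have sbeps : smooth_near (0 : R^o) (fun s => b (eps * s)).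
  exact: (smooth_near_comp1 (mulr0 _) sb seps).
have sbeta : smooth_near (0 : R^o) beta.
  apply: smooth_nearM; first exact: smooth_near_id.
  exact: smooth_nearX.
have dbeta : \forall s \near (0 : R^o), derive1 (beta : R -> R) s =
    b (eps * s) ^+ 2 + s * (2 * b (eps * s) * (eps * derive1 (b : R -> R) (eps * s))).
  have n := near_comp1 (smooth_near_at seps) (mulr0 _) sb.
  apply: filterS n => s sbs.
  have dbs := smooth_at_is_derive sbs.
  have de : is_derive (s : R) 1 (fun s : R => eps * s) eps.
    have := @is_deriveZ _ _ _ (id : R -> R) eps s 1 _ (is_derive_id _ _).
    by move=> h; apply: is_derive_eq h _; exact: mulr1.
  have d1 := @is_derive1_comp R (b : R -> R) (fun s => eps * s) s _ _ dbs de.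
  have dsq (y : R) : is_derive y 1 (fun y : R => y ^+ 2) (2 * y).
    by split; [exact: exprn_derivable|rewrite exp_derive expr1; exact: mulr1].
  have d2 := @is_derive1_comp R (fun y => y ^+ 2) ((b : R -> R) \o (fun s => eps * s)) s _ _ (dsq _) d1.
  have d3 := @is_deriveM _ _ (id : R -> R) _ (s : R) 1 _ _ (is_derive_id _ _) d2.
  have d4 : is_derive (s : R) 1 (beta : R -> R) _ := d3.
  rewrite (is_derive_derive1 d4) /= /GRing.scale /= mulr1; ring.
exists c, beta; split.
- apply: near_all => s; apply: (smooth_at_comp1 (sC _)).
  by apply: smooth_atM; [exact: smooth_at_cst|exact: smooth_at_id].
- rewrite /c mulr0; have := nbhs_singleton CE; rewrite expr0n /= => <-.
  by rewrite /Ne oppr0 N0 addr0 mul0r.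
- exact: sbeta.
- by rewrite /beta mul0r.
- have sv2 : smooth_near (0 : R^o) (fun v : R^o => v ^+ 2).
    by apply: smooth_nearX; exact: smooth_near_id.
  have sev2 : smooth_near (0 : R^o) (fun v : R^o => eps * v ^+ 2).
    by apply: smooth_nearM; [exact: smooth_near_cst|].
  have ev20 : eps * (0 : R^o) ^+ 2 = 0 by rewrite expr0n mulr0.
  have v20 : (0 : R^o) ^+ 2 = 0 by rewrite expr0n.
  have db0 : 0 < derive1 (beta : R -> R) 0.
    by rewrite (nbhs_singleton dbeta) mul0r addr0 mulr0 exprn_gt0.
  split=> //.
  have nz := near_neq0 (smooth_near_at (smooth_near_derive1 sbeta)) (lt0r_neq0 db0).
  have dbnn := near_comp1 (smooth_near_at sev2) ev20 nz.
  have dbn := near_comp1 (smooth_near_at sev2) ev20 dbeta.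
  have mpn := near_comp1 (smooth_near_at sv2) v20 mp.
  have mEn := near_join mE.
  apply: filterS3 (filterI dbn mpn) (filterI nd CE) (filterI mEn dbnn) => v [dbv mv] [vd CEv] [mEv dbnv].
  have w2 : eps * (eps * v ^+ 2) = v ^+ 2 by rewrite mulrA eps2 mul1r.
  have mEv1 := nbhs_singleton mEv.
  have dP' : 3 * hop 3 (derive1 n0) v = v * (2 * derive1 m ((v * 1) ^+ 2)).
    have d1 := dPE v vd.
    have E : \forall r \near (v : R), P r = m (r ^+ 2) by exact: mEv.
    have d2 := near_eq_is_derive E d1.
    by rewrite -(is_derive_derive1 d2) derive1_comp_sqr.
  have n0E : n0 v = b (v ^+ 2) ^+ 3 + 2 * v ^+ 2 * b (v ^+ 2) ^+ 2 * derive1 (b : R -> R) (v ^+ 2).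
    rewrite (PE v vd) mEv1 b3 //; congr (_ + _).
    have -> : hop 3 (derive1 n0) v = 3^-1 * (3 * hop 3 (derive1 n0) v) by field.
    rewrite dP' mulr1 -db //; by field.
  have dbE : derive1 (beta : R -> R) (eps * v ^+ 2) =
     b (v ^+ 2) ^+ 2 + 2 * v ^+ 2 * b (v ^+ 2) * derive1 (b : R -> R) (v ^+ 2).
    rewrite dbv w2.
    have -> : eps * v ^+ 2 * (2 * b (v ^+ 2) * (eps * derive1 (b : R -> R) (v ^+ 2))) =
      (eps * eps) * v ^+ 2 * (2 * b (v ^+ 2) * derive1 (b : R -> R) (v ^+ 2)) by ring.
    by rewrite eps2; ring.
  have n0b : n0 v = b (v ^+ 2) * derive1 (beta : R -> R) (eps * v ^+ 2).
    by rewrite dbE n0E; ring.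
  have dbn0 : derive1 (beta : R -> R) (eps * v ^+ 2) != 0.
    exact: dbnv.
  have NvE : N v - c (eps * v ^+ 2) = v * n0 v.
    by rewrite /c w2 -CEv NoE // /Ne /No; field.
  by rewrite NvE n0b [v * (_ * _)]mulrA mulfK // /beta w2 exprMn; ring.
Qed.

End BoundaryEquation.

(** * Rules of differentiation and primitives *)

Section DiffRules.
Context {R : realType} {V : normedModType R}.
Implicit Types (f g : V -> R^o) (x v : V).

Lemma diff_cstv x v (a : R) : 'd (fun=> a : R^o) x v = 0.
Proof. by have /(congr1 (fun L => L v)) := diff_cst (V := V) (W := R^o) a x. Qed.

Lemma diffBv f g x v : smooth_at x f -> smooth_at x g ->
  'd (fun y => f y - g y) x v = 'd f x v - 'd g x v.
Proof.
move=> /smooth_at_differentiable df /smooth_at_differentiable dg.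
by have /(congr1 (fun L => L v)) := diffB df dg.
Qed.

Lemma diffZv (a : R) f x v : smooth_at x f ->
  'd (fun y => a * f y) x v = a * 'd f x v.
Proof.
move=> sf; have df := smooth_at_differentiable sf.
have dc := smooth_at_differentiable (smooth_at_cst x a).
have aux (b c e : R) : e = 0 -> a * b + c * e = a * b by move=> ->; ring.
exact: (etrans (diffMv v dc df) (aux _ _ _ (diff_cstv x v a))).
Qed.

Lemma diff_sqrv f x v : smooth_at x f ->
  'd (fun y => f y ^+ 2) x v = 2 * f x * 'd f x v.
Proof.
move=> sf; have df := smooth_at_differentiable sf.
have -> : (fun y => f y ^+ 2) = (fun y => f y * f y) by apply/funext => y; rewrite expr2.
apply: (etrans (diffMv v df df)).
have aux (k l : R) : k * l + k * l = 2 * k * l by ring.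
exact: aux.
Qed.

Lemma diff_comp1_derive (g : R^o -> R^o) (h : V -> R^o) x v :
  smooth_at (h x) g -> smooth_at x h ->
  'd (fun y => g (h y)) x v = derive1 (g : R -> R) (h x) * 'd h x v.
Proof.
move=> sg sh.
apply: (etrans (diff_comp1v v (smooth_at_differentiable sh) (smooth_at_differentiable sg))).
by rewrite (diff_derive1 sg); exact: mulrC.
Qed.

End DiffRules.

Section NormalForm.
Context {R : realType}.
Implicit Types (z w : plane R).

(** K = x h, where h is the average of u over [0, x]; Lop_euler with k = 0 says
that h + x h_x = u. *)
Lemma primitive_near (u : plane R -> R^o) : smooth_near 0 u ->
  exists K : plane R -> R^o, [/\ smooth_near 0 K, K 0 = 0 &
    \forall z \near (0 : plane R), 'd K z e1 = u z].
Proof.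
move=> su; have [d d0 dP] := iffLR (near0_normP _) su.
have sr z : `|z| < d -> forall t : R, 0 <= t <= 1 -> smooth_at (ray t z) u.
  by move=> zd t t01; apply: dP; exact: norm_ray.
exists (fun z => z.1 * Lop 0 u z); split.
- apply/near0_normP; exists d => // z zd; apply: smooth_atM; first exact: smooth_at_fst.
  by apply: smooth_at_Lop; exact: sr.
- exact: mul0r.
- apply/near0_normP; exists d => // z zd.
  have sz := sr z zd.
  have sL := smooth_at_Lop 0 sz.
  apply: (etrans (diffMv e1 (smooth_at_differentiable (smooth_at_fst z)) (smooth_at_differentiable sL))).
  have [_ E] := Lop_diff 0 (fun t t01 => smooth_at_diff (sz t t01))
    (fun v t t01 => smooth_at_cont (smooth_at_d v (sz t t01))).
  have aux (x dl l df b c y : R) : dl = 1 * b + 0 * c -> df = 1 ->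
    1 * l + x * b = y -> x * dl + l * df = y by move=> -> -> <-; ring.
  exact: (aux _ _ _ _ _ _ _ (E e1) (diff_fstv z e1) (Lop_euler 0 sz)).
Qed.

(** Along vertical lines q increases, and it vanishes on the axis. *)
Lemma sign_half_plane (q : plane R -> R^o) : smooth_near 0 q ->
  (\forall x \near (0 : R^o), q (x, 0) = 0) -> 0 < 'd q 0 e2 ->
  \forall z \near (0 : plane R), (0 <= q z) = (0 <= z.2) /\ (q z == 0) = (z.2 == 0).
Proof.
move=> sq q0 dq.
have nd : \forall z \near (0 : plane R), 0 < 'd q z e2.
  exact: near_gt0 (smooth_near_at (smooth_near_diff e2 sq)) dq.
have q0n : \forall z \near (0 : plane R), q (z.1, 0) = 0.
  exact: (near_comp1 (smooth_at_fst 0) _ q0).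
have [d d0 dP] := iffLR (near0_normP _) (filterI q0n (filterI sq nd)).
apply/near0_normP; exists d => // -[x y] zd.
have [/= qx _] := dP _ zd.
have H t : `|t| <= `|y| -> differentiable q (x, t) /\ 0 < 'd q (x, t) e2.
  move=> ty; have nt : `|(x, t) : plane R| < d.
    move: zd; rewrite !norm_planeP /= => /andP[-> yd] /=.
    exact: le_lt_trans ty yd.
  by have [_ [s ?]] := dP _ nt; split => //; exact: smooth_at_differentiable.
rewrite /=; have [y0|y0|->] := ltgtP y 0; last by rewrite qx lexx eqxx.
- have : q (x, y) < q (x, 0).
    apply: (increasing_fiber y0) => t /andP[yt t0]; apply: H.
    by rewrite !ler0_norm ?(ltW y0) // lerN2.
  by rewrite qx => h; rewrite leNgt h lt_eqF.
- have : q (x, 0) < q (x, y).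
    apply: (increasing_fiber y0) => t /andP[t0 ty]; apply: H.
    by rewrite !ger0_norm ?(ltW y0).
  by rewrite qx => h; rewrite (ltW h) gt_eqF.
Qed.

Lemma derive1_slice (u : plane R -> R^o) (x : R) : smooth_at (x, 0) u ->
  derive1 (fun x => u (x, 0) : R) x = 'd u (x, 0) e1.
Proof.
move=> su.
have s0 : smooth_at (x : R^o) (fun=> 0 : R^o) by exact: smooth_at_cst.
have s1 : smooth_at (x : R^o) (fun x => x) by exact: smooth_at_id.
have sg : smooth_at (x : R^o) (fun x => u (x, 0)) by exact: smooth_at_comp2.
have aux (df ds a b : R) : df = 1 -> ds = 0 -> df * a + ds * b = a.
  by move=> -> ->; ring.
have E1 : 'd (fun x : R^o => x) (x : R^o) 1 = 1.
  by have /diff_is_derive [_ E] := @is_derive_id R R^o x 1; exact: E.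
rewrite -(diff_derive1 sg).
exact: (etrans (@diff_comp2v R R^o u (fun x => x) (fun=> 0) x 1
  (smooth_at_differentiable s1) (smooth_at_differentiable s0)
  (smooth_at_differentiable su)) (aux _ _ _ _ E1 (diff_cstv _ _ _))).
Qed.

End NormalForm.

(** * The normal form in the plane *)

Section NormalForm.
Context {R : realType}.
Implicit Types (z w : plane R).

(** The function s replaces y as second coordinate, with Y the inverse change;
u dx /\ ds is the form rho dx /\ dy in the new coordinates. *)
Lemma straighten (s rho : plane R -> R^o) : smooth_near 0 s -> s 0 = 0 ->
  'd s 0 e2 != 0 -> smooth_near 0 rho -> rho 0 != 0 ->
  exists Y u : plane R -> R^o,
    [/\ Y 0 = 0, smooth_near 0 Y,
        \forall w \near (0 : plane R), s (w.1, Y w) = w.2,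
        \forall z \near (0 : plane R), Y (z.1, s z) = z.2 &
    [/\ smooth_near 0 u, u 0 != 0 &
        \forall z \near (0 : plane R), u (z.1, s z) * 'd s z e2 = rho z]].
Proof.
move=> ss s0 ds srho rho0.
have [Y [Y0 sY sYE YsE]] := shear_inverse ss s0 ds.
have zY : ((0 : plane R).1, Y 0) = 0 by rewrite Y0.
have zs : ((0 : plane R).1, s 0) = 0 by rewrite s0.
have sfst : smooth_near (0 : plane R) (fun z : plane R => z.1) by exact: smooth_near_fst.
have sds : smooth_near 0 (fun z => 'd s z e2) by exact: smooth_near_diff.
have sdsY : smooth_near 0 (fun w => 'd s (w.1, Y w) e2).
  exact: (smooth_near_comp2 zY sds sfst sY).
have srhoY : smooth_near 0 (fun w => rho (w.1, Y w)).
  exact: (smooth_near_comp2 zY srho sfst sY).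
have d0 : 'd s ((0 : plane R).1, Y 0) e2 != 0 by rewrite zY.
exists Y, (fun w => rho (w.1, Y w) / 'd s (w.1, Y w) e2); split=> //; split.
- exact: (@smooth_near_div R (plane R) 0 (fun w => rho (w.1, Y w))
    (fun w => 'd s (w.1, Y w) e2) d0 srhoY sdsY).
- have aux (a b : R) : a != 0 -> b != 0 -> a / b != 0.
    by move=> a0 b0; rewrite mulf_neq0 // invr_neq0.
  rewrite zY; exact: (aux _ _ rho0 ds).
- have nz := near_neq0 (smooth_near_at sds) ds.
  apply: filterS2 YsE nz => z Yz dz /=.
  have -> : ((z.1, s z).1, Y (z.1, s z)) = z by rewrite Yz; case: (z).
  by rewrite divfK.
Qed.

Lemma diff_snd_e1 (g : R^o -> R^o) z : smooth_at (z.2 : R^o) g ->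
  'd (fun z : plane R => g z.2) z e1 = 0.
Proof.
move=> sg; have aux (a b : R) : b = 0 -> a * b = 0 by move=> ->; rewrite mulr0.
exact: (etrans (@diff_comp1_derive R (plane R) g (fun z => z.2) z e1 sg (smooth_at_snd z))
  (aux _ _ (diff_sndv z e1))).
Qed.

(** The choice P = (K - c (s)) / beta' (s), with K a primitive of u in x, gives
the equation for P_x whatever the functions c and beta are. In the Morse
parameter v of g, the equation on the boundary is that of boundary_equation for
N (v) = K (xi (v), eps v ^ 2). Its derivative at 0 is xi' (0) u (0), and it is made
positive by giving xi' (0) the sign of u (0). *)
Lemma solve_boundary (u : plane R -> R^o) (g : R^o -> R^o) :
  smooth_near 0 u -> u 0 != 0 -> smooth_near (0 : R^o) g -> g 0 = 0 ->
  derive1 (g : R -> R) 0 = 0 -> derive1n 2 (g : R -> R) 0 != 0 ->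
  exists (eps : R) (P : plane R -> R^o) (beta : R^o -> R^o),
    [/\ eps = 1 \/ eps = -1, smooth_near 0 P /\ P 0 = 0,
        [/\ smooth_near (0 : R^o) beta, beta 0 = 0 & 0 < derive1 (beta : R -> R) 0],
        \forall z \near (0 : plane R), 'd P z e1 * derive1 (beta : R -> R) z.2 = u z &
        \forall x \near (0 : R^o), beta (g x) = eps * P (x, g x) ^+ 2].
Proof.
move=> su u0 sg g0 g1 g2.
have [eps [epsE morse]] := morse1 sg g0 g1 g2.
have [tau [tauE tauu]] := sign_choice u0.
have [xi [X [sxi xi0 tauxi gxi [sX X0 xiX]]]] := morse tau tauE.
have [K [sK K0 dK]] := primitive_near su.
have tau2 : tau * tau = 1 by case: tauE => ->; lra.
have ssq : smooth_near (0 : R^o) (fun v : R^o => eps * v ^+ 2).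
  apply: smooth_nearM; first exact: smooth_near_cst.
  by apply: smooth_nearX; exact: smooth_near_id.
have sq0 : eps * (0 : R^o) ^+ 2 = 0 by rewrite expr0n mulr0.
have xz : (xi 0, eps * (0 : R^o) ^+ 2) = (0 : plane R) by rewrite xi0 sq0.
have sN : smooth_near (0 : R^o) (fun v => K (xi v, eps * v ^+ 2)).
  exact: (@smooth_near_comp2 R R^o 0 K xi (fun v => eps * v ^+ 2) 0 xz sK sxi ssq).
have N0 : K (xi 0, eps * (0 : R^o) ^+ 2) = 0 by rewrite xz.
have dN : derive1 (fun v : R => K (xi v, eps * v ^+ 2)) 0 = derive1 (xi : R -> R) 0 * u 0.
  rewrite -(diff_derive1 (smooth_near_at sN)).
  have d2 : 'd (fun v : R^o => eps * v ^+ 2) (0 : R^o) 1 = 0.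
    have si : smooth_at (0 : R^o) (fun x : R^o => x) by exact: smooth_at_id.
    have aux (a b y : R) : b = 2 * 0 * y -> a * b = 0 by move=> ->; ring.
    exact: (etrans (@diffZv R R^o eps (fun x => x ^+ 2) 0 1 (smooth_atX 2 si))
      (aux _ _ _ (@diff_sqrv R R^o (fun x => x) 0 1 si))).
  have dK0 : differentiable K (xi 0, eps * (0 : R^o) ^+ 2).
    by rewrite xz; exact: smooth_at_differentiable (smooth_near_at sK).
  have aux (a b c d e f : R) : b = 0 -> c = e -> a = f -> a * c + b * d = f * e.
    by move=> -> -> ->; ring.
  have dK00 : 'd K (xi 0, eps * (0 : R^o) ^+ 2) e1 = u 0.
    by rewrite xz; exact: (nbhs_singleton dK).
  exact: (etrans (@diff_comp2v R R^o K xi (fun v => eps * v ^+ 2) 0 1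
    (smooth_at_differentiable (smooth_near_at sxi))
    (smooth_at_differentiable (smooth_near_at ssq)) dK0)
    (aux _ _ _ _ _ _ d2 dK00 (diff_derive1 (smooth_near_at sxi)))).
have dNp : 0 < derive1 (fun v : R => K (xi v, eps * v ^+ 2)) 0.
  rewrite dN; have -> : derive1 (xi : R -> R) 0 * u 0 =
    (tau * derive1 (xi : R -> R) 0) * (tau * u 0).
    by rewrite mulrACA tau2 mul1r.
  exact: mulr_gt0.
have [c [beta [sc c0 sbeta beta0 [dbeta bE]]]] := boundary_equation epsE sN N0 dNp.
have ssnd : smooth_near (0 : plane R) (fun z : plane R => z.2) by exact: smooth_near_snd.
have sc2 : smooth_near (0 : plane R) (fun z : plane R => c z.2).
  exact: (smooth_near_comp1 (erefl : (0 : plane R).2 = 0) sc ssnd).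
have sb2 : smooth_near (0 : plane R) (fun z : plane R => derive1 (beta : R -> R) z.2).
  exact: (smooth_near_comp1 (erefl : (0 : plane R).2 = 0) (smooth_near_derive1 sbeta) ssnd).
have b20 : derive1 (beta : R -> R) (0 : plane R).2 != 0 by exact: lt0r_neq0.
have sKc : smooth_near 0 (fun z => K z - c z.2) by exact: smooth_nearB.
exists eps, (fun z => (K z - c z.2) / derive1 (beta : R -> R) z.2), beta; split=> //.
- split; first exact: (@smooth_near_div R (plane R) 0 (fun z => K z - c z.2)
    (fun z => derive1 (beta : R -> R) z.2) b20 sKc sb2).
  by rewrite K0 c0 subrr mul0r.
- have nz := near_neq0 (smooth_near_at sb2) b20.
  have s2a : \forall z \near (0 : plane R), smooth_at (z.2 : R^o) c.
    exact: (near_comp1 (smooth_near_at ssnd) (erefl : (0 : plane R).2 = 0) sc).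
  have s2b : \forall z \near (0 : plane R), smooth_at (z.2 : R^o) (derive1 (beta : R -> R)).
    exact: (near_comp1 (smooth_near_at ssnd) (erefl : (0 : plane R).2 = 0)
      (smooth_near_derive1 sbeta)).
  have H := near_and (near_and nz dK) (near_and (near_and sKc sK) (near_and sb2 (near_and s2a s2b))).
  apply: (near_imp H) => z [[bz dKz] [[sKcz sKz] [sbz [scz sdbz]]]].
  have sV := @smooth_atV R (plane R) z (fun z => derive1 (beta : R -> R) z.2) bz sbz.
  have dKc : 'd (fun z => K z - c z.2) z e1 = u z.
    have scz2 : smooth_at z (fun z => c z.2).
      exact: (@smooth_at_comp1 R (plane R) z c (fun z => z.2) scz (smooth_at_snd z)).
    have aux (a b k : R) : a = k -> b = 0 -> a - b = k by move=> -> ->; rewrite subr0.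
    exact: (etrans (diffBv e1 sKz scz2) (aux _ _ _ dKz (diff_snd_e1 scz))).
  have dV : 'd (fun z => (derive1 (beta : R -> R) z.2)^-1) z e1 = 0.
    exact: (@diff_snd_e1 (fun y => (derive1 (beta : R -> R) y)^-1) z (smooth_atV bz sdbz)).
  have aux (a b dv dk k : R) : b != 0 -> dv = 0 -> dk = k -> (a * dv + b^-1 * dk) * b = k.
    by move=> bn0 -> ->; rewrite mulr0 add0r mulrAC mulVf // mul1r.
  exact: (etrans (congr1 (fun y : R => y * _) (diffMv e1 (smooth_at_differentiable sKcz)
    (smooth_at_differentiable sV))) (aux _ _ _ _ _ bz dV dKc)).
- have n1 := near_comp1 (smooth_near_at sX) X0 bE.
  have n2 := near_comp1 (smooth_near_at sX) X0 gxi.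
  apply: filterS3 n1 n2 xiX => x bx gx xix.
  by move: bx; rewrite -gx xix.
Qed.

End NormalForm.

Section Assembly.
Context {R : realType}.
Implicit Types (z w : plane R).

(** The coordinate change (p, q) comes with its inverse (a, b), since a chart has
to be given with its inverse. The last clause says that (p, q) preserves the
half-plane and its edge. *)
Definition normal_form (f rho : plane R -> R^o) (eps : R) : Prop :=
  exists (p q a b : plane R -> R^o) (alpha : R^o -> R^o),
    [/\ [/\ smooth_near 0 p, smooth_near 0 q, p 0 = 0 & q 0 = 0],
        [/\ smooth_near 0 a, smooth_near 0 b, a 0 = 0 & b 0 = 0],
        (\forall z \near (0 : plane R), a (p z, q z) = z.1 /\ b (p z, q z) = z.2) /\
        (\forall w \near (0 : plane R), p (a w, b w) = w.1 /\ q (a w, b w) = w.2),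
        [/\ smooth_near (0 : R^o) alpha, derive1 (alpha : R -> R) 0 != 0 &
            \forall z \near (0 : plane R), f z = alpha (q z + eps * p z ^+ 2)] &
        (\forall z \near (0 : plane R),
           'd p z e1 * 'd q z e2 - 'd p z e2 * 'd q z e1 = rho z) /\
        (\forall z \near (0 : plane R), (0 <= q z) = (0 <= z.2) /\ (q z == 0) = (z.2 == 0))].

(** For p = P (x, s) and q = beta (s) - eps p ^ 2 the function q + eps p ^ 2 is
beta (s), so that dp /\ dq = P_x beta' (s) dx /\ ds, and alpha is the inverse of
beta. The inverse of (p, q) first finds s = alpha (q + eps p ^ 2), then x from p
and s as P_x <> 0, then y from x and s. *)
Lemma assemble (s Y u P : plane R -> R^o) (beta : R^o -> R^o) (eps : R) (rho : plane R -> R^o) :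
  smooth_near 0 s -> s 0 = 0 -> 0 < 'd s 0 e2 ->
  Y 0 = 0 -> smooth_near 0 Y ->
  (\forall w \near (0 : plane R), s (w.1, Y w) = w.2) ->
  (\forall z \near (0 : plane R), Y (z.1, s z) = z.2) ->
  u 0 != 0 -> (\forall z \near (0 : plane R), u (z.1, s z) * 'd s z e2 = rho z) ->
  eps = 1 \/ eps = -1 -> smooth_near 0 P -> P 0 = 0 ->
  smooth_near (0 : R^o) beta -> beta 0 = 0 -> 0 < derive1 (beta : R -> R) 0 ->
  (\forall z \near (0 : plane R), 'd P z e1 * derive1 (beta : R -> R) z.2 = u z) ->
  (\forall x \near (0 : R^o), beta (s (x, 0)) = eps * P (x, s (x, 0)) ^+ 2) ->
  normal_form s rho eps.
Proof.
move=> ss s0 ds Y0 sY sYE YsE u0 urho epsE sP P0 sbeta beta0 dbeta dP bE.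
have eps2 : eps * eps = 1 by case: epsE => ->; lra.
have sfst : smooth_near (0 : plane R) (fun z : plane R => z.1) by exact: smooth_near_fst.
have ssnd : smooth_near (0 : plane R) (fun z : plane R => z.2) by exact: smooth_near_snd.
have dPn0 : 'd P 0 e1 != 0.
  by apply: contra u0 => /eqP h; rewrite -(nbhs_singleton dP) h mul0r.
have zs : ((0 : plane R).1, s 0) = 0 by rewrite s0.
have [p pE] : exists p : plane R -> R^o, p = (fun z => P (z.1, s z)) by eexists.
have sp : smooth_near 0 p by rewrite pE; exact: (smooth_near_comp2 zs sP sfst ss).
have p0 : p 0 = 0 by rewrite pE zs.
have sbs : smooth_near 0 (fun z => beta (s z)) by exact: (smooth_near_comp1 s0 sbeta ss).
have sepp : smooth_near 0 (fun z => eps * p z ^+ 2).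
  apply: smooth_nearM; first exact: smooth_near_cst.
  exact: smooth_nearX.
have [q qE] : exists q : plane R -> R^o, q = (fun z => beta (s z) - eps * p z ^+ 2) by eexists.
have sq : smooth_near 0 q by rewrite qE; exact: smooth_nearB.
have q0 : q 0 = 0 by rewrite qE s0 beta0 p0 expr0n mulr0 subr0.
have [alpha [alpha0 salpha alphab betaa]] := inverse1 sbeta beta0 (lt0r_neq0 dbeta).
have zz : ((0 : plane R).2, (0 : plane R).1) = 0 by [].
have sPh : smooth_near 0 (fun z : plane R => P (z.2, z.1)).
  exact: (smooth_near_comp2 zz sP ssnd sfst).
have dPh : 'd (fun z : plane R => P (z.2, z.1)) 0 e2 != 0.
  have aux (x y c d : R) : c = 1 -> d = 0 -> x != 0 -> c * x + d * y != 0.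
    by move=> -> ->; rewrite mul1r mul0r addr0.
  rewrite (@diff_comp2v R (plane R) P (fun z => z.2) (fun z => z.1) 0 e2
    (smooth_at_differentiable (smooth_at_snd 0)) (smooth_at_differentiable (smooth_at_fst 0))
    (smooth_at_differentiable (smooth_near_at sP))).
  exact: (aux _ _ _ _ (diff_sndv 0 e2) (diff_fstv 0 e2) dPn0).
have [Z [Z0 sZ PZ ZP]] := shear_inverse sPh P0 dPh.
have sS0 : smooth_near 0 (fun w : plane R => w.2 + eps * w.1 ^+ 2).
  apply: smooth_nearD => //; apply: smooth_nearM; first exact: smooth_near_cst.
  exact: smooth_nearX.
have S00 : (0 : plane R).2 + eps * (0 : plane R).1 ^+ 2 = 0.
  by rewrite /= expr0n mulr0 addr0.
have [S SE] : exists S : plane R -> R^o, S = (fun w => alpha (w.2 + eps * w.1 ^+ 2)) by eexists.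
have sS : smooth_near 0 S by rewrite SE; exact: (@smooth_near_comp1 R (plane R) 0 alpha (fun w => w.2 + eps * w.1 ^+ 2) 0 S00 salpha sS0).
have S0 : S 0 = 0 by rewrite SE S00.
have Sz : (S 0, (0 : plane R).1) = 0 by rewrite S0.
have [a aE] : exists a : plane R -> R^o, a = (fun w => Z (S w, w.1)) by eexists.
have sa : smooth_near 0 a by rewrite aE; exact: (smooth_near_comp2 Sz sZ sS sfst).
have a0 : a 0 = 0 by rewrite aE Sz.
have az : (a 0, S 0) = 0 by rewrite a0 S0.
have [b bEq] : exists b : plane R -> R^o, b = (fun w => Y (a w, S w)) by eexists.
have sb : smooth_near 0 b by rewrite bEq; exact: (smooth_near_comp2 az sY sa sS).
have b0 : b 0 = 0 by rewrite bEq az.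
have sumE z : q z + eps * p z ^+ 2 = beta (s z) by rewrite qE subrK.
have sE : \forall z \near (0 : plane R), s z = alpha (q z + eps * p z ^+ 2).
  have n := near_comp1 (smooth_near_at ss) s0 alphab.
  by apply: (near_imp n) => z E; rewrite sumE E.
have n3 : \forall z \near (0 : plane R), smooth_at (s z : R^o) beta.
  exact: (near_comp1 (smooth_near_at ss) s0 sbeta).
have dqn : \forall z \near (0 : plane R), forall v, 'd q z v =
    derive1 (beta : R -> R) (s z) * 'd s z v - eps * (2 * p z * 'd p z v).
  apply: (near_imp (near_and n3 (near_and ss sp))) => z [sbz [sz spz]] v.
  rewrite qE; have sbsz : smooth_at z (fun z => beta (s z)) by exact: smooth_at_comp1.
  have sppz : smooth_at z (fun z => p z ^+ 2) by exact: smooth_atX.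
  have seppz : smooth_at z (fun z => eps * p z ^+ 2).
    by apply: smooth_atM => //; exact: smooth_at_cst.
  have aux (x y c d e f : R) : x = c -> y = eps * e -> e = f -> x - y = c - eps * f.
    by move=> -> -> ->.
  exact: (etrans (diffBv v sbsz seppz) (aux _ _ _ _ _ _ (diff_comp1_derive v sbz sz)
    (diffZv eps v sppz) (diff_sqrv v spz))).
exists p, q, a, b, alpha; split=> //.
- split.
    have n1 : \forall z \near (0 : plane R), Z (s z, P (z.1, s z)) = z.1.
      have szz : (s 0, (0 : plane R).1) = 0 by rewrite s0.
      exact: (near_comp2 (smooth_near_at ss) (smooth_near_at sfst) szz ZP).
    apply: (near_imp (near_and n1 (near_and sE YsE))) => z [Zz [sz Yz]].
    have Spq : S (p z, q z) = s z by rewrite SE sz.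
    have apq : a (p z, q z) = z.1 by rewrite aE Spq pE.
    by split => //; rewrite bEq apq Spq.
  have n1 := near_comp2 (smooth_near_at sa) (smooth_near_at sS) az sYE.
  have n2 : \forall w \near (0 : plane R), P (Z (S w, w.1), S w) = w.1.
    exact: (near_comp2 (smooth_near_at sS) (smooth_near_at sfst) Sz PZ).
  have n4 := near_comp1 (smooth_near_at sS0) S00 betaa.
  apply: (near_imp (near_and n1 (near_and n2 n4))) => w [sw [Pw bw]].
  have sab : s (a w, b w) = S w by rewrite bEq.
  have pab : p (a w, b w) = w.1 by rewrite pE sab aE.
  split=> //; rewrite qE sab pab SE bw addrK //.
- split=> //.
  have := inverse_derive1 sbeta salpha alpha0 betaa => E.
  by apply: contra_eq_neq E => ->; rewrite mulr0 eq_sym oner_neq0.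
- split.
    have n1 := near_comp2 (smooth_near_at sfst) (smooth_near_at ss) zs sP.
    have n2 := near_comp2 (smooth_near_at sfst) (smooth_near_at ss) zs dP.
    have H := near_and (near_and n1 n2) (near_and (near_and dqn urho) ss).
    apply: (near_imp H) => z [[sPz dPz] [[dqv uz] sz]].
    have dpv v : 'd p z v = v.1 * 'd P (z.1, s z) e1 + 'd s z v * 'd P (z.1, s z) e2.
      rewrite pE; apply: (etrans (@diff_comp2v R (plane R) P (fun z => z.1) s z v
       (smooth_at_differentiable (smooth_at_fst z)) (smooth_at_differentiable sz)
       (smooth_at_differentiable sPz))).
      by congr (_ * _ + _); exact: diff_fstv.
    have aux (p1 p2 q1 q2 b' s1 s2 k P1 P2 uu r : R) :
      p1 = 1 * P1 + s1 * P2 -> p2 = 0 * P1 + s2 * P2 ->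
      q1 = b' * s1 - eps * (2 * k * p1) -> q2 = b' * s2 - eps * (2 * k * p2) ->
      P1 * b' = uu -> uu * s2 = r -> p1 * q2 - p2 * q1 = r.
      by move=> -> -> -> -> <- <-; ring.
    exact: (aux _ _ _ _ _ _ _ _ _ _ _ _ (dpv e1) (dpv e2) (dqv e1) (dqv e2) dPz uz).
  apply: (sign_half_plane sq).
    by apply: (near_imp bE) => x E; rewrite qE E pE subrr.
  have -> : 'd q 0 e2 = derive1 (beta : R -> R) 0 * 'd s 0 e2.
    have := nbhs_singleton dqn e2; rewrite s0 p0 => E.
    have aux (x y : R) : x - eps * (2 * 0 * y) = x by ring.
    exact: (etrans E (aux _ _)).
  exact: mulr_gt0.
Qed.

(** The sign eta for which s = eta (f - f (0)) increases with y makes q and y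
have the same sign. *)
Theorem local_normal_form (f rho : plane R -> R^o) :
  smooth_near 0 f -> smooth_near 0 rho -> rho 0 != 0 -> 'd f 0 e2 != 0 ->
  derive1 (fun x : R => f (x, 0) : R) 0 = 0 ->
  derive1n 2 (fun x : R => f (x, 0) : R) 0 != 0 ->
  exists eps : R, (eps = 1 \/ eps = -1) /\ normal_form f rho eps.
Proof.
move=> sf srho rho0 df f1 f2.
have [eta [etaE etadf]] := sign_choice df.
have eta2 : eta * eta = 1 by case: etaE => ->; lra.
have eta0 : eta != 0 by case: etaE => ->; rewrite ?oppr_eq0 oner_neq0.
have [s sE] : exists s : plane R -> R^o, s = (fun z => eta * (f z - f 0)) by eexists.
have sfc : smooth_near 0 (fun z => f z - f 0).
  by apply: smooth_nearB => //; exact: smooth_near_cst.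
have ss : smooth_near 0 s by rewrite sE; apply: smooth_nearM => //; exact: smooth_near_cst.
have s0 : s 0 = 0 by rewrite sE subrr mulr0.
have dsv : \forall z \near (0 : plane R), forall v, 'd s z v = eta * 'd f z v.
  apply: (near_imp (near_and sf sfc)) => z [sfz sfcz] v; rewrite sE.
  have aux (x y c d : R) : x = eta * y -> y = c - d -> d = 0 -> x = eta * c.
    by move=> -> -> ->; rewrite subr0.
  exact: (aux _ _ _ _ (diffZv eta v sfcz) (diffBv v sfz (smooth_at_cst z (f 0))) (diff_cstv z v (f 0))).
have ds : 0 < 'd s 0 e2 by rewrite (nbhs_singleton dsv).
have sx : smooth_near (0 : R^o) (fun x : R^o => x) by exact: smooth_near_id.
have sc0 : smooth_near (0 : R^o) (fun x : R^o => 0 : R^o) by exact: smooth_near_cst.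
have z00 : ((0 : R^o), (0 : R^o)) = (0 : plane R) by [].
have [Y [u [Y0 sY sYE YsE [su u0 us]]]] := straighten ss s0 (lt0r_neq0 ds) srho rho0.
have sg : smooth_near (0 : R^o) (fun x => s (x, 0)).
  exact: (@smooth_near_comp2 R R^o 0 s (fun x => x) (fun=> 0) 0 z00 ss sx sc0).
have nslice (P : set (plane R)) : (\forall z \near (0 : plane R), P z) ->
    \forall x \near (0 : R^o), P (x, 0).
  exact: (near_comp2 (smooth_near_at sx) (smooth_near_at sc0) z00).
have dg : \forall x \near (0 : R^o), eta * derive1 (fun x : R => f (x, 0) : R) x =
    derive1 (fun x : R => s (x, 0) : R) x.
  apply: (near_imp (near_and (nslice _ dsv) (near_and (nslice _ ss) (nslice _ sf)))).
  by move=> x [dx [sx' fx]]; rewrite !derive1_slice // dx.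
have sfx : smooth_near (0 : R^o) (fun x => f (x, 0)).
  exact: (@smooth_near_comp2 R R^o 0 f (fun x => x) (fun=> 0) 0 z00 sf sx sc0).
have g1 : derive1 (fun x : R => s (x, 0) : R) 0 = 0.
  by rewrite -(nbhs_singleton dg) f1 mulr0.
have g2 : derive1n 2 (fun x : R => s (x, 0) : R) 0 != 0.
  have d2 := smooth_at_is_derive (smooth_near_at (smooth_near_derive1 sfx)).
  have d3 := @is_deriveZ R R^o R^o _ eta 0 1 _ d2.
  have dg' : \forall x \near (0 : R), (eta \*: derive1 (fun x : R => f (x, 0) : R)) x =
    derive1 (fun x : R => s (x, 0) : R) x by exact: dg.
  have d4 := near_eq_is_derive dg' d3.
  rewrite (_ : derive1n 2 _ 0 = eta * derive1n 2 (fun x : R => f (x, 0) : R) 0).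
    by rewrite mulf_neq0.
  exact: is_derive_derive1 d4.
have [eps [P [beta [epsE [sP P0] [sbeta beta0 dbeta] dP bE]]]] :=
  solve_boundary su u0 sg s0 g1 g2.
have [p [q [a [b [alpha [H1 H2 H3 [salpha dalpha sal] H5]]]]]] :=
  assemble ss s0 ds Y0 sY sYE YsE u0 us epsE sP P0 sbeta beta0 dbeta dP bE.
exists eps; split=> //.
exists p, q, a, b, (fun t => f 0 + eta * alpha t); split=> //; split.
- apply: smooth_nearD; first exact: smooth_near_cst.
  by apply: smooth_nearM => //; exact: smooth_near_cst.
- have d1 := smooth_at_is_derive (smooth_near_at salpha).
  have d2 := @is_deriveZ R R^o R^o _ eta 0 1 _ d1.
  have d3 := is_deriveD (is_derive_cst (f 0 : R^o) (0 : R^o) (1 : R^o)) d2.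
  rewrite (is_derive_derive1 d3) add0r mulf_neq0 //.
- apply: (near_imp sal) => z <-; rewrite sE mulrA eta2 mul1r addrC subrK //.
Qed.

End Assembly.

(** * Charts and coordinate changes *)

Section HalfDiff.
Context {R : realType}.
Implicit Types (x v : plane R).

(** Since x + h v stays in the half-plane for all h of one sign, limits over such
h are unique. *)
Lemma half_plane_direction x v : half_plane x ->
  ProperFilter (within [set h : R | half_plane (h *: v + x)] (0 : R)^').
Proof.
move=> xH; apply: Build_ProperFilter_ex => P; rewrite /within /= => nP.
have [r /= r0 rP] := iffLR (nbhs_ballP _ _) nP.
have H (h : R) : h != 0 -> `|h| < r -> half_plane (h *: v + x) -> P h.
  by move=> h0 hr; apply: (rP h) => //=; rewrite /ball /= sub0r normrN.
have r2 : `|r / 2| < r by rewrite gtr0_norm ?divr_gt0 //; lra.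
have rn0 : r / 2 != 0 by rewrite gt_eqF // divr_gt0.
have [v0|v0] := leP 0 v.2.
  exists (r / 2); apply: H => //.
  by rewrite /half_plane /= addr_ge0 // mulr_ge0 // divr_ge0 // ltW.
exists (- (r / 2)); apply: H; rewrite ?oppr_eq0 ?normrN //.
rewrite /half_plane /= addr_ge0 // [X in 0 <= X](_ : _ = (r / 2) * - v.2).
  by rewrite mulr_ge0 // ?divr_ge0 ?oppr_ge0 // ltW.
by rewrite mulrN -mulNr.
Qed.

(** One-sided derivatives are computed with any extension across the edge. *)
Lemma half_diffE (W : normedModType R) (g h : plane R -> W) x v : half_plane x ->
  (\forall y \near x, half_plane y -> g y = h y) -> differentiable h x ->
  half_diff g x v = 'd h x v.
Proof.
move=> xH gh dh; rewrite -deriveE //.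
have PF := half_plane_direction v xH.
apply: cvg_lim => //.
have gx : g x = h x by exact: (nbhs_singleton gh).
have c : (fun t : R => t *: v + x) @ (0 : R) --> x.
  rewrite -[X in _ --> X]add0r -(scale0r v); apply: cvgD; last exact: cvg_cst.
  by apply: cvgZr_tmp.
have n := near_cvg c gh.
have dd := diff_derivable (v := v) dh.
apply: (@cvg_trans _ (t^-1 *: (h (t *: v + x) - h x) @[t --> within
  [set t : R | half_plane (t *: v + x)] (0 : R)^'])); last first.
  exact: cvg_within_filter dd.
apply: near_eq_cvg.
have n' : (0 : R)^' [set t : R | half_plane (t *: v + x) ->
    g (t *: v + x) = h (t *: v + x)] by exact: (@cvg_within _ _ _ _ _ n).
rewrite /prop_near1 /within /=; apply: filterS n' => t gt tH.
by rewrite gt // gx.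
Qed.

End HalfDiff.

Section Charts.
Context {R : realType} {T : topologicalType}.
Implicit Types (c d : chart R T) (m : T) (x y v : plane R).

Lemma chart_img_half c y : chart_img c y -> half_plane y.
Proof.
have [A [oA E]] := chart_img_open c.
by rewrite /chart_img E => -[].
Qed.

Lemma chart_half c m : chart_dom c m -> half_plane (chart_map c m).
Proof. by move=> cm; apply: (@chart_img_half c); exists m. Qed.

Lemma chart_img_near c m : chart_dom c m ->
  \forall y \near chart_map c m, half_plane y -> chart_img c y.
Proof.
move=> cm; have [A [oA E]] := chart_img_open c.
have Am : A (chart_map c m).
  have : (chart_map c @` chart_dom c) (chart_map c m) by exists m.
  by rewrite E => -[].
have nA : \forall y \near chart_map c m, A y by exact: open_nbhs_nbhs.
by apply: (near_imp nA) => y Ay yH; rewrite /chart_img E.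
Qed.

Lemma chart_invK c y : chart_img c y ->
  chart_dom c (chart_inv c y) /\ chart_map c (chart_inv c y) = y.
Proof. by move=> [m cm <-]; rewrite chart_mapK. Qed.

Lemma chart_inv_near c m (U : set T) : chart_dom c m -> (\forall m' \near m, U m') ->
  \forall y \near chart_map c m, half_plane y -> U (chart_inv c y).
Proof.
move=> cm nU.
have ci : chart_img c (chart_map c m) by exists m.
have /subspace_continuousP /(_ _ ci) H := @chart_inv_cont _ _ c.
have nU' : \forall m' \near chart_inv c (chart_map c m), U m' by rewrite chart_mapK.
have n1 : \forall y \near chart_map c m, chart_img c y -> U (chart_inv c y).
  exact: (H _ nU').
apply: (near_imp (near_and n1 (chart_img_near cm))) => y [h1 h2] yH.
by apply: h1; exact: h2.
Qed.

Lemma chart_map_near c m (P : set (plane R)) : chart_dom c m ->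
  (\forall y \near chart_map c m, P y) -> \forall m' \near m, P (chart_map c m').
Proof.
move=> cm nP.
have /subspace_continuousP /(_ _ cm) H := @chart_map_cont _ _ c.
have n1 : \forall m' \near m, chart_dom c m' -> P (chart_map c m') by exact: (H _ nP).
have n2 : \forall m' \near m, chart_dom c m'.
  by apply: open_nbhs_nbhs; split=> //; exact: chart_dom_open.
by apply: filterS2 n1 n2 => m' h1 h2; exact: h1.
Qed.

Lemma smooth_within_scalar (D : set (plane R)) (g : plane R -> R^o) x :
  smooth_within D g -> D x -> exists h : plane R -> R^o,
    smooth_near x h /\ \forall y \near x, D y -> g y = h y.
Proof.
move=> sg Dx; have [A [h [oA Ax sh gh]]] := sg x Dx; exists h.
have nA : \forall y \near x, A y by exact: open_nbhs_nbhs.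
split; apply: (near_imp nA) => y Ay; first exact: (smooth_on_at oA sh Ay).
exact: gh.
Qed.

Lemma smooth_within_plane (D : set (plane R)) (g : plane R -> plane R) x :
  smooth_within D g -> D x -> exists h1 h2 : plane R -> R^o,
    [/\ smooth_near x h1, smooth_near x h2 & \forall y \near x, D y -> g y = (h1 y, h2 y)].
Proof.
move=> sg Dx; have [A [h [oA Ax sh gh]]] := sg x Dx.
have sh1 : smooth_on A (fun y => (h y).1 : R^o).
  exact: (@smooth_on_lin R (plane R) fst A h (fun w => cvg_fst) oA sh).
have sh2 : smooth_on A (fun y => (h y).2 : R^o).
  exact: (@smooth_on_lin R (plane R) snd A h (fun w => cvg_snd) oA sh).
exists (fun y => (h y).1), (fun y => (h y).2).
have nA : \forall y \near x, A y by exact: open_nbhs_nbhs.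
split; apply: (near_imp nA) => y Ay.
- exact: (smooth_on_at oA sh1 Ay).
- exact: (smooth_on_at oA sh2 Ay).
- by move=> Dy; rewrite gh //; case: (h y).
Qed.

Lemma smooth_within_intro (D : set (plane R)) (g : plane R -> plane R) :
  (forall x, D x -> exists h1 h2 : plane R -> R^o,
    [/\ smooth_near x h1, smooth_near x h2 & \forall y \near x, D y -> g y = (h1 y, h2 y)]) ->
  smooth_within D g.
Proof.
move=> H x /H[h1 [h2 [s1 s2 E]]].
have [A [oA Ax AP]] := near_open (near_and (near_and s1 s2) E).
exists A, (fun y => (h1 y, h2 y)); split=> //.
- by apply: smooth_at_on_pair => y /AP[[]].
- by move=> y /AP[].
Qed.

(** Extending coordinate changes across the edge reduces the calculus on the
half-plane to that of germs on the plane. *)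
Lemma transition_ext c d m : compatible c d -> chart_dom c m -> chart_dom d m ->
  exists T1 T2 : plane R -> R^o,
  [/\ smooth_near (chart_map c m) T1, smooth_near (chart_map c m) T2,
      (T1 (chart_map c m), T2 (chart_map c m)) = chart_map d m,
      \forall y \near chart_map c m, half_plane y ->
        [/\ chart_dom c (chart_inv c y), chart_dom d (chart_inv c y) &
            transition c d y = (T1 y, T2 y)] &
      forall v, half_diff (transition c d) (chart_map c m) v =
        ('d T1 (chart_map c m) v, 'd T2 (chart_map c m) v)].
Proof.
move=> [cd _] cm dm.
have Dx : (chart_map c @` (chart_dom c `&` chart_dom d)) (chart_map c m) by exists m.
have [h1 [h2 [s1 s2 E]]] := smooth_within_plane cd Dx.
have nd : \forall m' \near m, chart_dom d m'.
  by apply: open_nbhs_nbhs; split=> //; exact: chart_dom_open.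
have H : \forall y \near chart_map c m, half_plane y ->
    [/\ chart_dom c (chart_inv c y), chart_dom d (chart_inv c y) &
        transition c d y = (h1 y, h2 y)].
  apply: (near_imp (near_and E (near_and (chart_inv_near cm nd) (chart_img_near cm)))).
  move=> y [Ey [dy cy]] yH.
  have [ci cK] := chart_invK (cy yH); have di := dy yH.
  by split=> //; apply: Ey; exists (chart_inv c y).
have xH := chart_half cm.
exists h1, h2; split=> //.
- have [_ _ <-] := nbhs_singleton H xH.
  by rewrite /transition /= chart_mapK.
- move=> v.
  have d1 := smooth_at_differentiable (smooth_near_at s1).
  have d2 := smooth_at_differentiable (smooth_near_at s2).
  rewrite (@half_diffE _ _ _ (fun y => (h1 y, h2 y)) _ v xH).
  + by have /(congr1 (fun L => L v)) := diff_pair d1 d2.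
  + by apply: (near_imp H) => y Hy /Hy[].
  + exact: differentiable_pair.
Qed.

(** The chain rule for the expressions of phi in the charts c and d. *)
Lemma half_diff_transition c d m (phi : T -> R) (Phi : plane R -> R^o) v :
  compatible c d -> chart_dom c m -> chart_dom d m ->
  smooth_at (chart_map d m) Phi ->
  (\forall y \near chart_map d m, half_plane y -> phi (chart_inv d y) = Phi y) ->
  half_diff (phi \o chart_inv c : plane R -> R^o) (chart_map c m) v =
  'd Phi (chart_map d m) (half_diff (transition c d) (chart_map c m) v).
Proof.
move=> cd cm dm sPhi E.
have [T1 [T2 [s1 s2 T0 H ->]]] := transition_ext cd cm dm.
have sPhi' : smooth_at (T1 (chart_map c m), T2 (chart_map c m)) Phi by rewrite T0.
have sc := smooth_at_comp2 sPhi' (smooth_near_at s1) (smooth_near_at s2).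
rewrite (@half_diffE _ _ _ (fun y => Phi (T1 y, T2 y)) _ v (chart_half cm)).
- apply: (etrans (@diff_comp2v R (plane R) Phi T1 T2 (chart_map c m) v
    (smooth_at_differentiable (smooth_near_at s1)) (smooth_at_differentiable (smooth_near_at s2))
    (smooth_at_differentiable sPhi'))).
  rewrite T0; exact: (esym (diff_plane Phi (chart_map d m)
    ('d T1 (chart_map c m) v, 'd T2 (chart_map c m) v))).
- have n := near_comp2 (smooth_near_at s1) (smooth_near_at s2) T0 E.
  apply: (near_imp (near_and n H)) => y [ny Hy] yH.
  have [cy dy Ty] := Hy yH.
  have E2 : chart_map d (chart_inv c y) = (T1 y, T2 y) by exact: Ty.
  by rewrite /= -ny -E2 ?chart_mapK //; exact: chart_half.
- exact: smooth_at_differentiable.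
Qed.

Lemma diff_at_min (g : plane R -> R^o) x v : smooth_near x g -> g x = 0 ->
  (\forall y \near x, 0 <= g y) -> 'd g x v = 0.
Proof.
move=> sg g0 gp.
have c : (fun t : R => t *: v + x) @ (0 : R) --> x.
  rewrite -[X in _ --> X]add0r -(scale0r v); apply: cvgD; last exact: cvg_cst.
  by apply: cvgZr_tmp.
have n : \forall t \near (0 : R^o), smooth_at (t *: v + x) g /\ 0 <= g (t *: v + x).
  exact: (near_cvg c (near_and sg gp)).
have [r r0 rP] := iffLR (near0_normP _) n.
have dl (t : R) : `|t| < r -> is_derive t 1 (fun s : R => g (s *: v + x) : R) ('D_v g (t *: v + x)).
  move=> /rP[st _]; apply: is_derive_line; apply: diff_derivable.
  exact: smooth_at_differentiable.
have I (t : R) : t \in `]- r, r[ -> `|t : R| < r by rewrite in_itv /= -ltr_norml.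
have z0 : (0 : R) \in `]- r, r[ by rewrite in_itv /= oppr_lt0 r0.
have d0 : is_derive (0 : R) 1 (fun s : R => g (s *: v + x) : R) 0.
  apply: (@derive1_at_min R _ (- r) r).
  - lra.
  - by move=> t /I/dl dt; exact: ex_derive.
  - exact: z0.
  - by move=> t /I/rP[_]; rewrite scale0r add0r g0.
have := dl 0 (I _ z0); rewrite scale0r add0r => d1.
rewrite -deriveE; last exact: smooth_at_differentiable (smooth_near_at sg).
by rewrite -(is_derive_derive1 d1) (is_derive_derive1 d0).
Qed.

(** Otherwise the second component T2 of the coordinate change would have a
local minimum at an interior point, hence a vanishing differential there, which
is impossible since the coordinate change has a differentiable inverse. *)
Lemma boundary_invariant c d m : compatible c d -> compatible d c ->
  chart_dom c m -> chart_dom d m -> (chart_map d m).2 = 0 -> (chart_map c m).2 = 0.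
Proof.
move=> cd dc cm dm d0.
have := chart_half cm; rewrite /half_plane /= le_eqVlt => /orP[/eqP ->//|c0].
have [T1 [T2 [sT1 sT2 T0 HT _]]] := transition_ext cd cm dm.
have [S1 [S2 [sS1 sS2 S0 HS _]]] := transition_ext dc dm cm.
have nH : \forall y \near chart_map c m, half_plane y.
  by apply: (near_imp (near_gt0 (smooth_at_snd (chart_map c m)) c0)) => y /ltW.
have T2p : \forall y \near chart_map c m, 0 <= T2 y.
  apply: (near_imp (near_and nH HT)) => y [yH /(_ yH)[_ dy Ty]].
  by have := chart_half dy; rewrite -[chart_map d _]/(transition c d y) Ty.
have T20 : T2 (chart_map c m) = 0 by rewrite -d0 -T0.
have dT2 v := diff_at_min v sT2 T20 T2p.
have SS := near_comp2 (smooth_near_at sT1) (smooth_near_at sT2) T0 HS.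
have ST : \forall y \near chart_map c m, S1 (T1 y, T2 y) = y.1 /\ S2 (T1 y, T2 y) = y.2.
  apply: (near_imp (near_and (near_and SS (chart_img_near cm)) (near_and nH HT))).
  move=> y [[Sy iy] [yH /(_ yH)[cy dy Ty]]].
  have [_ yK] := chart_invK (iy yH).
  have E2 : chart_map d (chart_inv c y) = (T1 y, T2 y) by exact: Ty.
  have TH : half_plane ((T1 y, T2 y) : plane R) by rewrite -E2; exact: chart_half.
  have [_ _ E] := Sy TH.
  have E3 : y = (S1 (T1 y, T2 y), S2 (T1 y, T2 y)).
    by rewrite -E /transition /= -E2 chart_mapK // yK.
  by split; rewrite [in RHS]E3.
have sS1' : smooth_at (T1 (chart_map c m), T2 (chart_map c m)) S1.
  by rewrite T0; exact: smooth_near_at.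
have sS2' : smooth_at (T1 (chart_map c m), T2 (chart_map c m)) S2.
  by rewrite T0; exact: smooth_near_at.
have dT1 := smooth_at_differentiable (smooth_near_at sT1).
have dT2' := smooth_at_differentiable (smooth_near_at sT2).
have n1 : \forall y \near chart_map c m, S1 (T1 y, T2 y) = y.1.
  by apply: (near_imp ST) => y [].
have n2 : \forall y \near chart_map c m, S2 (T1 y, T2 y) = y.2.
  by apply: (near_imp ST) => y [].
pose t v := 'd T1 (chart_map c m) v.
have aux (a b e f r : R) : a * b + e * f = r -> e = 0 -> r = a * b.
  by move=> <- ->; rewrite mul0r addr0.
have D1 v : v.1 = t v * 'd S1 (T1 (chart_map c m), T2 (chart_map c m)) e1.
  apply: (aux _ _ _ _ _ _ (dT2 v)).
  apply: (etrans (esym (diff_comp2v v dT1 dT2' (smooth_at_differentiable sS1')))).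
  have [_ E] := diff_near_eq n1 (smooth_at_differentiable
    (smooth_at_comp2 sS1' (smooth_near_at sT1) (smooth_near_at sT2))).
  by have /(congr1 (fun L => L v)) := E => <-; exact: diff_fstv.
have D2 v : v.2 = t v * 'd S2 (T1 (chart_map c m), T2 (chart_map c m)) e1.
  apply: (aux _ _ _ _ _ _ (dT2 v)).
  apply: (etrans (esym (diff_comp2v v dT1 dT2' (smooth_at_differentiable sS2')))).
  have [_ E] := diff_near_eq n2 (smooth_at_differentiable
    (smooth_at_comp2 sS2' (smooth_near_at sT1) (smooth_near_at sT2))).
  by have /(congr1 (fun L => L v)) := E => <-; exact: diff_sndv.
have aux2 (p k1 r k2 : R) : 1 = p * k1 -> 0 = r * k1 -> 1 = r * k2 -> False.
  move=> h1 h2 h3; have : (1 : R) * 1 = 0.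
    by rewrite {1}h1 h3 mulrACA [p * r]mulrC mulrACA -h2 mul0r.
  by move/eqP; rewrite mulr1 oner_eq0.
exfalso; exact: (aux2 _ _ _ _ (D1 e1) (D1 e2) (D2 e2)).
Qed.

End Charts.

(** * Reparametrized charts *)

Section Reparam.
Context {R : realType} {T : topologicalType}.
Implicit Types (c d : chart R T) (m : T) (x y v w : plane R).

Lemma open_near (S : topologicalType) (A : set S) :
  (forall s : S, A s -> \forall t \near s, A t) -> open A.
Proof. by move=> H; rewrite openE => s /H. Qed.

(** Theta is a homeomorphism between open sets A and A' of the plane which
preserves the half-plane. The points of the half-plane in A have to be in the
image of the chart for the new image to be relatively open. *)
Lemma chart_reparam c (A A' : set (plane R)) (Theta Psi : plane R -> plane R) :
  open A ->
  (forall y, A y -> A' (Theta y) /\ Psi (Theta y) = y) ->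
  (forall w, A' w -> A (Psi w) /\ Theta (Psi w) = w) ->
  open A' ->
  (forall y, A y -> half_plane (Theta y) <-> half_plane y) ->
  (forall y, A y -> {for y, continuous Theta}) ->
  (forall w, A' w -> {for w, continuous Psi}) ->
  (forall y, A y -> half_plane y -> chart_img c y) ->
  exists c' : chart R T, [/\ chart_dom c' = [set m | chart_dom c m /\ A (chart_map c m)],
    chart_map c' = Theta \o chart_map c & chart_inv c' = chart_inv c \o Psi].
Proof.
move=> oA AT AP oA' TH cT cP AI.
pose U := [set m | chart_dom c m /\ A (chart_map c m)].
have oU : open U.
  apply: open_near => m [cm Am].
  have nA : \forall y \near chart_map c m, A y by exact: open_nbhs_nbhs.
  have nd : \forall m' \near m, chart_dom c m'.
    by apply: open_nbhs_nbhs; split=> //; exact: chart_dom_open.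
  by apply: filterS2 nd (chart_map_near cm nA).
have imgE : (Theta \o chart_map c) @` U = A' `&` @half_plane R.
  apply/seteqP; split=> [w [m [cm Am] <-]|w [A'w wH]].
    have [A't _] := AT _ Am; split => //.
    by apply/(TH _ Am); exact: chart_half.
  have [Ap Tp] := AP _ A'w.
  have pH : half_plane (Psi w) by apply/(TH _ Ap); rewrite Tp.
  have [cm mE] := chart_invK (AI _ Ap pH).
  exists (chart_inv c (Psi w)); last by rewrite /= mE.
  by split=> //; rewrite mE.
have oI : exists B, open B /\ (Theta \o chart_map c) @` U = B `&` @half_plane R.
  by exists A'.
have K m : U m -> (chart_inv c \o Psi) ((Theta \o chart_map c) m) = m.
  by move=> [cm Am]; have [_ E] := AT _ Am; rewrite /= E chart_mapK.
have cm : {within U, continuous (Theta \o chart_map c)}.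
  apply/subspace_continuousP => m [cm Am].
  apply: (@cvg_trans _ ((Theta \o chart_map c) m' @[m' --> m])).
    by apply: cvg_fmap2; exact: cvg_within.
  move=> P nP; have nP' := near_cvg (cT _ Am) nP.
  exact: (chart_map_near cm nP').
have ci : {within (Theta \o chart_map c) @` U, continuous (chart_inv c \o Psi)}.
  apply/subspace_continuousP => w; rewrite imgE => -[A'w wH] P nP.
  have [Ap Tp] := AP _ A'w.
  have pH : half_plane (Psi w) by apply/(TH _ Ap); rewrite Tp.
  have [dm mE] := chart_invK (AI _ Ap pH).
  have n1 := chart_inv_near dm nP; rewrite mE in n1.
  have n2 := near_cvg (cP _ A'w) n1.
  have nA' : \forall w' \near w, A' w' by exact: open_nbhs_nbhs.
  rewrite /within /=.
  apply: (near_imp (near_and n2 nA')) => w' [h A'w'] [_ w'H]; apply: h.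
  have [Ap' Tp'] := AP _ A'w'.
  by apply/(TH _ Ap'); rewrite Tp'.
by exists (Chart oU oI K cm ci).
Qed.

End Reparam.

Section SmoothReparam.
Context {R : realType} {M : surface R}.

(** The coordinate changes with the new chart are those of the old one composed
with th on one side or ps on the other. *)
Lemma smooth_reparam (c c' : chart R M) (A A' : set (plane R))
    (th1 th2 ps1 ps2 : plane R -> R^o) :
  atlas c ->
  chart_dom c' = [set m | chart_dom c m /\ A (chart_map c m)] ->
  chart_map c' = (fun y => (th1 y, th2 y)) \o chart_map c ->
  chart_inv c' = chart_inv c \o (fun w => (ps1 w, ps2 w)) ->
  (forall y, A y -> [/\ A' (th1 y, th2 y), (ps1 (th1 y, th2 y), ps2 (th1 y, th2 y)) = y,
     smooth_near y th1 & smooth_near y th2]) ->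
  (forall w, A' w -> smooth_near w ps1 /\ smooth_near w ps2) ->
  smooth_chart c'.
Proof.
move=> ac dE mE iE HA HA' d ad.
have cd := atlas_compatible ac ad; have dc := atlas_compatible ad ac.
split; apply: smooth_within_intro => _ [m [c'm dm] <-].
- move: c'm; rewrite dE => -[cm Am].
  have [T1 [T2 [s1 s2 T0 HT _]]] := transition_ext cd cm dm.
  have [A'm psth st1 st2] := HA _ Am.
  have [sp1 sp2] := HA' _ A'm.
  have wE : chart_map c' m = (th1 (chart_map c m), th2 (chart_map c m)) by rewrite mE.
  rewrite wE; set w := (th1 _, th2 _) in psth A'm sp1 sp2 *.
  exists (fun w => T1 (ps1 w, ps2 w)), (fun w => T2 (ps1 w, ps2 w)); split.
  + exact: (smooth_near_comp2 psth s1 sp1 sp2).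
  + exact: (smooth_near_comp2 psth s2 sp1 sp2).
  + have n := near_comp2 (smooth_near_at sp1) (smooth_near_at sp2) psth HT.
    apply: (near_imp n) => w' Hw' [m' [c'm' _] w'E].
    move: c'm' => -[cm' Am'].
    have [_ psth' _ _] := HA _ Am'.
    have psE : (ps1 w', ps2 w') = chart_map c m'.
      by rewrite -w'E mE /= psth'.
    have [|_ _ E] := Hw'; first by rewrite psE; exact: chart_half.
    by rewrite /transition iE; exact: E.
- move: c'm; rewrite dE => -[cm Am].
  have [T1 [T2 [s1 s2 T0 HT _]]] := transition_ext dc dm cm.
  have [A'm psth st1 st2] := HA _ Am.
  exists (fun y => th1 (T1 y, T2 y)), (fun y => th2 (T1 y, T2 y)); split.
  + exact: (smooth_near_comp2 T0 st1 s1 s2).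
  + exact: (smooth_near_comp2 T0 st2 s1 s2).
  + apply: (near_imp HT) => y Hy [m' [_ dm'] yE].
    have [|_ _ E] := Hy; first by rewrite -yE; exact: chart_half.
    by rewrite -E /transition mE.
Qed.

End SmoothReparam.

(** * Translations and two-forms *)

Section Shift.
Context {R : realType}.
Implicit Types (g : plane R -> R^o) (z a v : plane R).

Lemma smooth_near_shift g z a : smooth_near (z.1 + a.1, z.2 + a.2) g ->
  smooth_near z (fun z => g (z.1 + a.1, z.2 + a.2)).
Proof.
move=> sg; apply: (@smooth_near_comp2 R (plane R) z g (fun z => z.1 + a.1)
  (fun z => z.2 + a.2) _ erefl sg).
  by apply: smooth_nearD; [exact: smooth_near_fst|exact: smooth_near_cst].
by apply: smooth_nearD; [exact: smooth_near_snd|exact: smooth_near_cst].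
Qed.

Lemma diff_shift g z a v : smooth_at (z.1 + a.1, z.2 + a.2) g ->
  'd (fun z => g (z.1 + a.1, z.2 + a.2)) z v = 'd g (z.1 + a.1, z.2 + a.2) v.
Proof.
move=> sg.
have s1 : smooth_at z (fun z : plane R => z.1 + a.1).
  by apply: smooth_atD; [exact: smooth_at_fst|exact: smooth_at_cst].
have s2 : smooth_at z (fun z : plane R => z.2 + a.2).
  by apply: smooth_atD; [exact: smooth_at_snd|exact: smooth_at_cst].
have d1 : 'd (fun z : plane R => z.1 + a.1 : R^o) z v = v.1.
  have aux (x y r : R) : x = r -> y = 0 -> x + y = r by move=> -> ->; rewrite addr0.
  exact: (etrans (diffDv v (smooth_at_differentiable (smooth_at_fst z))
    (smooth_at_differentiable (smooth_at_cst z a.1))) (aux _ _ _ (diff_fstv z v) (diff_cstv z v a.1))).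
have d2 : 'd (fun z : plane R => z.2 + a.2 : R^o) z v = v.2.
  have aux (x y r : R) : x = r -> y = 0 -> x + y = r by move=> -> ->; rewrite addr0.
  exact: (etrans (diffDv v (smooth_at_differentiable (smooth_at_snd z))
    (smooth_at_differentiable (smooth_at_cst z a.2))) (aux _ _ _ (diff_sndv z v) (diff_cstv z v a.2))).
apply: (etrans (@diff_comp2v R (plane R) g (fun z => z.1 + a.1) (fun z => z.2 + a.2) z v
  (smooth_at_differentiable s1) (smooth_at_differentiable s2) (smooth_at_differentiable sg))).
apply: (etrans _ (esym (diff_plane g _ v))).
by congr (_ * _ + _ * _).
Qed.

Lemma derive1n_shift k (G : R -> R) (t x : R) :
  derive1n k (fun x => G (x + t)) x = derive1n k G (x + t).
Proof.
elim: k x => // k IHk x; rewrite !derive1nS.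
have -> : derive1n k (fun x => G (x + t)) = (fun x => derive1n k G (x + t)).
  by apply/funext => y; exact: IHk.
have E : (fun h : R => h^-1 *: (derive1n k G (h + x + t) - derive1n k G (x + t))) =
    (fun h : R => h^-1 *: (derive1n k G (h + (x + t)) - derive1n k G (x + t))).
  by apply/funext => h; rewrite addrA.
by rewrite /derive1 E.
Qed.

Lemma continuous_pair (V : normedModType R) (x : V) (h1 h2 : V -> R^o) :
  smooth_at x h1 -> smooth_at x h2 ->
  {for x, continuous (fun y => (h1 y, h2 y) : plane R)}.
Proof.
move=> /smooth_at_cont c1 /smooth_at_cont c2.
exact: (@cvg_pair _ _ _ (nbhs x) (nbhs (h1 x)) (nbhs (h2 x)) _ _ _ h1 h2 c1 c2).
Qed.

End Shift.

Section TwoForm.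
Context {R : realType} {M : surface R}.

Lemma two_form_det (w : form_family M) c m u v : two_form w ->
  atlas c -> chart_dom c m ->
  w c m u v = (u.1 * v.2 - u.2 * v.1) * w c m e1 e2.
Proof.
move=> [ll lr alt _] ac cm.
have L1 (x : R) a b y : w c m (x *: a + b) y = x * w c m a y + w c m b y.
  exact: (ll c m y ac cm x a b).
have L2 (x : R) a b y : w c m y (x *: a + b) = x * w c m y a + w c m y b.
  exact: (lr c m y ac cm x a b).
have Z1 y : w c m 0 y = 0.
  have := L1 1 0 0 y; rewrite scaler0 addr0 mul1r => /eqP.
  by rewrite -subr_eq0 opprD addrA subrr sub0r oppr_eq0 => /eqP.
have Z2 y : w c m y 0 = 0.
  have := L2 1 0 0 y; rewrite scaler0 addr0 mul1r => /eqP.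
  by rewrite -subr_eq0 opprD addrA subrr sub0r oppr_eq0 => /eqP.
have E (y : plane R) : y = y.1 *: e1 + (y.2 *: e2 + 0).
  rewrite !plane_scale !plane_add /= !mulr1 !mulr0 !addr0 add0r; by case: y.
have A11 := alt c m e1 ac cm; have A22 := alt c m e2 ac cm.
have A12 : w c m e2 e1 = - w c m e1 e2.
  have := alt c m (1 *: e1 + (1 *: e2 + 0)) ac cm.
  rewrite !(L1, L2, Z1, Z2, A11, A22) !mul1r !addr0 add0r => /eqP.
  by rewrite addrC addr_eq0 => /eqP.
rewrite {1}(E u) {1}(E v) !(L1, L2, Z1, Z2, A11, A22, A12).
move: (w c m e1 e2) => k; have aux (a b c' d : R) :
  a * (c' * 0 + (d * k + 0)) + (b * (c' * - k + (d * 0 + 0)) + (c' * 0 + (d * 0 + 0))) = (a * d - b * c') * k by ring.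
exact: aux.
Qed.

End TwoForm.

(** * The normal form on the surface *)

(** A chart at O turns f and omega into the data of local_normal_form, and it is
composed with the coordinate change (p, q) given there. *)
Theorem theorem1 (R : realType) (M : surface R) (omega : form_family M)
    (f : M -> R) (O : M)
    (area_omega : area_form omega)
    (smooth_f : smooth_fun f)
    (bd_O : boundary M O)
    (reg_O : regular_point f O)
    (crit_O : nondegenerate_boundary_critical_point f O) :
  exists c : chart R M,
    let U := chart_dom c in
    let p := fun m => (chart_map c m).1 in
    let q := fun m => (chart_map c m).2 in
    [/\ smooth_chart c,
        [/\ U O, p O = 0 & q O = 0],
        (forall m, U m -> 0 <= q m) /\
          boundary M `&` U = [set m | U m /\ q m = 0],
        form_eq_on U omega (wedge_diff p q) &
        exists (S : M -> R) (alpha : R -> R) (B : set R),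
          [/\ (S = fun m => q m + p m ^+ 2) \/ (S = fun m => q m - p m ^+ 2),
              [/\ open B, B 0 & smooth_on B (alpha : R^o -> R^o)],
              derive1 (alpha : R -> R^o) 0 != 0 &
              forall m, U m -> B (S m) /\ f m = alpha (S m)]].
Proof.
have [two_w smooth_w nz_w] := area_omega.
have [c0 [ac0 dO yO0 crit1 crit2]] := crit_O.
have [x0 x0E] : exists x0 : plane R, x0 = chart_map c0 O by eexists.
have x02 : x0.2 = 0 by rewrite x0E.
have img0 : chart_img c0 x0 by rewrite x0E; exists O.
have img_near := chart_img_near dO; rewrite -x0E in img_near.
have half0 : half_plane x0 by rewrite x0E; exact: chart_half.
have invx0 : chart_inv c0 x0 = O by rewrite x0E chart_mapK.
have [F [sF FE]] := smooth_within_scalar (smooth_f c0 ac0) img0.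
have [rr [srr rE]] := smooth_within_scalar (smooth_w c0 e1 e2 ac0) img0.
have FH : \forall y \near x0, half_plane y -> f (chart_inv c0 y) = F y.
  apply: (near_imp (near_and FE img_near)) => y [Fy iy] yH; exact: (Fy (iy yH)).
have x0pair : (x0.1, 0) = x0 by rewrite -x02; case: (x0).
have shift0 : ((0 : plane R).1 + x0.1, (0 : plane R).2 + x0.2) = x0.
  by rewrite /= !add0r; case: (x0).
(* f0 and r0 are f and the density of omega in coordinates centered at O. *)
have [f0 f0E] : exists f0 : plane R -> R^o, f0 = (fun z => F (z.1 + x0.1, z.2 + x0.2)) by eexists.
have [r0 r0E] : exists r0 : plane R -> R^o, r0 = (fun z => rr (z.1 + x0.1, z.2 + x0.2)) by eexists.
have sf0 : smooth_near 0 f0 by rewrite f0E; apply: smooth_near_shift; rewrite shift0.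
have sr0 : smooth_near 0 r0 by rewrite r0E; apply: smooth_near_shift; rewrite shift0.
have r00 : r0 0 != 0.
  rewrite r0E shift0 -(nbhs_singleton rE img0) invx0.
  have [u [v]] := nz_w c0 O ac0 dO; rewrite (two_form_det u v two_w ac0 dO).
  by apply: contra => /eqP ->; rewrite mulr0.
have bdE : \forall t \near (x0.1 : R^o), on_boundary c0 f t = F (t, 0).
  have n := near_comp2 (smooth_at_id (x0.1 : R^o)) (smooth_at_cst (x0.1 : R^o) 0) x0pair FH.
  by apply: (near_imp n) => t; apply; exact: lexx.
have df0 k : derive1n k (fun x : R => f0 (x, 0) : R) 0 =
    derive1n k (on_boundary c0 f : R -> R) x0.1.
  rewrite (nbhs_singleton (derive1n_near k bdE)).
  have -> : (fun x : R => f0 (x, 0) : R) = (fun x : R => F (x + x0.1, 0)).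
    by apply/funext => x; rewrite f0E /= x02 addr0.
  by have := derive1n_shift k (fun t : R => F (t, 0) : R) x0.1 0; rewrite add0r.
have f01 : derive1 (fun x : R => f0 (x, 0) : R) 0 = 0.
  by rewrite [LHS](df0 1%N) x0E.
have f02 : derive1n 2 (fun x : R => f0 (x, 0) : R) 0 != 0 by rewrite df0 x0E.
have sFx0 : smooth_at x0 F by exact: smooth_near_at.
have sFx0s : smooth_at ((0 : plane R).1 + x0.1, (0 : plane R).2 + x0.2) F by rewrite shift0.
have dfv v : 'd f0 0 v = 'd F x0 v.
  rewrite f0E; apply: (etrans (diff_shift v sFx0s)).
  exact: (congr1 (fun x : plane R => 'd F x v) shift0).
have dF1 : 'd F x0 e1 = 0.
  rewrite -dfv -[RHS]f01; apply: esym; exact: (derive1_slice (smooth_near_at sf0)).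
(* As F is critical along the edge, its regularity is that of the normal
   derivative. *)
have dF2 : 'd f0 0 e2 != 0.
  have [c1 [ac1 d1O [u]]] := reg_O.
  have sFm : smooth_at (chart_map c0 O) F by rewrite -x0E.
  have FHm : \forall y \near chart_map c0 O, half_plane y -> f (chart_inv c0 y) = F y.
    by rewrite -x0E.
  rewrite /diff_in (half_diff_transition u (atlas_compatible ac1 ac0) d1O dO sFm FHm).
  rewrite -x0E => /eqP du; apply/eqP => E; apply: du.
  have aux (k l m n : R) : m = 0 -> n = 0 -> k * m + l * n = 0.
    by move=> -> ->; rewrite !mulr0 addr0.
  exact: (etrans (diff_plane _ _ _) (aux _ _ _ _ dF1 (etrans (esym (dfv e2)) E))).
have [eps [epsE [p [q [a [b [alpha [[sp sq p0 q0] [sa sb a0 b0] [abpq pqab]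
  [salpha dalpha falpha] [area sgn]]]]]]]]] := local_normal_form sf0 sr0 r00 dF2 f01 f02.
have [B [oB B0 BP]] := near_open salpha.
have nB : \forall z \near (0 : plane R), B (q z + eps * p z ^+ 2).
  have nB0 : \forall t \near (0 : R^o), B t by exact: open_nbhs_nbhs.
  have sS : smooth_near 0 (fun z => q z + eps * p z ^+ 2).
    apply: smooth_nearD => //; apply: smooth_nearM; first exact: smooth_near_cst.
    exact: smooth_nearX.
  have S0 : q 0 + eps * p 0 ^+ 2 = 0 by rewrite q0 p0 expr0n mulr0 addr0.
  exact: (near_comp1 (smooth_near_at sS) S0 nB0).
have nsh (P : set (plane R)) : (\forall y \near x0, P y) ->
    \forall z \near (0 : plane R), P (z.1 + x0.1, z.2 + x0.2).
  have s1 : smooth_at (0 : plane R) (fun z : plane R => z.1 + x0.1).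
    by apply: smooth_atD; [exact: smooth_at_fst|exact: smooth_at_cst].
  have s2 : smooth_at (0 : plane R) (fun z : plane R => z.2 + x0.2).
    by apply: smooth_atD; [exact: smooth_at_snd|exact: smooth_at_cst].
  exact: (near_comp2 s1 s2 shift0).
have [N1 [oN1 N10 N1P]] := near_open
  (near_and (near_and (near_and (smooth_near_join sp) (smooth_near_join sq)) (near_and abpq falpha))
  (near_and (near_and area sgn) (near_and nB
    (near_and (nsh _ img_near) (near_and (nsh _ FE) (nsh _ rE)))))).
have [N2 [oN2 N20 N2P]] := near_open
  (near_and (near_and (smooth_near_join sa) (smooth_near_join sb)) pqab).
(* The map un takes O to the origin; th is the coordinate change (p, q) after un,
   and ps is its inverse, from A' to A. The sets A and A' are chosen for all
   identities between germs to hold at each of their points. *)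
pose un (y : plane R) : plane R := (y.1 + (- x0.1, - x0.2).1, y.2 + (- x0.1, - x0.2).2).
have un0 : un x0 = 0 by rewrite /un /= !subrr.
have unK y : ((un y).1 + x0.1, (un y).2 + x0.2) = y by rewrite /= !subrK; case: (y).
have Kun z : un (z.1 + x0.1, z.2 + x0.2) = z by rewrite /un /= !addrK; case: (z).
have un2 y : (un y).2 = y.2 by rewrite /un /= x02 subr0.
pose th1 y : R^o := p (un y).
pose th2 y : R^o := q (un y).
pose ps1 w : R^o := a w + x0.1.
pose ps2 w : R^o := b w + x0.2.
pose A := [set y | N1 (un y) /\ N2 (th1 y, th2 y)].
pose A' := [set w | N2 w /\ N1 (a w, b w)].
have sth y : N1 (un y) -> smooth_near y th1 /\ smooth_near y th2.
  move=> /N1P[[[spy sqy] _] _].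
  by split; [exact: (smooth_near_shift (a := (- x0.1, - x0.2)) spy)
            |exact: (smooth_near_shift (a := (- x0.1, - x0.2)) sqy)].
have sps w : N2 w -> smooth_near w ps1 /\ smooth_near w ps2.
  move=> /N2P[[saw sbw] _].
  by split; apply: smooth_nearD => //; exact: smooth_near_cst.
have abth y : N1 (un y) -> (a (th1 y, th2 y), b (th1 y, th2 y)) = un y.
  by move=> /N1P[[_ [[-> ->] _]] _]; case: (un y).
have psth y : N1 (un y) -> (ps1 (th1 y, th2 y), ps2 (th1 y, th2 y)) = y.
  by move=> /abth [Ea Eb]; rewrite /ps1 /ps2 Ea Eb; exact: unK.
have AT y : A y -> A' (th1 y, th2 y) /\ (ps1 (th1 y, th2 y), ps2 (th1 y, th2 y)) = y.
  by move=> [n1 n2]; split; [split => //; rewrite abth|exact: psth].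
have thps w : N2 w -> (th1 (ps1 w, ps2 w), th2 (ps1 w, ps2 w)) = w.
  move=> /N2P[_ [Ep Eq]].
  have -> : th1 (ps1 w, ps2 w) = p (a w, b w) by rewrite /th1 (Kun (a w, b w)).
  have -> : th2 (ps1 w, ps2 w) = q (a w, b w) by rewrite /th2 (Kun (a w, b w)).
  by rewrite Ep Eq; case: (w).
have AP w : A' w -> A (ps1 w, ps2 w) /\ (th1 (ps1 w, ps2 w), th2 (ps1 w, ps2 w)) = w.
  move=> [n2 n1]; split; last exact: thps.
  by split; [rewrite (Kun (a w, b w))|rewrite thps].
have oA : open A.
  apply: open_near => y [n1 n2].
  have s1 : smooth_at y (fun z : plane R => z.1 + - x0.1).
    by apply: smooth_atD; [exact: smooth_at_fst|exact: smooth_at_cst].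
  have s2 : smooth_at y (fun z : plane R => z.2 + - x0.2).
    by apply: smooth_atD; [exact: smooth_at_snd|exact: smooth_at_cst].
  have [st1 st2] := sth y n1.
  have nN1 : \forall z \near un y, N1 z by exact: open_nbhs_nbhs.
  have nN2 : \forall z \near (th1 y, th2 y), N2 z by exact: open_nbhs_nbhs.
  exact: (near_and (near_comp2 s1 s2 erefl nN1)
    (near_comp2 (smooth_near_at st1) (smooth_near_at st2) erefl nN2)).
have oA' : open A'.
  apply: open_near => w [n2 n1]; have [[saw sbw] _] := N2P _ n2.
  have nN1 : \forall z \near (a w, b w), N1 z by exact: open_nbhs_nbhs.
  have nN2 : \forall z \near w, N2 z by exact: open_nbhs_nbhs.
  exact: (near_and nN2 (near_comp2 (smooth_near_at saw) (smooth_near_at sbw) erefl nN1)).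
have sgnA y : A y -> (0 <= th2 y) = (0 <= y.2) /\ (th2 y == 0) = (y.2 == 0).
  by move=> [/N1P[_ [[_ sg] _]] _]; rewrite -(un2 y).
have TH y : A y -> half_plane ((th1 y, th2 y) : plane R) <-> half_plane y.
  by move=> /sgnA[E _]; rewrite /half_plane /= E.
have AI y : A y -> half_plane y -> chart_img c0 y.
  by move=> [/N1P[_ [_ [_ [i _]]]] _]; move: i; rewrite unK.
have cT y : A y -> {for y, continuous (fun y => (th1 y, th2 y) : plane R)}.
  move=> [n1 _]; have [st1 st2] := sth y n1.
  exact: continuous_pair (smooth_near_at st1) (smooth_near_at st2).
have cP w : A' w -> {for w, continuous (fun w => (ps1 w, ps2 w) : plane R)}.
  move=> [n2 _]; have [st1 st2] := sps w n2.
  exact: continuous_pair (smooth_near_at st1) (smooth_near_at st2).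
have [c [dE mE iE]] := chart_reparam oA AT AP oA' TH cT cP AI.
exists c; rewrite /= dE mE.
have Ax0 : A x0.
  have t1 : th1 x0 = 0 by rewrite /th1 un0.
  have t2 : th2 x0 = 0 by rewrite /th2 un0.
  by split; [rewrite un0|rewrite t1 t2].
have imgU m : chart_dom c0 m -> chart_img c0 (chart_map c0 m) by exists m.
split.
- apply: (smooth_reparam ac0 dE mE iE (A' := A')); last by move=> w [/sps].
  by move=> y Ay; have [A'y E] := AT y Ay; have [n1 _] := Ay; have [s1 s2] := sth y n1.
- split.
  + by split; [exact: dO|rewrite -x0E].
  + by rewrite /= -x0E /th1 un0.
  + by rewrite /= -x0E /th2 un0.
- split.
    move=> m [cm Am]; rewrite (sgnA _ Am).1; exact: chart_half.
  apply/seteqP; split=> [m [[d [ad dm d0]] [cm Am]]|m [[cm Am] /eqP qm]].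
    split=> //; apply/eqP; rewrite (sgnA _ Am).2; apply/eqP.
    exact: (boundary_invariant (atlas_compatible ac0 ad) (atlas_compatible ad ac0) cm dm d0).
  split=> //; exists c0; split=> //.
  by apply/eqP; rewrite -(sgnA _ Am).2.
- move=> d m u v ad dm [cm Am].
  have [n1 n2] := Am.
  have [[[spy sqy] _] [[areaz _] [_ [_ [_ rz]]]]] := N1P _ n1.
  rewrite unK in rz.
  have [st1 st2] := sth _ n1.
  have thn (t : plane R -> R^o) : \forall y \near chart_map c0 m, half_plane y ->
      (t \o chart_map c0) (chart_inv c0 y) = t y.
    apply: (near_imp (chart_img_near cm)) => y iy yH.
    by rewrite /=; have [_ ->] := chart_invK (iy yH).
  have dth (t : plane R -> R^o) k : smooth_near (chart_map c0 m) t ->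
      diff_in d (t \o chart_map c0) m k =
      'd t (chart_map c0 m) (half_diff (transition d c0) (chart_map d m) k).
    move=> st; exact: (half_diff_transition k (atlas_compatible ad ac0) dm cm
      (smooth_near_at st) (thn t)).
  rewrite (two_form_change two_w u v ad ac0 dm cm) (two_form_det _ _ two_w ac0 cm).
  rewrite /wedge_diff.
  have D1 k := dth th1 k st1; have D2 k := dth th2 k st2.
  have p1 k : 'd th1 (chart_map c0 m) k = 'd p (un (chart_map c0 m)) k.
    exact: (diff_shift (a := (- x0.1, - x0.2)) k (smooth_near_at spy)).
  have p2 k : 'd th2 (chart_map c0 m) k = 'd q (un (chart_map c0 m)) k.
    exact: (diff_shift (a := (- x0.1, - x0.2)) k (smooth_near_at sqy)).
  have E1 k : diff_in d (th1 \o chart_map c0) m k =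
    (half_diff (transition d c0) (chart_map d m) k).1 * 'd p (un (chart_map c0 m)) e1 +
    (half_diff (transition d c0) (chart_map d m) k).2 * 'd p (un (chart_map c0 m)) e2.
    exact: (etrans (D1 k) (etrans (p1 _) (diff_plane _ _ _))).
  have E2 k : diff_in d (th2 \o chart_map c0) m k =
    (half_diff (transition d c0) (chart_map d m) k).1 * 'd q (un (chart_map c0 m)) e1 +
    (half_diff (transition d c0) (chart_map d m) k).2 * 'd q (un (chart_map c0 m)) e2.
    exact: (etrans (D2 k) (etrans (p2 _) (diff_plane _ _ _))).
  have rho_m : omega c0 m e1 e2 =
      'd p (un (chart_map c0 m)) e1 * 'd q (un (chart_map c0 m)) e2 -
      'd p (un (chart_map c0 m)) e2 * 'd q (un (chart_map c0 m)) e1.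
    by rewrite areaz r0E unK -rz ?chart_mapK //; exact: imgU.
  have aux (u1 u2 v1 v2 P1 P2 Q1 Q2 w Du Dv Eu Ev : R) : w = P1 * Q2 - P2 * Q1 ->
    Du = u1 * P1 + u2 * P2 -> Dv = v1 * P1 + v2 * P2 ->
    Eu = u1 * Q1 + u2 * Q2 -> Ev = v1 * Q1 + v2 * Q2 ->
    (u1 * v2 - u2 * v1) * w = Du * Ev - Dv * Eu.
    by move=> -> -> -> -> ->; ring.
  exact: (aux _ _ _ _ _ _ _ _ _ _ _ _ _ rho_m (E1 u) (E1 v) (E2 u) (E2 v)).
- exists (fun m => th2 (chart_map c0 m) + eps * th1 (chart_map c0 m) ^+ 2), alpha, B; split.
  + case: epsE => ->; [left|right]; apply/funext => m /=; first by rewrite mul1r.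
    by rewrite mulN1r.
  + split=> //; exact: smooth_at_on.
  + exact: dalpha.
  + move=> m [cm Am]; have [n1 _] := Am.
    have [[_ [_ fz]] [_ [Bz [_ [Fz _]]]]] := N1P _ n1.
    rewrite unK in Fz; split; first exact: Bz.
    rewrite -[RHS]fz f0E unK -Fz; [by rewrite /= chart_mapK|exact: imgU].
Qed.
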